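(* Let $m$ and $n$ be integers such that $2\le m\le n-1$. Suppose the distribution function $F$ is absolutely continuous. Then $F$ is exponential, i.e. $F(x)=1-e^{-c(x-l_F)}$ for $x\ge l_F$ with some constant $c>0$, if and only if for all $l_F<u<v$ $$E\left[R_n-(n-m)R_m\mid R_{m-1}=u,\ R_{n+1}=v\right]=E\left[R_m-(n-m)R_{m-1}\mid R_{m-1}=u,\ R_{n+1}=v\right].$$
   Context: Let $X_1,X_2,\ldots$ be independent copies of a random variable $X$ with distribution function $F$, absolutely continuous with respect to Lebesgue measure. The record times are $T_1=1$ and $T_n=\min\{j: j>T_{n-1},\ X_j>X_{T_{n-1}}\}$ for $n>1$, and the (upper) record values are $R_n=X_{T_n}$, $n=1,2,\ldots$. The number $l_F>-\infty$ denotes the left endpoint of the support of $F$. *)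

(* Defs.v *)
From mathcomp Require Import all_boot all_order all_algebra.
From mathcomp Require Import all_classical all_reals all_analysis.
Import Order.TTheory GRing.Theory Num.Theory.
Import numFieldNormedType.Exports.

Set Implicit Arguments.
Unset Strict Implicit.
Unset Printing Implicit Defensive.

Local Open Scope classical_set_scope.
Local Open Scope ring_scope.

Definition mutually_independent d (T : measurableType d) (R : realType)
    (P : probability T R) (X : nat -> T -> R) : Prop :=
  forall (s : seq nat) (A : nat -> set R), uniq s ->
    (forall i, measurable (A i)) ->
    P (\bigcap_(i in [set` s]) (X i @^-1` A i)) =
    (\prod_(i <- s) P (X i @^-1` A i))%E.

(* The least j > k with x j > x k. If x k is never exceeded after time k, the
   value is k; for iid variables with a continuous distribution function this
   happens with probability 0. *)
Definition next_record (R : realType) (x : nat -> R) (k : nat) : nat :=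
  match pselect (exists j, (k < j)%N && (x k < x j)) with
  | left ex => ex_minn ex
  | right _ => k
  end.

(* Observations and records are both numbered from 1: T_1 = 1 is
   [record_time x 1], the term x 0 is never used, and [record_time x 0] is
   meaningless. *)
Definition record_time (R : realType) (x : nat -> R) (n : nat) : nat :=
  iter n.-1 (next_record x) 1%N.

Definition record_value (R : realType) (T : Type) (X : nat -> T -> R)
    (n : nat) (w : T) : R :=
  X (record_time (X ^~ w) n) w.

Definition df_support (R : realType) (F : R -> R) : set R :=
  [set x | forall e : R, 0 < e -> F (x - e) < F (x + e)].

Definition left_endpoint (R : realType) (F : R -> R) : \bar R :=
  ereal_inf (EFin @` df_support F).

(* [g] is a version of z |-> E[Y | Z = z] for a nonnegative Y, which need not
   be integrable: g(Z) = E[Y | sigma(Z)] almost surely. *)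
Definition cond_expect_ge0 d d' (T : measurableType d) (S : measurableType d')
    (R : realType) (P : probability T R) (Y : T -> R) (Z : T -> S)
    (g : S -> R) : Prop :=
  [/\ measurable_fun [set: S] g,
      forall z, 0 <= g z &
      forall B : set S, measurable B ->
        (\int[P]_(w in Z @^-1` B) (Y w)%:E =
         \int[P]_(w in Z @^-1` B) (g (Z w))%:E)%E].

(* [g] is a version of z |-> E[Y | Z = z] := E[Y^+ | Z = z] - E[Y^- | Z = z].
   Both terms are required to be finite, but Y itself need not be integrable:
   record values can have infinite mean, even when their conditional
   expectations given a lower and a higher record are finite. *)
Definition cond_expect d d' (T : measurableType d) (S : measurableType d')
    (R : realType) (P : probability T R) (Y : T -> R) (Z : T -> S)
    (g : S -> R) : Prop :=
  exists gp gn : S -> R,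
    [/\ cond_expect_ge0 P (fun w => Num.max (Y w) 0) Z gp,
        cond_expect_ge0 P (fun w => Num.max (- Y w) 0) Z gn &
        forall z, g z = gp z - gn z].

(* Main.v *)
(* With H = - ln (1 - F), the transformed observations H(X_j) are standard
   exponential, and the transformed records are partial sums of independent
   standard exponential variables. Given that the records m - 1 and n + 1 sit at
   a and v in this scale, the intermediate records m and n have densities
   proportional to (v - s)^N and (s - a)^N on [a, v], where N = n - m. For the
   quantile function g = H^-1 the condition therefore becomes, for a < v,

     int_a^v (g s + N g a) (s - a)^N ds = (N + 1) int_a^v g s (v - s)^N ds,

   first almost everywhere and then everywhere by left continuity of g. An
   affine g satisfies it. Conversely the equation makes g continuous, and
   differentiating it in v and then in a gives g'(a) (v - a) = g v - g a, so that
   g is affine and F is exponential. Records need not have a mean, so all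
   integrals are taken over nonnegative functions, the two sides being
   rearranged so that nothing infinite is subtracted. *)
From HB Require Import structures.
Require Import Defs.
From mathcomp Require Import all_boot all_order all_algebra.
From mathcomp Require Import all_classical all_reals all_analysis.
From mathcomp Require Import measurable_realfun.
From mathcomp Require Import zify ring lra.
Import Order.TTheory GRing.Theory Num.Theory.
Import numFieldNormedType.Exports.

Set Implicit Arguments.
Unset Strict Implicit.
Unset Printing Implicit Defensive.

Local Open Scope classical_set_scope.
Local Open Scope ring_scope.

(** * Laws and independence of the past *)

(** The records become sums by lack of memory: after a record at x, the next one is an observation
    conditioned to exceed x, and in the scale H its excess over H x is standard exponential whatever
    x is. Record times are stopping times, so this is proved by summing over their values;
    conditioning is replaced by measures restricted to past events and by uniqueness of product
    measures.

    Three obstacles shape the rest. F may be constant on intervals, so g inverts H only on a set of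
    full probability and may jump; identities between functions of (a, v) are therefore tested on
    small rectangles to the left of the point. Records may have no mean, so Radon-Nikodym is applied
    to Y divided by a function of Z. Finally g has a meaning only on positive arguments; cut off at
    a level q > 0 and shifted, it becomes nonnegative and monotone on the whole line.

    The difference of the two combinations in the theorem is (R_n - R_(m-1)) - (N + 1) (R_m -
    R_(m-1)). Constants cancel in it, which permits the shift; for exponential F it consists of
    gaps, which are integrable. *)

Section event_law.
Context (R : realType) d d1 (T : measurableType d) (S1 : measurableType d1).
Variables (P : probability T R) (A : set T) (U : T -> S1).

(** The law of [U] on the event [A] is not divided by the probability of [A], so null events need no
    separate treatment. The measurability proofs are arguments so that the measure structure can be
    attached to the definition. *)
Definition event_law (mA : measurable A) (mU : measurable_fun setT U)
  (B : set S1) : \bar R := P (A `&` U @^-1` B).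

Variables (mA : measurable A) (mU : measurable_fun setT U).

Lemma measurable_preimageT (B : set S1) :
  measurable B -> measurable (U @^-1` B).
Proof. by move=> mB; rewrite -[X in measurable X]setTI; exact: mU. Qed.

Let event_law0 : event_law mA mU set0 = 0%E.
Proof. by rewrite /event_law preimage_set0 setI0 measure0. Qed.

Let event_law_ge0 B : (0 <= event_law mA mU B)%E.
Proof. exact: measure_ge0. Qed.

Let event_law_sigma_additive : semi_sigma_additive (event_law mA mU).
Proof.
move=> F mF tF mUF; rewrite /event_law preimage_bigcup setI_bigcupr.
apply: measure_semi_sigma_additive.
- by move=> n; apply: measurableI => //; exact: measurable_preimageT.
- apply/trivIsetP => /= i j _ _ ij; rewrite setIACA -preimage_setI.
  by move/trivIsetP : tF => /(_ _ _ _ _ ij) ->//; rewrite preimage_set0 setI0.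
- apply: bigcup_measurable => i _.
  by apply: measurableI => //; exact: measurable_preimageT.
Qed.

HB.instance Definition _ := isMeasure.Build _ _ _ (event_law mA mU)
  event_law0 event_law_ge0 event_law_sigma_additive.

Let event_law_fin : fin_num_fun (event_law mA mU).
Proof.
move=> B mB; apply: fin_num_measure; apply: measurableI => //.
exact: measurable_preimageT.
Qed.

HB.instance Definition _ := Measure_isFinite.Build _ _ _ (event_law mA mU)
  event_law_fin.

End event_law.

Lemma ge0_integral_event_law (R : realType) d d1 (T : measurableType d)
    (S1 : measurableType d1) (P : probability T R) (U : T -> S1)
    (mU : measurable_fun setT U) (f : S1 -> \bar R) :
  measurable_fun setT f -> (forall y, 0 <= f y)%E ->
  (\int[event_law P measurableT mU]_y f y = \int[P]_w f (U w))%E.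
Proof.
move=> mf f0; pose nu0 : {measure set S1 -> \bar R} := pushforward P U.
transitivity (\int[nu0 mU]_y f y)%E.
  by apply: eq_measure_integral => B mB _; rewrite /= /event_law setTI.
by rewrite /nu0 ge0_integral_pushforward//= preimage_setT.
Qed.

(** A measure on the product with the right values on measurable rectangles is the product measure,
    so independence of [V] from [A] and [U] need only be checked on rectangles. *)
Lemma joint_law (R : realType) d d1 d2 (T : measurableType d)
    (S1 : measurableType d1) (S2 : measurableType d2) (P : probability T R)
    (nu : probability S2 R) (U : T -> S1) (V : T -> S2) (A : set T)
    (mA : measurable A) (mU : measurable_fun setT U)
    (mV : measurable_fun setT V) (C : set (S1 * S2)) :
  (forall B1 B2, measurable B1 -> measurable B2 ->
    P (A `&` U @^-1` B1 `&` V @^-1` B2) = (P (A `&` U @^-1` B1) * nu B2)%E) ->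
  measurable C ->
  P (A `&` (fun w => (U w, V w)) @^-1` C) =
  (event_law P mA mU \x nu)%E C.
Proof.
move=> UV mC.
have mUV : measurable_fun setT (fun w => (U w, V w)) by exact: measurable_fun_pair.
pose rho : {measure set (S1 * S2) -> \bar R} := event_law P mA mUV.
apply/esym; apply: (@product_measure_unique _ _ _ _ _ _ _ rho) => // B1 B2 mB1 mB2.
by rewrite /rho /= /event_law -UV// -setIA; congr (P (_ `&` _)).
Qed.

Section past.
Context (R : realType) d (T : measurableType d) (P : probability T R).
Variable X : nat -> {RV P >-> R}.
Hypothesis X_indep : mutually_independent P (fun j => X j.+1 : T -> R).

Definition cylinder (p : nat) : set (set T) :=
  [set A | exists2 B : nat -> set R, (forall i, measurable (B i)) &
     A = \bigcap_(i in `I_p) X i.+1 @^-1` B i].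

Definition past (p : nat) : set (set T) := <<s cylinder p >>.

Lemma measurable_RV j (B : set R) : measurable B -> measurable (X j @^-1` B).
Proof. by move=> mB; exact: measurable_funPTI. Qed.

Lemma cylinder_measurable p : cylinder p `<=` measurable.
Proof.
move=> _ [B mB ->]; apply: bigcap_measurableType => i _; exact: measurable_RV.
Qed.

Lemma past_measurable p A : past p A -> measurable A.
Proof.
move: A; apply: smallest_sub; first exact: sigma_algebra_measurable.
exact: cylinder_measurable.
Qed.

Lemma cylinder_setI p : setI_closed (cylinder p).
Proof.
move=> _ _ [B mB ->] [C mC ->]; exists (fun i => B i `&` C i).
  by move=> i; exact: measurableI.
by rewrite -bigcapI; apply: eq_bigcapr => i _; rewrite preimage_setI.
Qed.

Lemma past_cylinder p q (B : nat -> set R) : (p <= q)%N ->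
  (forall i, measurable (B i)) -> past q (\bigcap_(i in `I_p) X i.+1 @^-1` B i).
Proof.
move=> pq mB; apply: sub_sigma_algebra; exists (fun i => if (i < p)%N then B i else setT).
  by move=> i; case: ifP.
apply/seteqP; split=> [w Bw j /= jq|w Bw j /= jp].
  by case: ifPn => // jp; exact: Bw.
by have /= := Bw j (leq_trans jp pq); rewrite jp.
Qed.

Lemma past_sub p q A : (p <= q)%N -> past p A -> past q A.
Proof.
move=> pq; move: A; apply: smallest_sub; first exact: smallest_sigma_algebra.
by move=> _ [B mB ->]; exact: past_cylinder.
Qed.

Lemma pastT p : past p setT.
Proof. exact: (@measurableT _ (g_sigma_algebraType (cylinder p))). Qed.

Lemma past0 p : past p set0.
Proof. exact: (@measurable0 _ (g_sigma_algebraType (cylinder p))). Qed.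

Lemma pastI p A B : past p A -> past p B -> past p (A `&` B).
Proof. exact: (@measurableI _ (g_sigma_algebraType (cylinder p))). Qed.

Lemma past_bigcup p (D : set nat) (A : nat -> set T) :
  (forall i, D i -> past p (A i)) -> past p (\bigcup_(i in D) A i).
Proof.
exact: (@bigcup_measurable _ (g_sigma_algebraType (cylinder p))).
Qed.

Lemma past_bigcap p (D : set nat) (A : nat -> set T) :
  (forall i, D i -> past p (A i)) -> past p (\bigcap_(i in D) A i).
Proof.
exact: (@bigcap_measurableType _ (g_sigma_algebraType (cylinder p))).
Qed.

Lemma past_preimage p j (B : set R) : (0 < j <= p)%N -> measurable B ->
  past p (X j @^-1` B).
Proof.
move=> /andP[j0 jp] mB.
rewrite (_ : _ @^-1` _ =
  \bigcap_(i in `I_p) X i.+1 @^-1` (if i.+1 == j then B else setT)).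
  by apply: past_cylinder => // i; case: ifP.
apply/seteqP; split => [w Bw l /= _|w /(_ j.-1)]; first by case: eqP => // ->.
by rewrite /= prednK// eqxx; apply.
Qed.

Lemma past_measurable_fun p j : (0 < j <= p)%N ->
  measurable_fun setT (X j : g_sigma_algebraType (cylinder p) -> R).
Proof. by move=> jp _ B mB; rewrite setTI; exact: past_preimage. Qed.

Lemma past_preimage2 p i j (C : set (R * R)) : (0 < i <= p)%N ->
  (0 < j <= p)%N -> measurable C -> past p ((fun w => (X i w, X j w)) @^-1` C).
Proof.
move=> ip jp mC.
have := @measurable_fun_pair _ _ _ (g_sigma_algebraType (cylinder p)) R R _ _
  (past_measurable_fun ip) (past_measurable_fun jp) measurableT C mC.
by rewrite setTI.
Qed.

(** As functions of [A], both sides are finite measures. On cylinders they agree by mutual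
    independence, and cylinders generate [past p]. *)
Lemma past_indep p A (B : set R) : past p A -> measurable B ->
  P (A `&` X p.+1 @^-1` B) = (P A * P (X p.+1 @^-1` B))%E.
Proof.
move=> pA mB; have mXB := measurable_RV p.+1 mB.
pose c : {nonneg R} := NngNum (fine_ge0 (measure_ge0 P (X p.+1 @^-1` B))).
have cE : c%:num%:E = P (X p.+1 @^-1` B) by rewrite /= fineK ?fin_num_measure.
transitivity (mrestr P mXB A) => //; transitivity (mscale c P A); last first.
  by rewrite /mscale /= muleC; congr (_ * _)%E.
apply: (g_sigma_algebra_measure_unique (cylinder p) _ (fun=> setT)) pA.
- exact: cylinder_measurable.
- by move=> _; exists (fun=> setT) => //; rewrite bigcapT.
- by rewrite bigcup_const//; exists 0%N.
- exact: cylinder_setI.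
- move=> {}A [C mC ->]; rewrite /mscale /mrestr [RHS]muleC cE.
  pose C' i := if (i < p)%N then C i else B.
  have mC' i : measurable (C' i) by rewrite /C'; case: ifP.
  have := X_indep (iota_uniq 0 p.+1) mC'.
  rewrite -[in iota _ _]addn1 iotaD big_cat/= big_seq1 add0n {3}/C' ltnn => e.
  transitivity (P (\bigcap_(i in [set` iota 0 p ++ [:: p]]) X i.+1 @^-1` C' i)).
    congr (P _); apply/seteqP; split => [w [CC Bw] i /=|w Cw].
      rewrite mem_cat mem_iota add0n/= inE /C' => /orP[ip|/eqP ->].
        by rewrite ip; exact: CC.
      by rewrite ltnn.
    split => [i /= ip|]; last first.
      have := Cw p; rewrite /C' /= ltnn; apply.
      by rewrite mem_cat inE eqxx orbT.
    have := Cw i; rewrite /C' /= ip; apply.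
    by rewrite mem_cat mem_iota add0n ip.
  rewrite e; congr (_ * _)%E.
  rewrite -(X_indep (iota_uniq 0 p) mC'); congr (P _).
  apply/seteqP; split => [w Cw i /= ip|w Cw i].
    by have := Cw i; rewrite /= /C' mem_iota add0n/= ip; apply.
  by rewrite /= mem_iota add0n/= /C' => ip; rewrite ip; exact: Cw.
- by move=> _; rewrite /= /mrestr; apply: (le_lt_trans (probability_le1 _ _));
    rewrite ?ltry//; apply: measurableI.
Qed.

(* Conditionally on the first p observations, X_{p+1} keeps its law. *)
Lemma past_xsection p j A (C C' : set (R * R)) (V : set R) (c : R) :
  (0 < j <= p)%N -> past p A -> measurable C -> measurable C' -> 0 <= c ->
  measurable V -> P (X j @^-1` ~` V) = 0%E ->
  (forall x, V x -> distribution P (X p.+1) (xsection C x) =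
    (c%:E * distribution P (X p.+1) (xsection C' x))%E) ->
  P (A `&` (fun w => (X j w, X p.+1 w)) @^-1` C) =
  (c%:E * P (A `&` (fun w => (X j w, X p.+1 w)) @^-1` C'))%E.
Proof.
move=> jp pA mC mC' c0 mV V0 secE.
have mA := past_measurable pA.
have mXj : measurable_fun setT (X j) by [].
pose mu := event_law P mA mXj.
pose nu := distribution P (X p.+1).
have E D : measurable D -> P (A `&` (fun w => (X j w, X p.+1 w)) @^-1` D) =
    (\int[mu]_x nu (xsection D x))%E.
  move=> mD; rewrite -[RHS]/((mu \x nu)%E D); apply: joint_law => // B1 B2 mB1 mB2.
  by rewrite past_indep//; apply: pastI => //; exact: past_preimage.
rewrite !E// -ge0_integralZl//; last exact: measurable_fun_xsection.
apply: ae_eq_integral => //.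
- exact: measurable_fun_xsection.
- by apply: measurable_funeM; exact: measurable_fun_xsection.
exists (~` V); split => //.
- exact: measurableC.
- apply/eqP; rewrite -measure_le0 -V0 /mu /= /event_law.
  apply: le_measure; rewrite ?inE; last exact: subIsetr.
    by apply: measurableI => //; apply/measurable_RV/measurableC.
  by apply/measurable_RV/measurableC.
- by move=> x /= H Vx; apply: H => _; exact: secE.
Qed.

End past.

(** * Record times *)

Section record_times.
Context (R : realType).
Implicit Types x : nat -> R.

Definition successor_record x (l j : nat) : Prop :=
  [/\ (l < j)%N, forall i, (l < i < j)%N -> x i <= x l & x l < x j].

(* Records are numbered from 0 here: [rec_at x n j] means T_{n+1} = j, and
   fails for every j if there are at most n records. *)
Fixpoint rec_at x (n j : nat) : Prop :=
  if n is n'.+1 then exists2 l, rec_at x n' l & successor_record x l j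
  else j = 1%N.

(** The second disjunct is the default value of [next_record]. It excludes the first, because a
    successor lies strictly later; [rec_at] keeps only the first, so a repeated index never counts
    as a record. *)
Lemma next_recordP x l j : next_record x l = j <->
  successor_record x l j \/ (j = l /\ forall i, (l < i)%N -> x i <= x l).
Proof.
rewrite /next_record; case: pselect => [ex|nex]; last first.
  have nex' i : (l < i)%N -> x i <= x l.
    by move=> li; rewrite leNgt; apply/negP => xli; apply: nex; exists i; rewrite li.
  split=> [<-|[[lj _ xlj]|[->//]]]; first by right.
  by exfalso; apply: nex; exists j; rewrite lj.
case: ex_minnP => j' /andP[lj' xj'] minj'.
split=> [<-|[[lj xj xlj]|[_ nex]]].
- left; split=> // i /andP[li ij']; rewrite leNgt; apply/negP => xli.
  by have := minj' i; rewrite li xli leqNgt ij' => /(_ isT).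
- apply/eqP; rewrite eqn_leq minj' ?lj// leqNgt; apply/negP => j'j.
  by have := xj j'; rewrite lj' j'j leNgt xj' => /(_ isT).
- by have := nex _ lj'; rewrite leNgt xj'.
Qed.

Lemma rec_at_time x n j : rec_at x n j -> record_time x n.+1 = j.
Proof.
rewrite /record_time /=; elim: n j => [|n IH] j /=; first by move->.
by move=> [l /IH -> lj]; apply/next_recordP; left.
Qed.

Lemma rec_at_uniq x n i j : rec_at x n i -> rec_at x n j -> i = j.
Proof. by move=> /rec_at_time <- /rec_at_time <-. Qed.

Lemma rec_at_gt0 x n j : rec_at x n j -> (0 < j)%N.
Proof. by case: n => [->//|n [l _ [+ _ _]]]; case: j. Qed.

Lemma next_record_ge x k : (k <= next_record x k)%N.
Proof. by have [[/ltnW//]|[->]] := (next_recordP x k _).1 erefl. Qed.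

Lemma le_next_record x k : x k <= x (next_record x k).
Proof. by have [[_ _ /ltW//]|[->]] := (next_recordP x k _).1 erefl. Qed.

Lemma record_time_gt0 x k : (0 < record_time x k)%N.
Proof.
rewrite /record_time; elim: k.-1 => //= i; move/leq_trans; apply.
exact: next_record_ge.
Qed.

End record_times.

Lemma le_set_measurable (R : realType) : measurable [set z : R * R | z.1 <= z.2].
Proof.
rewrite (_ : mkset _ = (fun z : R * R => z.2 - z.1) @^-1` `[0, +oo[).
  rewrite -[X in measurable X]setTI; apply: measurable_funB => //.
by apply/seteqP; split => z /=; rewrite in_itv/= andbT subr_ge0.
Qed.

Lemma lt_set_measurable (R : realType) : measurable [set z : R * R | z.1 < z.2].
Proof.
rewrite (_ : mkset _ = (fun z : R * R => z.2 - z.1) @^-1` `]0, +oo[).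
  rewrite -[X in measurable X]setTI; apply: measurable_funB => //.
by apply/seteqP; split => z /=; rewrite in_itv/= andbT subr_gt0.
Qed.

(** * Record times as stopping times *)

Section record_events.
Context (R : realType) d (T : measurableType d) (P : probability T R).
Variable X : nat -> {RV P >-> R}.

Definition rec_event (n j : nat) : set T := [set w | rec_at (X ^~ w) n j].

Lemma past_le p i j : (0 < i <= p)%N -> (0 < j <= p)%N ->
  past X p [set w | X i w <= X j w].
Proof. by move=> ip jp; exact: (past_preimage2 ip jp (@le_set_measurable R)). Qed.

Lemma past_lt p i j : (0 < i <= p)%N -> (0 < j <= p)%N ->
  past X p [set w | X i w < X j w].
Proof. by move=> ip jp; exact: (past_preimage2 ip jp (@lt_set_measurable R)). Qed.

Lemma rec_eventS n j : rec_event n.+1 j =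
  \bigcup_(l in [set l | (0 < l < j)%N]) (rec_event n l `&`
    \bigcap_(i in [set i | (l < i < j)%N]) [set w | X i w <= X l w] `&`
    [set w | X l w < X j w]).
Proof.
apply/seteqP; split => [w [l rl [lj le lt]]|w [l /andP[l0 lj] [[rl le] lt]]].
  by exists l => /=; [rewrite lj (rec_at_gt0 rl)|split=> //; split].
by exists l => //; split.
Qed.

(** Record times are stopping times: by [rec_eventS] the event is a union, over the time of the
    preceding record, of comparisons among X_1, ..., X_j. *)
Lemma past_rec_event n j : past X j (rec_event n j).
Proof.
elim: n j => [|n IH] j.
  have [->|j1] := eqVneq j 1%N.
    by rewrite (_ : rec_event _ _ = setT); [exact: pastT|apply/seteqP; split].
  rewrite (_ : rec_event _ _ = set0); first exact: past0.
  by apply/seteqP; split => // w /= /eqP; rewrite (negbTE j1).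
rewrite rec_eventS; apply: past_bigcup => l /= /andP[l0 lj].
apply: pastI; last by apply: past_lt; rewrite ?l0 ?(ltnW lj)//= leqnn (leq_ltn_trans _ lj).
apply: pastI; first by apply: (past_sub (ltnW lj)); exact: IH.
apply: past_bigcap => i /= /andP[li ij].
by apply: past_le; rewrite ?l0 ?(ltnW lj)//= (ltnW ij) andbT (leq_ltn_trans _ li).
Qed.

Lemma measurable_rec_event n j : measurable (rec_event n j).
Proof. by apply: (@past_measurable _ _ _ P X j); exact: past_rec_event. Qed.

Lemma trivIset_rec_event n : trivIset setT (rec_event n).
Proof. by apply/trivIsetP => i j _ _ /eqP ij; apply/seteqP; split => // w [/rec_at_uniq ri /ri]. Qed.

Lemma record_value_rec_event n j w : rec_event n j w ->
  record_value (fun j => X j : T -> R) n.+1 w = X j w.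
Proof. by move=> /rec_at_time; rewrite /record_value => ->. Qed.

(** The default value of [next_record] depends on the whole future, so this event need not lie in
    any [past]. Plain measurability is enough to make record values measurable on the whole
    space. *)
Lemma measurable_record_time n j :
  measurable [set w | record_time (X ^~ w) n = j].
Proof.
have mle i l : measurable [set w | X i w <= X l w].
  have -> : [set w | X i w <= X l w] = (fun w => (X i w, X l w)) @^-1` [set z | z.1 <= z.2] by [].
  rewrite -[X in measurable X]setTI.
  by apply: measurable_fun_pair => //; exact: le_set_measurable.
have mlt i l : measurable [set w | X i w < X l w].
  have -> : [set w | X i w < X l w] = (fun w => (X i w, X l w)) @^-1` [set z | z.1 < z.2] by [].
  rewrite -[X in measurable X]setTI.
  by apply: measurable_fun_pair => //; exact: lt_set_measurable.
have mnext l i : measurable [set w | next_record (X ^~ w) l = i].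
  rewrite (_ : mkset _ =
      [set w | successor_record (X ^~ w) l i] `|`
      [set w | i = l /\ forall q, (l < q)%N -> X q w <= X l w]); last first.
    by apply/seteqP; split => w; [move/next_recordP|move=> ?; apply/next_recordP].
  apply: measurableU.
    have [li|il] := ltnP l i; last first.
      by rewrite (_ : mkset _ = set0)//; apply/seteqP; split => // w [+ _ _]; rewrite ltnNge il.
    rewrite (_ : mkset _ =
      \bigcap_(q in [set q | (l < q < i)%N]) [set w | X q w <= X l w] `&` [set w | X l w < X i w]).
      by apply: measurableI => //; apply: bigcap_measurableType.
    by apply/seteqP; split => w; [case=> _ ? ?; split|case=> ? ?; split].
  have [->|/eqP il] := eqVneq i l; last first.
    by rewrite (_ : mkset _ = set0)//; apply/seteqP; split => // w [].
  rewrite (_ : mkset _ = \bigcap_(q in [set q | (l < q)%N]) [set w | X q w <= X l w]).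
    exact: bigcap_measurableType.
  by apply/seteqP; split => w; [case|].
rewrite /record_time; elim: n.-1 j => [|{}n IH] j /=.
  have [->|/eqP j1] := eqVneq 1%N j.
    by rewrite (_ : mkset _ = setT)//; apply/seteqP; split.
  by rewrite (_ : mkset _ = set0)//; apply/seteqP; split.
rewrite (_ : mkset _ = \bigcup_l ([set w | iter n (next_record (X ^~ w)) 1%N = l] `&`
    [set w | next_record (X ^~ w) l = j])).
  by apply: bigcup_measurable => l _; exact: measurableI.
by apply/seteqP; split => w /= => [h|[l _ [-> //]]]; eexists; split; [|exact: h].
Qed.

Lemma measurable_record_value n :
  measurable_fun setT (record_value (fun j => X j : T -> R) n).
Proof.
move=> _ B mB; rewrite setTI.
rewrite (_ : _ @^-1` _ =
  \bigcup_j ([set w | record_time (X ^~ w) n = j] `&` X j @^-1` B)).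
  apply: bigcup_measurable => j _; apply: measurableI; first exact: measurable_record_time.
  exact: measurable_RV.
by apply/seteqP; split => w /= => [h|[j _ [<- //]]]; eexists; split; [|exact: h].
Qed.

End record_events.

(** The density [p] and the Radon-Nikodym derivative have the same integrals over measurable sets,
    so they agree almost everywhere and the change of variables passes from one to the other. *)
Lemma ge0_integral_density d (S : measurableType d) (R : realType)
    (mu : {sigma_finite_measure set S -> \bar R})
    (nu : {finite_measure set S -> \bar R}) (p : S -> R)
    (mp : measurable_fun setT p) (p_ge0 : forall x, 0 <= p x)
    (nuE : forall A, measurable A -> nu A = (\int[mu]_(x in A) (p x)%:E)%E)
    (h : S -> \bar R) :
  measurable_fun setT h -> (forall x, 0 <= h x)%E ->
  (\int[nu]_x h x = \int[mu]_x (h x * (p x)%:E))%E.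
Proof.
move=> mh h0.
have mp' : measurable_fun setT (EFin \o p) by exact/measurable_EFinP.
have numu : nu `<< mu.
  apply/null_content_dominatesP => A mA muA0.
  rewrite nuE//; apply: null_set_integral => //; exact: measurable_funTS.
have fint := Radon_Nikodym_SigmaFinite.f_integrable numu.
rewrite -(Radon_Nikodym_SigmaFinite.change_of_variables numu)//.
apply: ae_eq_integral => //.
- by apply: emeasurable_funM => //; exact: measurable_int fint.
- exact: emeasurable_funM.
apply: ae_eqe_mul2l; apply: integral_ae_eq => // E _ mE.
by rewrite -(Radon_Nikodym_SigmaFinite.f_integral numu mE) nuE.
Qed.

(** * Gamma distributions *)

Section lebesgue_translation.
Context (R : realType).
Notation mu := (@lebesgue_measure R).

Lemma ge0_integral_shift (c : R) (h : R -> \bar R) :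
  measurable_fun setT h -> (forall x, 0 <= h x)%E ->
  (\int[mu]_x h (x + c)%R = \int[mu]_x h x)%E.
Proof.
move=> mh h0.
have mc : measurable_fun setT (fun x : R => x + c : measurableTypeR R).
  exact: measurable_funD.
pose nu0 : {measure set (measurableTypeR R) -> \bar R} :=
  pushforward mu (fun x : R => x + c : measurableTypeR R).
pose nu := nu0 mc.
have E A : measurable A -> mu A = nu A.
  apply: lebesgue_measure_unique => _ [[a b]] _ <-.
  rewrite /nu /nu0 /= /pushforward.
  rewrite (_ : _ @^-1` _ = `]a - c, b - c]%classic); last first.
    by apply/seteqP; split => x /=; rewrite !in_itv/= ltrBlDr lerBrDr.
  by rewrite !lebesgue_measure_itv/= !lte_fin ltrD2r -!EFinB opprB addrA subrK.
transitivity (\int[nu]_x h x)%E.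
  by rewrite /nu /nu0 ge0_integral_pushforward//= => x _; exact: h0.
by apply: eq_measure_integral => A mA _; apply/esym; exact: E.
Qed.

End lebesgue_translation.

Section gamma_distribution.
Context (R : realType).
Notation mu := (@lebesgue_measure R).

(* The density of a sum of n+1 independent standard exponential variables. *)
Definition gpdf (n : nat) (t : R) : R :=
  if 0 <= t then t ^+ n / n`!%:R * expR (- t) else 0.

Lemma gpdf_ge0 n t : 0 <= gpdf n t.
Proof.
rewrite /gpdf; case: ifP => // t0.
by rewrite mulr_ge0 ?expR_ge0// divr_ge0// exprn_ge0.
Qed.

Lemma measurable_gpdf n : measurable_fun setT (gpdf n).
Proof.
apply: measurable_fun_ifT => //.
  by apply: measurable_fun_ler.
apply: measurable_funM; first by apply: measurable_funM => //; exact: exprn_measurable.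
by apply: measurableT_comp => //; exact: measurable_oppr.
Qed.

Lemma integral_exprn n (v : R) : 0 <= v ->
  (\int[mu]_(t in `[0%R, v]) (t ^+ n)%:E = (v ^+ n.+1 / n.+1%:R)%:E)%E.
Proof.
rewrite le_eqVlt => /predU1P[<-|v0].
  by rewrite set_itv1 integral_set1 expr0n/= mul0r.
pose G (t : R) : R := t ^+ n.+1 / n.+1%:R.
have dG (t : R) : is_derive t 1 G (t ^+ n).
  rewrite (_ : G = (id ^+ n.+1 : R -> R) * cst (n.+1%:R^-1 : R)); last first.
    by apply/funext => x; rewrite /G !fctE.
  apply: is_derive_eq; rewrite scaler0 add0r /= /GRing.scale /= mulr1.
  by rewrite mulrA mulVf ?mul1r ?pnatr_eq0.
have cG : continuous G.
  by move=> x; apply/differentiable_continuous/derivable1_diffP; apply: ex_derive; exact: dG.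
rewrite (@continuous_FTC2 _ _ G 0 v v0).
- by rewrite /G expr0n mul0r sube0.
- by apply: continuous_subspaceT => x; exact: exprn_continuous.
- split.
  + by move=> x _; apply: ex_derive; exact: dG.
  + by apply: cvg_at_right_filter; exact: cG.
  + by apply: cvg_at_left_filter; exact: cG.
- by move=> x _; rewrite derive1E; apply: derive_val; exact: dG.
Qed.

(** On [0, v] the exponentials multiply to the constant [expR (- v)], which leaves the integral of a
    power; outside [0, v] one factor vanishes. *)
Lemma gpdf_conv n (v : R) :
  (\int[mu]_t (gpdf n t * gpdf 0 (v - t))%:E = (gpdf n.+1 v)%:E)%E.
Proof.
have [v0|v0] := ltP v 0.
  rewrite [in RHS]/gpdf leNgt v0/=; apply: integral0_eq => t _.
  rewrite /gpdf subr_ge0; case: ifPn => t0; rewrite ?mul0r//.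
  by rewrite leNgt (lt_le_trans v0)// mulr0.
transitivity (\int[mu]_(t in `[0%R, v]) ((t ^+ n)%:E * (expR (- v) / n`!%:R)%:E))%E.
  rewrite [RHS]integral_mkcond; apply: eq_integral => t _.
  rewrite patchE; case: ifPn => [|/negP]; rewrite inE/= in_itv/=.
    move=> /andP[t0 tv]; rewrite /gpdf t0 subr_ge0 tv expr0 fact0 divr1 mul1r -EFinM.
    by rewrite -!mulrA -expRD opprB addrA addNr add0r [expR _ / _]mulrC.
  move=> tv; rewrite -[point]/0%E /gpdf subr_ge0; case: ifPn => t0; rewrite ?mul0r//.
  by case: ifPn => tv'; rewrite ?mulr0//; exfalso; apply: tv; rewrite t0.
rewrite ge0_integralZr//; last 2 first.
- apply: measurable_funTS; apply/measurable_EFinP; exact: exprn_measurable.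
- by move=> t /=; rewrite in_itv/= => /andP[t0 _]; rewrite lee_fin exprn_ge0.
rewrite integral_exprn// -EFinM /gpdf v0 factS natrM invfM; congr (_%:E); ring.
Qed.

Lemma measurable_EFin_gpdf n : measurable_fun setT (EFin \o gpdf n).
Proof. by apply/measurable_EFinP; exact: measurable_gpdf. Qed.

Lemma integral_gpdf0 : (\int[mu]_t (gpdf 0 t)%:E = 1)%E.
Proof.
rewrite -(@integral_exponential_pdf R 1)//; apply: eq_integral => t _.
rewrite /gpdf /exponential_pdf patchE; case: ifPn => t0; last first.
  by rewrite memNset//= in_itv/= andbT; exact/negP.
by rewrite mem_set/= ?in_itv/= ?t0// expr0 fact0 divr1 mul1r mulN1r mul1r.
Qed.

Lemma measurable_gpdf_sub n : measurable_fun setT (fun z : R * R => gpdf n (z.1 - z.2)).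
Proof.
by apply: (@measurableT_comp _ _ _ _ _ _ (gpdf n)); [exact: measurable_gpdf|exact: measurable_funB].
Qed.

Lemma integral_gpdf n : (\int[mu]_t (gpdf n t)%:E = 1)%E.
Proof.
elim: n => [|n IH]; first exact: integral_gpdf0.
under eq_integral do rewrite -gpdf_conv.
pose f (z : R * R) : \bar R := (gpdf n z.2 * gpdf 0 (z.1 - z.2))%:E.
have mf : measurable_fun setT f.
  apply/measurable_EFinP; apply: measurable_funM; last exact: measurable_gpdf_sub.
  by apply: measurableT_comp => //; exact: measurable_gpdf.
have f0 z : (0 <= f z)%E by rewrite lee_fin mulr_ge0// gpdf_ge0.
rewrite (fubini_tonelli (m1 := mu) (m2 := mu) f)//.
rewrite -[RHS]IH; apply: eq_integral => t _; rewrite /f /=.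
under eq_integral do rewrite EFinM.
rewrite ge0_integralZl//; last 3 first.
- by apply/measurable_EFinP; apply: (measurableT_comp (@measurable_gpdf 0)); exact: measurable_funB.
- by move=> x _; rewrite lee_fin gpdf_ge0.
- by rewrite lee_fin gpdf_ge0.
rewrite (ge0_integral_shift (- t) (h := EFin \o gpdf 0)); last 2 first.
- exact: measurable_EFin_gpdf.
- by move=> x; rewrite lee_fin gpdf_ge0.
by rewrite [X in (_ * X)%E]integral_gpdf0 mule1.
Qed.

(* [lebesgue_measure] lives on [measurableTypeR R], a copy of [R] with another
   display; [gam] is the same law transported to [R]. *)
Definition gam_lebesgue (n : nat) (B : set (measurableTypeR R)) : \bar R :=
  (\int[mu]_(t in B) (gpdf n t)%:E)%E.

Let gam0 n : gam_lebesgue n set0 = 0%E.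
Proof. by rewrite /gam_lebesgue integral_set0. Qed.

Let gam_ge0 n A : (0 <= gam_lebesgue n A)%E.
Proof. by apply: integral_ge0 => x _; rewrite lee_fin gpdf_ge0. Qed.

Let gam_sigma_additive n : semi_sigma_additive (gam_lebesgue n).
Proof.
move=> F mF tF mUF; rewrite /gam_lebesgue; apply: cvg_toP.
  apply: ereal_nondecreasing_is_cvgn => i j ij.
  apply: lee_sum_nneg_natr => // k _ _; apply: integral_ge0 => x _.
  by rewrite lee_fin gpdf_ge0.
rewrite ge0_integral_bigcup//=.
- by apply: measurable_funTS; exact: measurable_EFin_gpdf.
- by move=> x _; rewrite lee_fin gpdf_ge0.
Qed.

HB.instance Definition _ n := isMeasure.Build _ _ _
  (gam_lebesgue n) (gam0 n) (@gam_ge0 n) (@gam_sigma_additive n).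

Let gam_setT n : gam_lebesgue n setT = 1%E.
Proof. exact: integral_gpdf. Qed.

HB.instance Definition _ n :=
  @Measure_isProbability.Build _ _ R (gam_lebesgue n) (gam_setT n).

Definition gam (n : nat) : set R -> \bar R := gam_lebesgue n.

HB.instance Definition _ n := isMeasure.Build _ R R
  (gam n) (gam0 n) (@gam_ge0 n) (@gam_sigma_additive n).

HB.instance Definition _ n :=
  @Measure_isProbability.Build _ R R (gam n) (gam_setT n).

Lemma ge0_integral_gam n (h : R -> \bar R) :
  measurable_fun setT h -> (forall x, 0 <= h x)%E ->
  (\int[gam n]_x h x = \int[mu]_x (h x * (gpdf n x)%:E))%E.
Proof.
move=> mh h0.
have mid : measurable_fun setT (fun x : measurableTypeR R => x : R).
  by move=> _ B mB; rewrite setTI.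
pose nu0 : {measure set R -> \bar R} :=
  pushforward (gam_lebesgue n) (fun x : measurableTypeR R => x : R).
transitivity (\int[nu0 mid]_x h x)%E; first exact: eq_measure_integral.
rewrite /nu0 ge0_integral_pushforward//= preimage_setT.
apply: (ge0_integral_density (mu := mu) (nu := gam_lebesgue n)) => //.
  exact: measurable_gpdf.
exact: gpdf_ge0.
Qed.

Lemma gam_gt0 (t : R) : 0 <= t -> gam 0 `]t, +oo[ = (expR (- t))%:E.
Proof.
move=> t0.
have E : gam 0 `[0, t] = (1 - (expR (- t))%:E)%E.
  move: t0; rewrite le_eqVlt => /predU1P[<-|t0].
    by rewrite set_itv1 /gam /gam_lebesgue integral_set1 oppr0 expR0 subee.
  rewrite -(mulN1r t) -exponential_prob_itv0c// /gam /gam_lebesgue /exponential_prob.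
  apply: eq_integral => x; rewrite inE/= in_itv/= => /andP[x0 _].
  by rewrite exponential_pdfE// /gpdf x0 expr0 fact0 divr1 !mul1r mulN1r.
have E0 : gam 0 `]-oo, 0[ = 0%E.
  rewrite /gam /gam_lebesgue integral0_eq// => x /=; rewrite in_itv/= => x0.
  by rewrite /gpdf leNgt x0.
have -> : `]t, +oo[%classic = ~` (`]-oo, 0[%classic `|` `[0, t]%classic).
  apply/seteqP; split => x /=; rewrite !in_itv/= andbT.
    by move=> tx [|/andP[_]]; [rewrite ltNge (le_trans t0 (ltW tx))|rewrite leNgt tx].
  move=> n; rewrite ltNge; apply/negP => xt; apply: n.
  by have [x0|x0] := ltP x 0; [left|right; rewrite xt].
rewrite probability_setC; last by apply: measurableU.
rewrite measureU//; last first.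
  by apply/seteqP; split => // x /=; rewrite !in_itv/= => -[x0 /andP[]]; rewrite leNgt x0.
by rewrite [X in (1 - (X + _))%E]E0 [X in (1 - (_ + X))%E]E add0e -!EFinB opprB addrC subrK.
Qed.

(* Both sides are the expectation of F (a, s, v) when s - a and v - s are
   independent gamma variables. *)
Lemma ge0_integral_gam2 i j (a : R) (f : R * R -> \bar R) :
  measurable_fun setT f -> (forall z, 0 <= f z)%E ->
  (\int[gam i]_x \int[gam j]_y f (a + x, a + x + y)%R =
   \int[mu]_v \int[mu]_s (f (s, v) * (gpdf i (s - a) * gpdf j (v - s))%:E))%E.
Proof.
move=> mf f0.
have mfx (x : R) : measurable_fun setT (fun y => f (x, y)).
  by apply: measurableT_comp => //; exact: measurable_pair1.
have inner x : (\int[gam j]_y f (a + x, a + x + y)%R =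
    \int[mu]_v (f ((a + x)%R, v) * (gpdf j (v - (a + x)))%:E))%E.
  rewrite (ge0_integral_gam j (h := fun y => f ((a + x)%R, (a + x + y)%R))); last 2 first.
  - by apply: (measurableT_comp (mfx _)); exact: measurable_funD.
  - by move=> y.
  rewrite -[RHS](ge0_integral_shift (a + x)); last 2 first.
  - apply: emeasurable_funM => //; apply/measurable_EFinP.
    by apply: (measurableT_comp (@measurable_gpdf j)); exact: measurable_funB.
  - by move=> y; rewrite mule_ge0// lee_fin gpdf_ge0.
  by apply: eq_integral => y _; rewrite addrK [(y + _)%R]addrC.
under eq_integral do rewrite inner.
pose g (z : R * R) : \bar R := (f (z.1, z.2) * (gpdf j (z.2 - z.1))%:E)%E.
have mg : measurable_fun setT g.
  apply: emeasurable_funM; first by apply: eq_measurable_fun mf => -[].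
  apply/measurable_EFinP.
  by apply: (measurableT_comp (@measurable_gpdf j)); exact: measurable_funB.
have g0 z : (0 <= g z)%E by rewrite mule_ge0// lee_fin gpdf_ge0.
have mG : measurable_fun setT (fun s => \int[mu]_v g (s, v))%E.
  exact: (measurable_fun_fubini_tonelli_F (m2 := mu)).
have G0 s : (0 <= \int[mu]_v g (s, v))%E by exact: integral_ge0.
rewrite (ge0_integral_gam i (h := fun x => \int[mu]_v g ((a + x)%R, v))%E); last 2 first.
- by apply: (measurableT_comp mG); exact: measurable_funD.
- by move=> x.
transitivity (\int[mu]_s ((\int[mu]_v g (s, v)) * (gpdf i (s - a))%:E))%E.
  rewrite -[RHS](ge0_integral_shift a); last 2 first.
  - apply: emeasurable_funM => //; apply/measurable_EFinP.
    by apply: (measurableT_comp (@measurable_gpdf i)); exact: measurable_funB.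
  - by move=> y; rewrite mule_ge0// lee_fin gpdf_ge0.
  by apply: eq_integral => y _; rewrite addrK [(y + _)%R]addrC.
pose k (z : R * R) : \bar R := (g z * (gpdf i (z.1 - a))%:E)%E.
have mk : measurable_fun setT k.
  apply: emeasurable_funM => //; apply/measurable_EFinP.
  by apply: (measurableT_comp (@measurable_gpdf i)); exact: measurable_funB.
have k0 z : (0 <= k z)%E by rewrite mule_ge0// lee_fin gpdf_ge0.
transitivity (\int[mu]_s \int[mu]_v k (s, v))%E.
  apply: eq_integral => s _; rewrite -ge0_integralZr//.
  - by apply: (measurableT_comp mg); exact: measurable_pair1.
  - by rewrite lee_fin gpdf_ge0.
transitivity (\int[mu]_v \int[mu]_s k (s, v))%E.
  exact: (fubini_tonelli (m1 := mu) (m2 := mu) k).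
apply: eq_integral => v _; apply: eq_integral => s _.
by rewrite /k /g /= -muleA -EFinM [(gpdf j _ * _)%R]mulrC.
Qed.

Lemma gam_convolution n (B : set R) : measurable B ->
  (\int[gam n]_x \int[gam 0]_y (\1_B (x + y)%R)%:E = gam n.+1 B)%E.
Proof.
move=> mB.
pose f (z : R * R) : \bar R := (\1_B z.2)%:E.
have mf : measurable_fun setT f.
  apply/measurable_EFinP.
  have m1 : measurable_fun setT (\1_B : R -> R) by exact: measurable_indic.
  exact: (measurableT_comp m1 measurable_snd).
have f0 z : (0 <= f z)%E by rewrite lee_fin.
have := ge0_integral_gam2 n 0 0 mf f0.
rewrite /f /=; under [in LHS]eq_integral do under eq_integral do rewrite add0r.
move=> ->; rewrite /gam /gam_lebesgue [RHS]integral_mkcond; apply: eq_integral => v _.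
rewrite patchE; under eq_integral do rewrite subr0.
rewrite ge0_integralZl//; last first.
- by move=> s _; rewrite lee_fin mulr_ge0 ?gpdf_ge0.
- apply/measurable_EFinP; apply: measurable_funM; first exact: measurable_gpdf.
  by apply: (measurableT_comp (@measurable_gpdf 0)); exact: measurable_funB.
by rewrite gpdf_conv indicE; case: ifPn => _; rewrite ?mul1e ?mul0e.
Qed.

End gamma_distribution.

(** * Records of exponential variables *)

Section record_steps.
Context (R : realType) d (T : measurableType d) (P : probability T R).
Variable X : nat -> {RV P >-> R}.
Hypothesis X_indep : mutually_independent P (fun j => X j.+1 : T -> R).
(* [H] stands for - ln (1 - F), which turns the observations into standard
   exponential variables; it is well behaved on [V] only. *)
Variables (H : R -> R) (V : set R).
Hypothesis mH : measurable_fun setT H.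
Hypothesis mV : measurable V.
Hypothesis XV : forall j, P (X j.+1 @^-1` ~` V) = 0%E.
Hypothesis H_ge0 : forall x, 0 <= H x.
Hypothesis H_homo : forall x y, V x -> V y -> x <= y -> H x <= H y.
Hypothesis XH : forall j s, 0 <= s ->
  P (X j.+1 @^-1` [set y | s < H y]) = (expR (- s))%:E.
Hypothesis X_gt : forall j x, V x ->
  P (X j.+1 @^-1` [set y | x < y]) = (expR (- H x))%:E.

Definition Gam (n : nat) (w : T) : R :=
  H (record_value (fun j => X j : T -> R) n.+1 w).

Lemma measurable_Gam n : measurable_fun setT (Gam n).
Proof.
apply: (@measurableT_comp _ _ _ _ _ _ H); first exact: mH.
exact: measurable_record_value.
Qed.

Lemma GamE n j w : rec_event X n j w -> Gam n w = H (X j w).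
Proof. by rewrite /Gam => /record_value_rec_event ->. Qed.

(* The events decided by the first n+1 records. *)
Definition past_rec (n : nat) (A : set T) : Prop :=
  measurable A /\ forall j, past X j (A `&` rec_event X n j).

(** For every level K, either H(X_j) exceeds K, with probability [expR (- K)], or all later
    observations stay below K in the scale [H]. The latter has probability 0, since for every M it
    implies M independent events of a fixed probability q < 1. Letting K grow gives the claim. *)
Lemma no_next_record j : (0 < j)%N ->
  P (\bigcap_(i in [set i | (j < i)%N]) [set w | X i w <= X j w]) = 0%E.
Proof.
case: j => // j _.
set N := \bigcap_(i in _) _.
have mN : measurable N.
  apply: bigcap_measurableType => i _.
  rewrite -[X in measurable X]/((fun w => (X i w, X j.+1 w)) @^-1` [set z | z.1 <= z.2]).
  by apply: measurable_preimageT; [exact: measurable_fun_pair|exact: le_set_measurable].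
have mHX i (B : set R) : measurable B -> measurable (X i @^-1` (H @^-1` B)).
  by move=> mB; apply: measurable_RV; exact: measurable_preimageT.
pose Q K := \bigcap_(i in [set i | (j.+1 < i)%N]) X i @^-1` (H @^-1` `]-oo, K%:R]).
have mQ K : measurable (Q K).
  by apply: bigcap_measurableType => i _; exact: mHX.
have Q0 (K : nat) : P (Q K) = 0%E.
  pose q : R := 1 - expR (- K%:R).
  have q01 : 0 <= q < 1.
    rewrite /q subr_ge0 ltrBlDr ltrDl expR_gt0 andbT.
    by rewrite -expR0 ler_expR oppr_le0.
  have PK i : P (X i.+1 @^-1` (H @^-1` `]-oo, K%:R])) = q%:E.
    rewrite (_ : _ @^-1` _ = ~` (X i.+1 @^-1` [set y | K%:R < H y])); last first.
      by apply/seteqP; split => w /=; rewrite in_itv/= leNgt => /negP.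
    rewrite probability_setC ?XH//.
    rewrite (_ : [set y | _] = H @^-1` `]K%:R, +oo[); first exact: mHX.
    by apply/seteqP; split => y /=; rewrite in_itv/= andbT.
  have le_qn M : (P (Q K) <= (q ^+ M)%:E)%E.
    have -> : (q ^+ M)%:E = P (\bigcap_(i in [set` iota j.+1 M]) X i.+1 @^-1` (H @^-1` `]-oo, K%:R])).
      rewrite (X_indep (A := fun=> H @^-1` `]-oo, K%:R])) ?iota_uniq//; last first.
        by move=> _; exact: measurable_preimageT.
      under eq_bigr do rewrite PK.
      by rewrite big_const_seq/= count_predT size_iota; elim: M => [//|M /= <-]; rewrite exprS EFinM.
    apply: le_measure; rewrite ?inE//.
      by apply: bigcap_measurableType => i _; exact: mHX.
    by move=> w Qw i /=; rewrite mem_iota => /andP[ji _]; apply: Qw.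
  have cv : (q ^+ M)%:E @[M --> \oo] --> 0%E.
    by apply: cvg_EFin; [exact: nearW|apply: cvg_expr; case/andP: q01 => q0 q1; rewrite ger0_norm].
  apply/eqP; rewrite -measure_le0; apply: (cvge_to_ge cv); exact: nearW.
(* [H] is monotone on [V] only, so sample points with some observation outside [V] are set aside. *)
have W0 : P.-negligible (\bigcup_i X i.+1 @^-1` ~` V).
  apply: negligible_bigcup => i; apply/negligibleP; last exact: XV.
  exact/measurable_RV/measurableC.
have le_e K : (P N <= (expR (- K%:R))%:E)%E.
  rewrite -(XH j) ?ler0n//.
  have mHK : measurable (X j.+1 @^-1` [set y | K%:R < H y]).
    rewrite (_ : [set y | _] = H @^-1` `]K%:R, +oo[); first exact: mHX.
    by apply/seteqP; split => y /=; rewrite in_itv/= andbT.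
  have [W' [mW' W'0 WW']] := W0.
  have mWQ : measurable (W' `|` Q K) by exact: measurableU.
  rewrite -(measureU0 mHK mWQ); last exact: (null_set_setU mW' (mQ K) W'0 (Q0 K)).
  apply: le_measure; rewrite ?inE//; first exact: measurableU.
  move=> w Nw; have [Ww|nWw] := pselect ((\bigcup_i X i.+1 @^-1` ~` V) w).
    by right; left; exact: WW'.
  have VX i : V (X i.+1 w).
    by apply: contrapT => nV; apply: nWw; exists i.
  have [KX|XK] := ltP K%:R (H (X j.+1 w)); first by left.
  right; right => -[//|i] /= ji; rewrite in_itv/=.
  by apply: le_trans XK; apply: H_homo => //; exact: Nw.
have cv : (expR (- K%:R) : R)%:E @[K --> \oo] --> 0%E.
  apply: cvg_EFin; first exact: nearW.
  apply: (@cvg_comp _ _ _ (fun K : nat => K%:R) (fun x => expR (- x)) _ (pinfty_nbhs R)).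
    exact: cvgr_idn.
  exact: cvgr_expR.
apply/eqP; rewrite -measure_le0; apply: (cvge_to_ge cv); exact: nearW.
Qed.

Lemma full_rec_event n : P (~` \bigcup_j rec_event X n j) = 0%E.
Proof.
have mE k : measurable (\bigcup_j rec_event X k j).
  by apply: bigcup_measurable => j _; exact: measurable_rec_event.
apply/negligibleP; first exact: measurableC.
elim: n => [|n IH].
  rewrite (_ : ~` _ = set0); first exact: negligible_set0.
  by apply/seteqP; split => // w; apply; exists 1%N.
pose N j := \bigcap_(i in [set i | (j.+1 < i)%N]) [set w | X i w <= X j.+1 w].
have mN j : measurable (N j).
  apply: bigcap_measurableType => i _.
  rewrite -[X in measurable X]/((fun w => (X i w, X j.+1 w)) @^-1` [set z | z.1 <= z.2]).
  by apply: measurable_preimageT; [exact: measurable_fun_pair|exact: le_set_measurable].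
have N0 : P.-negligible (\bigcup_j N j).
  by apply: negligible_bigcup => j; apply/negligibleP => //; exact: no_next_record.
apply: negligibleS (negligibleU IH N0) => w nw.
have [[j _ rj]|] := pselect ((\bigcup_j rec_event X n j) w); last by left.
right; exists j.-1 => // i /=; rewrite prednK ?(rec_at_gt0 rj)// => ji.
rewrite leNgt; apply/negP => lt; apply: nw.
have ex : exists i, (j < i)%N && (X j w < X i w) by exists i; rewrite ji.
exists (next_record (X ^~ w) j) => //; exists j => //.
have /next_recordP [//|[_ /(_ _ ji)]] : next_record (X ^~ w) j = next_record (X ^~ w) j by [].
by rewrite leNgt lt.
Qed.

Lemma rec_event_partition n A : measurable A ->
  P A = (\sum_(j <oo) P (A `&` rec_event X n j))%E.
Proof.
move=> mA.
have mE : measurable (\bigcup_j rec_event X n j).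
  by apply: bigcup_measurable => j _; exact: measurable_rec_event.
rewrite -measure_semi_bigcup.
- rewrite -setI_bigcupr -[in LHS](setIT A) -(setUv (\bigcup_j rec_event X n j)) setIUr.
  rewrite measureU0//; [exact: measurableI|by apply: measurableI => //; exact: measurableC|].
  by apply: (subset_measure0 (B := ~` \bigcup_j rec_event X n j)); [apply: measurableI => //; exact: measurableC|exact: measurableC|exact: subIsetr|exact: full_rec_event].
- by move=> j; apply: measurableI => //; exact: measurable_rec_event.
- apply/trivIsetP => i j _ _ ij; rewrite setIACA.
  by have /trivIsetP/(_ i j I I ij) -> := @trivIset_rec_event _ _ _ P X n; rewrite setI0.
- by apply: bigcup_measurable => j _; apply: measurableI => //; exact: measurable_rec_event.
Qed.

Lemma past_recI n A B : past_rec n A -> past_rec n B -> past_rec n (A `&` B).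
Proof.
move=> [mA pA] [mB pB]; split; first exact: measurableI.
by move=> j; rewrite -(setIid (rec_event X n j)) setIACA; exact: pastI.
Qed.

Lemma past_recS n A : past_rec n A -> past_rec n.+1 A.
Proof.
move=> [mA pA]; split=> // j; rewrite rec_eventS setI_bigcupr.
apply: past_bigcup => l /= /andP[l0 lj]; rewrite !setIA.
have j0 := leq_ltn_trans (leq0n l) lj.
apply: pastI; last by apply: past_lt; rewrite ?l0 ?(ltnW lj) ?j0 /=.
apply: pastI; first by apply: (past_sub (ltnW lj)); exact: pA.
apply: past_bigcap => i /= /andP[li ij].
by apply: past_le; rewrite ?l0 ?(ltnW lj)//= (ltnW ij) andbT (leq_ltn_trans _ li).
Qed.

Lemma past_rec_le n p A : (n <= p)%N -> past_rec n A -> past_rec p A.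
Proof.
move=> /subnKC <-; elim: (p - n)%N => [|q IH] pA; first by rewrite addn0.
by rewrite addnS; apply: past_recS; exact: IH.
Qed.

Lemma rec_at_le (x : nat -> R) i n j : (i <= n)%N -> rec_at x n j ->
  exists2 l, rec_at x i l & (l <= j)%N.
Proof.
move=> /subnK <-; elim: (n - i)%N j => [|p IH] j; first by exists j.
rewrite addSn => -[l /IH [q rq ql] [lj _ _]].
by exists q => //; rewrite (leq_trans ql)// ltnW.
Qed.

(** Once record [n] is at time [j], record [i] is at some time [l <= j], and the two values are
    functions of X_l and X_j. *)
Lemma past_rec_Gam2 i n (C : set (R * R)) : (i <= n)%N -> measurable C ->
  past_rec n ((fun w => (Gam i w, Gam n w)) @^-1` C).
Proof.
move=> le_in mC; split.
  apply: measurable_preimageT => //.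
  by apply: measurable_fun_pair; exact: measurable_Gam.
move=> j.
rewrite (_ : _ `&` _ = \bigcup_(l in [set l | (0 < l <= j)%N])
    (rec_event X i l `&` rec_event X n j `&`
     (fun w => (X l w, X j w)) @^-1` ((fun z => (H z.1, H z.2)) @^-1` C))).
  apply: past_bigcup => l /= /andP[l0 lj]; apply: pastI.
    by apply: pastI; [apply: (past_sub lj); exact: past_rec_event|exact: past_rec_event].
  apply: past_preimage2; rewrite ?l0 ?lj ?leqnn ?andbT ?(leq_trans l0 lj)//.
  rewrite -[X in measurable X]setTI; apply: measurable_fun_pair => //.
    by apply: (@measurableT_comp _ _ _ _ _ _ H).
  by apply: (@measurableT_comp _ _ _ _ _ _ H).
apply/seteqP; split => [w [Cw rw]|w [l _ [[rl rj] Cw]]].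
  have [l rl lj] := rec_at_le le_in rw.
  exists l => /=; first by rewrite lj (rec_at_gt0 rl).
  by split => //; rewrite -(GamE rl) -(GamE rw).
by split => //=; rewrite (GamE rl) (GamE rj).
Qed.

Lemma past_rec_Gam i n (B : set R) : (i <= n)%N -> measurable B ->
  past_rec n (Gam i @^-1` B).
Proof.
move=> le_in mB; rewrite (_ : _ @^-1` _ = (fun w => (Gam i w, Gam n w)) @^-1` (B `*` setT)).
  by apply: past_rec_Gam2 => //; exact: measurableX.
by apply/seteqP; split => w //= [].
Qed.

Lemma past_rec_incr i n (B : set R) : (i <= n)%N -> measurable B ->
  past_rec n ((fun w => Gam n w - Gam i w) @^-1` B).
Proof.
move=> le_in mB; apply: (@past_rec_Gam2 i n ((fun z => z.2 - z.1) @^-1` B)) => //.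
by rewrite -[X in measurable X]setTI; apply: measurable_funB.
Qed.

(** Lack of memory. The event is cut according to the times l < j of the two consecutive records. On
    a piece, X_j has to exceed x = X_l; the stronger demand H(X_j) > t + H x has probability
    [expR (- (t + H x))], which is [expR (- t)] times the probability of X_j > x. This factor does
    not depend on x, l or j. *)
Lemma prob_Gam_incr_gt n A t : past_rec n A -> 0 <= t ->
  P (A `&` [set w | t < Gam n.+1 w - Gam n w]) = (P A * (expR (- t))%:E)%E.
Proof.
move=> [mA pA] t0.
pose C' : set (R * R) := [set z | z.1 < z.2].
pose C := C' `&` [set z | t < H z.2 - H z.1].
have mC' : measurable C' by exact: lt_set_measurable.
have mtH : measurable [set z : R * R | t < H z.2 - H z.1].
  rewrite (_ : mkset _ = (fun z => H z.2 - H z.1) @^-1` `]t, +oo[).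
    rewrite -[X in measurable X]setTI; apply: measurable_funB => //.
      by apply: (@measurableT_comp _ _ _ _ _ _ H).
    by apply: (@measurableT_comp _ _ _ _ _ _ H).
  by apply/seteqP; split => z /=; rewrite in_itv/= andbT.
have mC : measurable C by exact: measurableI.
have mW : measurable [set w | t < Gam n.+1 w - Gam n w].
  rewrite (_ : mkset _ = (fun w => Gam n.+1 w - Gam n w) @^-1` `]t, +oo[).
    by rewrite -[X in measurable X]setTI; apply: measurable_funB => //; exact: measurable_Gam.
  by apply/seteqP; split => z /=; rewrite in_itv/= andbT.
(* For x and y in [V], H y > t + H x with t >= 0 forces y > x by monotonicity, so up to a null event
   the section of [C] is an upper level set of [H]. *)
have sec p x : V x -> distribution P (X p.+1) (xsection C x) =
    ((expR (- t))%:E * distribution P (X p.+1) (xsection C' x))%E.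
  move=> Vx; rewrite /distribution /= /pushforward.
  rewrite (_ : xsection C' x = [set y | x < y]); last first.
    by apply/seteqP; split => y; rewrite /xsection/= inE.
  rewrite X_gt// -EFinM -expRD -opprD -(XH p) ?addr_ge0//.
  have mXV : measurable (X p.+1 @^-1` ~` V) by apply/measurable_RV/measurableC.
  have mXC : measurable (X p.+1 @^-1` xsection C x).
    by apply: measurable_RV; exact: measurable_xsection.
  have mXH : measurable (X p.+1 @^-1` [set y | t + H x < H y]).
    apply: measurable_RV; rewrite (_ : mkset _ = H @^-1` `]t + H x, +oo[).
      exact: measurable_preimageT.
    by apply/seteqP; split => z /=; rewrite in_itv/= andbT.
  rewrite -(measureU0 mXC mXV (XV p)) -(measureU0 mXH mXV (XV p)).
  congr (P _); rewrite -!preimage_setU; apply/seteqP; split => w /= [|?]; try by right.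
    by rewrite /xsection /= inE /C /= => -[_]; left; rewrite -ltrBrDr.
  have [Vy|?] := pselect (V (X p.+1 w)); last by right.
  move=> lt; left; rewrite /xsection/= inE; split => /=; last by rewrite ltrBrDr.
  rewrite /C' /= ltNge; apply/negP => /(H_homo Vy Vx); rewrite leNgt => /negP; apply.
  by apply: le_lt_trans lt; rewrite lerDr.
rewrite (rec_event_partition n.+1 (measurableI _ _ mA mW)).
rewrite (rec_event_partition n.+1 mA) muleC -nneseriesZl//.
apply: eq_eseriesr => j _.
(* The part decided before time [j]: record [n] is at [l] and is not exceeded until then. *)
pose D (l : nat) := A `&` rec_event X n l `&`
  \bigcap_(i in [set i | (l < i < j)%N]) [set w | X i w <= X l w].
have pD l : (0 < l < j)%N -> past X j.-1 (D l).
  move=> /andP[l0 lj]; have lj1 : (l <= j.-1)%N by case: (j) lj.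
  apply: pastI; first by apply: (past_sub lj1); exact: pA.
  apply: past_bigcap => i /= /andP[li ij].
  apply: past_le; last by rewrite l0.
  by rewrite (leq_ltn_trans _ li)//=; case: (j) ij.
have AE E : A `&` E `&` rec_event X n.+1 j = \bigcup_(l in [set l | (0 < l < j)%N])
    (D l `&` ([set w | X l w < X j w] `&` E)).
  rewrite rec_eventS setI_bigcupr; apply: eq_bigcupr => l _.
  by rewrite /D -!setIA [in LHS](setICA E); congr (_ `&` _); rewrite (setIC E) -!setIA.
have AE' : A `&` rec_event X n.+1 j = \bigcup_(l in [set l | (0 < l < j)%N])
    (D l `&` [set w | X l w < X j w]).
  by rewrite -(setIT A) AE; under eq_bigcupr do rewrite setIT.
have triv (E : nat -> set T) : trivIset [set l | (0 < l < j)%N] (fun l => D l `&` E l).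
  apply/trivIsetP => l l' _ _ ll'; apply/seteqP; split => // w [[[[_ rl] _] _] [[[_ rl'] _] _]].
  by move/eqP: ll'; apply; exact: rec_at_uniq rl rl'.
have mlt l : measurable [set w | X l w < X j w].
  rewrite -[X in measurable X]/((fun w => (X l w, X j w)) @^-1` C').
  by apply: measurable_preimageT => //; exact: measurable_fun_pair.
have mD l : (0 < l < j)%N -> measurable (D l).
  by move=> lj; exact: (@past_measurable _ _ _ P X j.-1) (pD l lj).
rewrite AE AE' !measure_bigcup//; last 2 first.
- by move=> l lj; apply: measurableI; [exact: mD|].
- by move=> l lj; apply: measurableI; [exact: mD|exact: measurableI].
rewrite -nneseriesZl//; apply: eq_eseriesr => l; rewrite inE /= => lj.
have j0 : j = j.-1.+1 by rewrite prednK//; case/andP: lj => _ /(leq_ltn_trans (leq0n _)).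
transitivity (P (D l `&` (fun w => (X l w, X j.-1.+1 w)) @^-1` C)).
  rewrite -j0; congr (P _); apply/seteqP; split => w [].
    move=> [[Aw rl] le] [lt tG]; split; first by [].
    have rj : rec_event X n.+1 j w by exists l => //; split => //; case/andP: lj.
    by split => //=; rewrite -(GamE rl) -(GamE rj).
  move=> [[Aw rl] le] [/= lt tG]; split; first by [].
  have rj : rec_event X n.+1 j w by exists l => //; split => //; case/andP: lj.
  by split => //=; rewrite (GamE rl) (GamE rj).
rewrite (past_xsection X_indep (C' := C') (V := V) (c := expR (- t))) -?j0//.
- by case/andP: lj => -> /=; case: (j).
- exact: pD.
- by case/andP: lj; case: (l) => // l' _ _; exact: XV.
- by move=> x Vx; rewrite j0 sec.
Qed.

(** Half-lines ]t, +oo[ are closed under intersection and generate the Borel sets. For t < 0 both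
    measures give them the mass P(A), because ]0, +oo[ already carries all of it. *)
Lemma prob_incr_exp n A (B : set R) : past_rec n A -> measurable B ->
  P (A `&` (fun w => Gam n.+1 w - Gam n w) @^-1` B) = (P A * gam 0 B)%E.
Proof.
move=> pA mB; have [mA _] := pA.
have mI : measurable_fun setT (fun w => Gam n.+1 w - Gam n w).
  by apply: measurable_funB; exact: measurable_Gam.
have PAfin : P A \is a fin_num by exact: fin_num_measure.
pose c : {nonneg R} := NngNum (fine_ge0 (measure_ge0 P A)).
have cE : c%:num%:E = P A by rewrite /= fineK.
pose m1 : {measure set R -> \bar R} := event_law P mA mI.
pose m2 : {measure set R -> \bar R} := mscale c (@gam R 0).
transitivity (m1 B) => //; transitivity (m2 B); last first.
  by rewrite /m2 /= /mscale cE.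
have m1P (t : R) : m1 `]t, +oo[%classic = P (A `&` [set w | t < Gam n.+1 w - Gam n w]).
  rewrite /m1 /= /event_law; congr (P (_ `&` _)).
  by apply/seteqP; split => w /=; rewrite in_itv/= andbT.
have m1E (t : R) : 0 <= t -> m1 `]t, +oo[%classic = m2 `]t, +oo[%classic.
  move=> t0; rewrite m1P prob_Gam_incr_gt//.
  by rewrite /m2 /= /mscale cE; congr (_ * _)%E; apply/esym; exact: gam_gt0.
have m1T : m1 setT = P A by rewrite /m1 /= /event_law preimage_setT setIT.
have g1 : gam 0 [set: R] = 1%E by exact: (probability_setT (@gam R 0)).
have m2T : m2 setT = P A.
  by rewrite -[RHS]mule1 -g1 -cE.
have neg (t : R) : t < 0 -> m1 `]t, +oo[%classic = m2 `]t, +oo[%classic.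
  move=> t0.
  have sub : (`]0%R, +oo[%classic `<=` `]t, +oo[%classic).
    by apply: subset_itvr; rewrite bnd_simp ltW.
  have lo (m : {measure set R -> \bar R}) : (m `]0%R, +oo[%classic <= m `]t, +oo[%classic)%E.
    by apply: le_measure; rewrite ?inE.
  have up (m : {measure set R -> \bar R}) : (m `]t, +oo[%classic <= m setT)%E.
    by apply: le_measure; rewrite ?inE.
  have e0 : m1 `]0, +oo[%classic = P A.
    by rewrite m1P prob_Gam_incr_gt// oppr0 expR0 mule1.
  have e1 : m1 `]t, +oo[%classic = P A.
    by apply/eqP; rewrite eq_le -{2}e0 lo andbT -m1T up.
  have e2 : m2 `]t, +oo[%classic = P A.
    by apply/eqP; rewrite eq_le -{2}e0 m1E// lo andbT -m2T up.
  by rewrite e1 e2.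
apply: (measure_unique (@RGenOInfty.G R) (fun k => `](- k%:R)%R, +oo[%classic)) => //.
- exact: RGenOInfty.measurableE.
- move=> _ _ [x ->] [y ->]; exists (Num.max x y).
  by apply/seteqP; split => z /=; rewrite !in_itv/= !andbT gt_max; [case=> -> ->|move/andP].
- by move=> k; exists (- k%:R).
- apply/seteqP; split => // x _; exists (Num.bound `|x : R|) => //=.
  rewrite in_itv/= andbT ltrNl; have := archi_boundP (normr_ge0 (x : R)).
  by apply: le_lt_trans; rewrite -normrN ler_norm.
- by move=> _ [x ->]; have [x0|x0] := ltP x 0; [exact: neg|exact: m1E].
- move=> k; apply: (@le_lt_trans _ _ (m1 setT)); first by apply: le_measure; rewrite ?inE.
  by rewrite m1T -ge0_fin_numE.
Qed.

(** From [p] to [p + j.+1] there are j + 1 steps, matching [gam j] as the law of a sum of j + 1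
    exponentials. The last step is independent of [A] together with the preceding increment, so the
    induction adds it by convolution. *)
Lemma prob_incr_gam p j A (B : set R) : past_rec p A -> measurable B ->
  P (A `&` (fun w => Gam (p + j.+1) w - Gam p w) @^-1` B) = (P A * gam j B)%E.
Proof.
move=> pA; have [mA _] := pA; elim: j B => [|j IH] B mB.
  by rewrite addn1; exact: prob_incr_exp.
pose U w := Gam (p + j.+1) w - Gam p w.
pose W w := Gam (p + j.+1).+1 w - Gam (p + j.+1) w.
have mU : measurable_fun setT U by apply: measurable_funB; exact: measurable_Gam.
have mW : measurable_fun setT W by apply: measurable_funB; exact: measurable_Gam.
pose C := [set z : R * R | B (z.1 + z.2)].
have mC : measurable C.
  by rewrite -[C]/((fun z : R * R => z.1 + z.2) @^-1` B); apply: measurable_preimageT => //; exact: measurable_funD.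
rewrite (_ : _ @^-1` B = (fun w => (U w, W w)) @^-1` C); last first.
  have E w : Gam (p + j.+2) w - Gam p w = U w + W w by rewrite /U /W addnS; ring.
  by apply/seteqP; split => w; rewrite /C /= E.
rewrite (joint_law (nu := @gam R 0) mA mU mW)//; last first.
  move=> B1 B2 mB1 mB2; apply: prob_incr_exp => //; apply: past_recI.
    by apply: past_rec_le pA; exact: leq_addr.
  by apply: past_rec_incr => //; exact: leq_addr.
rewrite -gam_convolution//.
pose c : {nonneg R} := NngNum (fine_ge0 (measure_ge0 P A)).
have cE : c%:num%:E = P A by rewrite /= fineK// fin_num_measure.
have mx : measurable_fun setT (gam 0 \o xsection C).
  exact: measurable_fun_xsection.
transitivity (\int[mscale c (@gam R j)]_x (gam 0 \o xsection C) x)%E.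
  rewrite /product_measure1 /=; apply: eq_measure_integral => D mD _.
  by rewrite /= /event_law IH// /mscale cE.
rewrite ge0_integral_mscale//= cE; congr (_ * _)%E.
apply: eq_integral => x _ /=.
have mxC : measurable (xsection C x) by exact: measurable_xsection.
transitivity (\int[gam 0]_y (\1_(xsection C x) y)%:E)%E.
  by rewrite integral_indic// setIT.
apply: eq_integral => y _; by rewrite !indicE mem_xsection.
Qed.

(** Record [p] and the two successive increments are independent: in [prob_incr_gam] the event [A]
    may describe all preceding variables, and a product measure is determined by rectangles. *)
Lemma law_Gam3 p i j (f : R * (R * R) -> \bar R) :
  measurable_fun setT f -> (forall z, 0 <= f z)%E ->
  (\int[P]_w f (Gam p w, ((Gam (p + i.+1) w - Gam p w)%R,
      (Gam (p + i.+1 + j.+1) w - Gam (p + i.+1) w)%R)) =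
   \int[event_law P measurableT (measurable_Gam p)]_a
     \int[gam i]_x \int[gam j]_y f (a, (x, y)))%E.
Proof.
move=> mf f0.
pose U w := Gam (p + i.+1) w - Gam p w.
pose W w := Gam (p + i.+1 + j.+1) w - Gam (p + i.+1) w.
have mU : measurable_fun setT U by apply: measurable_funB; exact: measurable_Gam.
have mW : measurable_fun setT W by apply: measurable_funB; exact: measurable_Gam.
have mUW : measurable_fun setT (fun w => (U w, W w)) by exact: measurable_fun_pair.
pose mG := measurable_Gam p.
have mGUW : measurable_fun setT (fun w => (Gam p w, (U w, W w))) by exact: measurable_fun_pair.
pose nu : probability (R * R)%type R := (@gam R i \x @gam R j)%E.
have UW A C : past_rec p A -> measurable C ->
    P (A `&` (fun w => (U w, W w)) @^-1` C) = (P A * nu C)%E.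
  move=> pA mC; have [mA _] := pA.
  rewrite (joint_law (nu := @gam R j) mA mU mW)//; last first.
    move=> B1 B2 mB1 mB2; apply: prob_incr_gam => //; apply: past_recI.
      by apply: past_rec_le pA; exact: leq_addr.
    by apply: past_rec_incr => //; exact: leq_addr.
  pose c : {nonneg R} := NngNum (fine_ge0 (measure_ge0 P A)).
  have cE : c%:num%:E = P A by rewrite /= fineK// fin_num_measure.
  have mx : measurable_fun setT (gam j \o xsection C).
    exact: measurable_fun_xsection.
  transitivity (\int[mscale c (@gam R i)]_x (gam j \o xsection C) x)%E.
    rewrite /product_measure1 /=; apply: eq_measure_integral => D mD _.
    by rewrite /= /event_law prob_incr_gam// /mscale cE.
  by rewrite ge0_integral_mscale//= cE.
pose rho : {measure set (R * (R * R)) -> \bar R} := event_law P measurableT mGUW.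
rewrite -(ge0_integral_event_law P mGUW)//.
transitivity (\int[event_law P measurableT mG \x nu]_z f z)%E.
  apply: eq_measure_integral => C mC _; apply/esym.
  apply: (product_measure_unique (m' := rho)) => // B1 B2 mB1 mB2.
  transitivity (P (Gam p @^-1` B1 `&` (fun w => (U w, W w)) @^-1` B2)).
    by rewrite /rho /= /event_law setTI; congr (P _); apply/seteqP; split.
  rewrite UW//; last exact: past_rec_Gam.
  by rewrite /= /event_law setTI.
rewrite fubini_tonelli1//; apply: eq_integral => a _; rewrite /fubini_F.
rewrite (fubini_tonelli1 (fun z => f (a, z)))//.
by apply: measurableT_comp => //; exact: measurable_pair1.
Qed.

Lemma law_Gam3_density p i j (f : R * (R * R) -> \bar R) :
  measurable_fun setT f -> (forall z, 0 <= f z)%E ->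
  (\int[P]_w f (Gam p w, (Gam (p + i.+1) w, Gam (p + i.+1 + j.+1) w)) =
   \int[event_law P measurableT (measurable_Gam p)]_a
     \int[@lebesgue_measure R]_v \int[@lebesgue_measure R]_s
       (f (a, (s, v)) * (gpdf i (s - a) * gpdf j (v - s))%:E))%E.
Proof.
move=> mf f0.
pose h (z : R * (R * R)) : \bar R := f (z.1, ((z.1 + z.2.1)%R, (z.1 + z.2.1 + z.2.2)%R)).
have mh : measurable_fun setT h.
  apply: (measurableT_comp mf); apply: measurable_fun_pair => //.
  have m1 : measurable_fun setT (fun z : R * (R * R) => z.1 + z.2.1).
    by apply: measurable_funD => //; exact: (measurableT_comp measurable_fst).
  apply: measurable_fun_pair => //; apply: measurable_funD => //.
  exact: (measurableT_comp measurable_snd).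
transitivity (\int[P]_w h (Gam p w, ((Gam (p + i.+1) w - Gam p w)%R,
      (Gam (p + i.+1 + j.+1) w - Gam (p + i.+1) w)%R)))%E.
  apply: eq_integral => w _; rewrite /h /=; congr (f (_, (_, _))); ring.
rewrite law_Gam3; [|exact: mh|by move=> z; exact: f0].
apply: eq_integral => a _; rewrite /h /=.
apply: (ge0_integral_gam2 i j a (f := fun z => f (a, z))) => //.
by apply: (measurableT_comp mf); exact: measurable_pair1.
Qed.

(** [rectangle_compare] needs a law that charges every interval of positive numbers. For the
    induction the interval is halved: record [p] falls into the lower half, and the next step is
    positive and at most as long as the upper half. *)
Lemma Gam_prob_gt0 p (q r : R) : 0 <= q -> q < r ->
  (0 < P (Gam p @^-1` `]q, r]))%E.
Proof.
have prob_oc (s t : R) : 0 <= s -> s < t ->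
    forall (nu : probability R R), (forall u : R, 0 <= u -> nu `]u, +oo[%classic = (expR (- u))%:E) ->
    (0 < nu `]s, t]%classic)%E.
  move=> s0 st nu nuE.
  have -> : `]s, t]%classic = `]s, +oo[%classic `\` `]t, +oo[%classic.
    by apply/seteqP; split => x /=; rewrite !in_itv/= !andbT; [move=> /andP[-> xt]; split => //; apply/negP; rewrite -leNgt|move=> [-> /negP]; rewrite -leNgt].
  rewrite measureD//=; last first.
    by rewrite nuE// ltry.
  rewrite setIidr; last by apply: subset_itvr; rewrite bnd_simp ltW.
  by rewrite !nuE ?(ltW (le_lt_trans s0 st))// -EFinB lte_fin subr_gt0 ltr_expR ltrN2.
elim: p q r => [|p IH] q r q0 qr.
  have mG := measurable_Gam 0.
  pose nu : probability R R := distribution P (X 1%N).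
  have mH' : measurable_fun setT H by exact: mH.
  have -> : P (Gam 0 @^-1` `]q, r]) =
      (P (X 1%N @^-1` [set y | (q < H y)%R]) - P (X 1%N @^-1` [set y | (r < H y)%R]))%E.
    have mgt (t : R) : measurable (X 1%N @^-1` [set y | t < H y]).
      apply: measurable_RV; rewrite (_ : mkset _ = H @^-1` `]t, +oo[).
        exact: measurable_preimageT.
      by apply/seteqP; split => y /=; rewrite in_itv/= andbT.
    have rq : X 1%N @^-1` [set y | r < H y] `<=` X 1%N @^-1` [set y | q < H y].
      by move=> w /=; exact: lt_trans.
    rewrite -[X in (_ - P X)%E](setIidr rq) -measureD//; last first.
      by rewrite -ge0_fin_numE// fin_num_measure.
    congr (P _); apply/seteqP; split => w /=; rewrite in_itv/= /Gam /record_value /record_time /=.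
      by move=> /andP[-> xt]; split => //; apply/negP; rewrite -leNgt.
    by move=> [-> /negP]; rewrite -leNgt.
  rewrite !XH ?(ltW (le_lt_trans q0 qr))//.
  by rewrite -EFinB lte_fin subr_gt0 ltr_expR ltrN2.
pose c := (q + r) / 2.
have qc : q < c by rewrite /c; lra.
have cr : c < r by rewrite /c; lra.
have mp n (B : set R) : measurable B -> measurable (Gam n @^-1` B).
  by apply: measurable_preimageT; exact: measurable_Gam.
have mI : measurable_fun setT (fun w => Gam p.+1 w - Gam p w).
  by apply: measurable_funB; exact: measurable_Gam.
have mIB := measurable_preimageT mI.
apply: (@lt_le_trans _ _ (P (Gam p @^-1` `]q, c] `&` (fun w => Gam p.+1 w - Gam p w) @^-1` `]0, (r - c)]))).
  rewrite prob_incr_exp//; last exact: past_rec_Gam.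
  apply: mule_gt0; first exact: IH.
  by apply: prob_oc; rewrite ?subr_gt0// => u u0; exact: gam_gt0.
apply: le_measure; rewrite ?inE; [by apply: measurableI; [exact: mp|exact: mIB]|exact: mp|].
by move=> w /=; rewrite !in_itv/= => -[/andP[h1 h2] /andP[h3 h4]]; apply/andP; split; lra.
Qed.

End record_steps.

(** * Conditional expectations *)

Section density_measure.
Context d (T : measurableType d) (R : realType) (mu : {measure set T -> \bar R}).
Variable p : T -> R.

Definition density (mp : measurable_fun setT p) (p0 : forall x, 0 <= p x)
  (B : set T) : \bar R := (\int[mu]_(x in B) (p x)%:E)%E.

Variables (mp : measurable_fun setT p) (p0 : forall x, 0 <= p x).

Let density0 : density mp p0 set0 = 0%E.
Proof. by rewrite /density integral_set0. Qed.

Let density_ge0 A : (0 <= density mp p0 A)%E.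
Proof. by apply: integral_ge0 => x _; rewrite lee_fin. Qed.

Let density_sigma_additive : semi_sigma_additive (density mp p0).
Proof.
move=> F mF tF mUF; rewrite /density; apply: cvg_toP.
  apply: ereal_nondecreasing_is_cvgn => i j ij.
  apply: lee_sum_nneg_natr => // k _ _; apply: integral_ge0 => x _.
  by rewrite lee_fin.
rewrite ge0_integral_bigcup//=.
- by apply: measurable_funTS; exact/measurable_EFinP.
- by move=> x _; rewrite lee_fin.
Qed.

HB.instance Definition _ := isMeasure.Build _ _ _
  (density mp p0) density0 density_ge0 density_sigma_additive.

End density_measure.

(** [Y] need not be integrable, so it may fail to be the density of a finite measure. Divided by
    [expR (c (Z w))] it is at most 1; the Radon-Nikodym derivative of the image under [Z] of the
    resulting measure, multiplied back by [expR (c z)], is the required version. The exponential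
    keeps the divisor positive. *)
Lemma cond_expect_ge0_exists d d' (T : measurableType d) (S : measurableType d')
    (R : realType) (P : probability T R) (Y : T -> R) (Z : T -> S) (c : S -> R) :
  measurable_fun setT Y -> measurable_fun setT Z -> measurable_fun setT c ->
  (forall w, 0 <= Y w <= expR (c (Z w))) ->
  exists g, cond_expect_ge0 P Y Z g.
Proof.
move=> mY mZ mc Yb.
pose b z := expR (c z).
have b0 z : 0 < b z by exact: expR_gt0.
have mb : measurable_fun setT b by exact: measurableT_comp.
pose p w := Y w * expR (- c (Z w)).
have pE w : b (Z w) * p w = Y w.
  by rewrite mulrC -mulrA -expRD addNr expR0 mulr1.
have mp : measurable_fun setT p.
  apply: measurable_funM => //; apply: measurableT_comp => //.
  by apply: measurableT_comp => //; exact: measurableT_comp.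
have p0 w : 0 <= p w by have /andP[Y0 _] := Yb w; rewrite mulr_ge0 ?expR_ge0.
have p1 w : p w <= 1.
  by have /andP[_ Y1] := Yb w; rewrite /p expRN ler_pdivrMr ?mul1r ?expR_gt0.
pose nu' : {measure set T -> \bar R} := density P mp p0.
have nu'T : (nu' setT <= 1)%E.
  rewrite -(probability_setT P) -[leRHS]mul1e -integral_cst//.
  apply: ge0_le_integral => //.
  - by move=> w _; rewrite lee_fin.
  - exact/measurable_EFinP.
  - by move=> w _; rewrite lee_fin.
have fnu' : fin_num_fun nu'.
  move=> B mB; rewrite ge0_fin_numE//; apply: (le_lt_trans _ (ltry 1)).
  by apply: le_trans (nu'T); apply: le_measure; rewrite ?inE.
pose nu'M := Measure_isFinite.Build _ _ _ nu' fnu'.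
pose nu'F : {finite_measure set T -> \bar R} := HB.pack (Measure.sort nu') nu'M.
pose nu0 : {measure set S -> \bar R} := pushforward nu' Z.
pose nu1 := nu0 mZ.
have fnu : fin_num_fun nu1.
  move=> B mB; rewrite ge0_fin_numE//; apply: (le_lt_trans _ (ltry 1)).
  apply: le_trans (nu'T); rewrite /nu1 /nu0 /= /pushforward.
  by apply: le_measure; rewrite ?inE//; exact: measurable_preimageT.
pose nuM := Measure_isFinite.Build _ _ _ nu1 fnu.
pose nu : {finite_measure set S -> \bar R} := HB.pack (Measure.sort nu1) nuM.
pose mu := event_law P measurableT mZ.
have numu : nu `<< mu.
  apply/null_content_dominatesP => A mA.
  rewrite /mu /= /event_law setTI => PA0.
  rewrite /nu /= /nu1 /= /pushforward /nu' /= /density.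
  by apply: null_set_integral => //; [exact: measurable_preimageT|apply: measurable_funTS; exact/measurable_EFinP].
pose f := Radon_Nikodym_SigmaFinite.f nu mu.
have f_fin z : f z \is a fin_num by exact: Radon_Nikodym_SigmaFinite.f_fin_num.
have f0 z : (0 <= f z)%E by exact: Radon_Nikodym_SigmaFinite.f_ge0.
have mf : measurable_fun setT f.
  exact: measurable_int (Radon_Nikodym_SigmaFinite.f_integrable numu).
have mff : measurable_fun setT (fine \o f) by exact: measurableT_comp.
exists (fun z => b z * fine (f z)); split.
- exact: measurable_funM.
- by move=> z; rewrite mulr_ge0 ?fine_ge0// ltW.
move=> B mB.
have mZB := measurable_preimageT mZ mB.
have mbE : measurable_fun setT (EFin \o b) by exact/measurable_EFinP.
transitivity (\int[nu]_(z in B) (b z)%:E)%E.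
  rewrite /nu /= /nu1 /nu0 ge0_integral_pushforward//; last 2 first.
  - exact: measurable_funTS.
  - by move=> z _; rewrite /= lee_fin ltW.
  rewrite [LHS]integral_mkcond [RHS]integral_mkcond.
  pose h := ((fun w => (b (Z w))%:E) \_ (Z @^-1` B)).
  have mh : measurable_fun setT h.
    apply/(measurable_restrictT _ mZB); apply: measurable_funTS.
    by apply/measurable_EFinP; exact: measurableT_comp.
  have h0 w : (0 <= h w)%E.
    by rewrite /h patchE; case: ifP => // _; rewrite lee_fin ltW.
  transitivity (\int[nu'F]_w h w)%E => //.
  rewrite (ge0_integral_density (mu := P) mp p0 (nu := nu'F))//.
  apply: eq_integral => w _; rewrite /h !patchE; case: ifP => _; last by rewrite mul0e.
  by rewrite -EFinM pE.
rewrite -(Radon_Nikodym_SigmaFinite.change_of_variables numu)//; last 2 first.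
- by move=> z; rewrite lee_fin ltW.
- exact: measurable_funTS.
rewrite [LHS]integral_mkcond [RHS]integral_mkcond.
rewrite ge0_integral_event_law.
- apply: eq_integral => w _; rewrite !patchE.
  rewrite [in LHS](_ : (Z w \in B) = (w \in Z @^-1` B))//; case: ifP => // _.
  by rewrite EFinM fineK.
- apply/(measurable_restrictT _ mB); apply: measurable_funTS; exact: emeasurable_funM.
- by move=> z; rewrite patchE; case: ifP => // _; rewrite mule_ge0// lee_fin ltW.
Qed.

Section conditional_expectations.
Context d d' (T : measurableType d) (S : measurableType d') (R : realType).
Variables (P : probability T R) (Z : T -> S).
Hypothesis mZ : measurable_fun setT Z.

(** The values of a version on a set that [Z] avoids almost surely are free; [cond_expect_common]
    uses this freedom to obtain equality at every point. *)
Lemma cond_expect_ge0_null (Y : T -> R) (g : S -> R) (N : set S) : measurable_fun setT Y ->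
  (forall w, 0 <= Y w) -> measurable N -> P (Z @^-1` N) = 0%E ->
  cond_expect_ge0 P Y Z g -> cond_expect_ge0 P Y Z (g \_ (~` N)).
Proof.
move=> mY Y0 mN N0 [mg g0 gE]; have mNC := measurableC mN.
have mg' : measurable_fun setT (g \_ (~` N)).
  by apply/(measurable_restrictT _ mNC); exact: measurable_funTS.
split=> //.
  by move=> z; rewrite patchE; case: ifP.
move=> B mB; have mZB := measurable_preimageT mZ mB.
rewrite gE//; apply: ge0_ae_eq_integral => //.
- by apply/measurable_EFinP; apply: measurable_funTS; exact: measurableT_comp.
- by apply/measurable_EFinP; apply: measurable_funTS; exact: measurableT_comp.
- by move=> w _; rewrite lee_fin.
- by move=> w _; rewrite lee_fin patchE; case: ifP.
exists (Z @^-1` N); split => //; first exact: measurable_preimageT.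
move=> w /= ne; apply: contrapT => nN; apply: ne => _.
by rewrite patchE mem_set.
Qed.

(** Equality of infinite integrals carries no information, so uniqueness is applied on the sets q1
    <= K, where q1 is integrable. These sets exhaust [S]. *)
Lemma cond_integral_uniq (q1 q2 : S -> R) :
  measurable_fun setT q1 -> measurable_fun setT q2 ->
  (forall z, 0 <= q1 z) -> (forall z, 0 <= q2 z) ->
  (forall B, measurable B -> \int[P]_(w in Z @^-1` B) (q1 (Z w))%:E =
                             \int[P]_(w in Z @^-1` B) (q2 (Z w))%:E)%E ->
  P (Z @^-1` [set z | q1 z != q2 z]) = 0%E.
Proof.
move=> mq1 mq2 q10 q20 E.
pose mu := event_law P measurableT mZ.
have meq : measurable [set z | q1 z != q2 z].
  rewrite (_ : mkset _ = (fun z => q1 z - q2 z) @^-1` (~` [set 0])).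
    apply: measurable_preimageT; first exact: measurable_funB.
    exact: measurableC.
  by apply/seteqP; split => z /=; rewrite -subr_eq0 => /eqP.
have muE (q : S -> R) B : measurable_fun setT q -> (forall z, 0 <= q z) -> measurable B ->
    (\int[mu]_(z in B) (q z)%:E = \int[P]_(w in Z @^-1` B) (q (Z w))%:E)%E.
  move=> mq q0 mB; rewrite [LHS]integral_mkcond [RHS]integral_mkcond.
  rewrite ge0_integral_event_law//.
  - by apply/(measurable_restrictT _ mB); apply: measurable_funTS; exact/measurable_EFinP.
  - by move=> z; rewrite patchE; case: ifP => // _; rewrite lee_fin.
pose D (K : nat) := [set z | q1 z <= K%:R].
have mD K : measurable (D K).
  rewrite (_ : D K = q1 @^-1` `]-oo, K%:R]); first exact: measurable_preimageT.
  by apply/seteqP; split => z; rewrite /D /= in_itv.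
have aeD K : ae_eq mu (D K) (EFin \o q1) (EFin \o q2).
  apply: integral_ae_eq => //.
  - apply/integrableP; split.
      by apply: measurable_funTS; exact/measurable_EFinP.
    apply: (@le_lt_trans _ _ (\int[mu]_(z in D K) (K%:R)%:E)%E).
      apply: ge0_le_integral => //.
      + apply: measurable_funTS; apply: measurableT_comp => //; exact/measurable_EFinP.
      + by move=> z Dz /=; rewrite lee_fin ger0_norm.
    rewrite integral_cst// -ge0_fin_numE; last by rewrite mule_ge0.
    by rewrite fin_numM// fin_num_measure.
  - by apply: measurable_funTS; exact/measurable_EFinP.
  - by move=> B BD mB; rewrite !muE//; exact: E.
have : mu.-negligible [set z | q1 z != q2 z].
  apply: (@negligibleS _ _ _ _ (\bigcup_K ~` [set z | D K z -> (q1 z)%:E = (q2 z)%:E])).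
    move=> z /= /eqP ne; exists (Num.bound (q1 z)) => //=.
    have Dz : D (Num.bound (q1 z)) z by rewrite /D /= ltW// archi_boundP.
    by move=> /(_ Dz) [].
  by apply: negligible_bigcup => K; exact: aeD.
by move=> /(negligibleP _ meq); rewrite /mu /= /event_law setTI.
Qed.

Variables Y1 Y2 : T -> R.
Hypotheses (mY1 : measurable_fun setT Y1) (mY2 : measurable_fun setT Y2).

Let pos (Y : T -> R) w := Num.max (Y w) 0.
Let neg (Y : T -> R) w := Num.max (- Y w) 0.

Let mpos (Y : T -> R) : measurable_fun setT Y -> measurable_fun setT (pos Y).
Proof. by move=> mY; exact: measurable_maxr. Qed.

Let mneg (Y : T -> R) : measurable_fun setT Y -> measurable_fun setT (neg Y).
Proof. by move=> mY; apply: measurable_maxr => //; exact: measurableT_comp. Qed.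

Let pos_ge0 Y w : 0 <= pos Y w.
Proof. by rewrite /pos le_max lexx orbT. Qed.

Let neg_ge0 Y w : 0 <= neg Y w.
Proof. by rewrite /neg le_max lexx orbT. Qed.

Let integral_add (U V : T -> R) gU gV B : measurable_fun setT U -> measurable_fun setT V ->
  (forall w, 0 <= U w) -> (forall w, 0 <= V w) ->
  cond_expect_ge0 P U Z gU -> cond_expect_ge0 P V Z gV -> measurable B ->
  (\int[P]_(w in Z @^-1` B) (gU (Z w) + gV (Z w))%:E =
   \int[P]_(w in Z @^-1` B) (U w + V w)%:E)%E.
Proof.
move=> mU mV U0 V0 [mgU gU0 UE] [mgV gV0 VE] mB.
have mZB := measurable_preimageT mZ mB.
have mgUZ : measurable_fun setT (gU \o Z) by exact: measurableT_comp.
have mgVZ : measurable_fun setT (gV \o Z) by exact: measurableT_comp.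
under eq_integral do rewrite EFinD.
under [in RHS]eq_integral do rewrite EFinD.
rewrite !ge0_integralD//; try (by move=> w _; rewrite lee_fin);
  try (by apply: measurable_funTS; exact/measurable_EFinP).
by rewrite -UE// -VE.
Qed.

(** Where gp1 - gn1 = gp2 - gn2, also gp1 + gn2 = gp2 + gn1, and these nonnegative sums can be
    integrated even if a part has infinite integral. *)
Lemma cond_expect_agree g1 g2 B : cond_expect P Y1 Z g1 ->
  cond_expect P Y2 Z g2 -> measurable B -> (forall z, B z -> g1 z = g2 z) ->
  (\int[P]_(w in Z @^-1` B) (Num.max (Y1 w) 0 + Num.max (- Y2 w) 0)%:E =
   \int[P]_(w in Z @^-1` B) (Num.max (Y2 w) 0 + Num.max (- Y1 w) 0)%:E)%E.
Proof.
move=> [gp1 [gn1 [p1 n1 E1]]] [gp2 [gn2 [p2 n2 E2]]] mB gE.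
have e1 := integral_add (mpos mY1) (mneg mY2) (pos_ge0 Y1) (neg_ge0 Y2) p1 n2 mB.
have e2 := integral_add (mpos mY2) (mneg mY1) (pos_ge0 Y2) (neg_ge0 Y1) p2 n1 mB.
rewrite /pos /neg in e1 e2; rewrite -e1 -e2; apply: eq_integral => w; rewrite inE /= => Bw.
by congr (_%:E); have := gE _ Bw; rewrite E1 E2 => h; lra.
Qed.

(** Integrals determine versions only up to null sets, whereas a common version is a single
    function. All four parts are therefore set to 0 on the null set where the crossed sums q1 and q2
    differ. *)
Lemma cond_expect_common gp1 gn1 gp2 gn2 :
  cond_expect_ge0 P (fun w => Num.max (Y1 w) 0) Z gp1 ->
  cond_expect_ge0 P (fun w => Num.max (- Y1 w) 0) Z gn1 ->
  cond_expect_ge0 P (fun w => Num.max (Y2 w) 0) Z gp2 ->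
  cond_expect_ge0 P (fun w => Num.max (- Y2 w) 0) Z gn2 ->
  (forall B, measurable B ->
    \int[P]_(w in Z @^-1` B) (Num.max (Y1 w) 0 + Num.max (- Y2 w) 0)%:E =
    \int[P]_(w in Z @^-1` B) (Num.max (Y2 w) 0 + Num.max (- Y1 w) 0)%:E)%E ->
  exists g, cond_expect P Y1 Z g /\ cond_expect P Y2 Z g.
Proof.
move=> p1 n1 p2 n2 E.
have [mp1 p10 _] := p1. have [mn1 n10 _] := n1.
have [mp2 p20 _] := p2. have [mn2 n20 _] := n2.
pose q1 z := gp1 z + gn2 z; pose q2 z := gp2 z + gn1 z.
have mq1 : measurable_fun setT q1 by exact: measurable_funD.
have mq2 : measurable_fun setT q2 by exact: measurable_funD.
pose N := [set z | q1 z != q2 z].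
have mN : measurable N.
  rewrite (_ : N = (fun z => q1 z - q2 z) @^-1` (~` [set 0])).
    apply: measurable_preimageT; first exact: measurable_funB.
    exact: measurableC.
  by apply/seteqP; split => z; rewrite /N /= -subr_eq0 => /eqP.
have N0 : P (Z @^-1` N) = 0%E.
  apply: cond_integral_uniq => //; try (by move=> z; exact: addr_ge0).
  move=> B mB; rewrite /q1 /q2.
  rewrite (integral_add (mpos mY1) (mneg mY2) (pos_ge0 Y1) (neg_ge0 Y2) p1 n2 mB).
  rewrite (integral_add (mpos mY2) (mneg mY1) (pos_ge0 Y2) (neg_ge0 Y1) p2 n1 mB).
  exact: E.
have nul := cond_expect_ge0_null _ _ mN N0.
pose r (g : S -> R) := g \_ (~` N).
exists (fun z => r gp1 z - r gn1 z); split.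
  exists (r gp1), (r gn1); split => //.
    exact: (nul _ _ (mpos mY1) (pos_ge0 Y1)).
  exact: (nul _ _ (mneg mY1) (neg_ge0 Y1)).
exists (r gp2), (r gn2); split => //.
- exact: (nul _ _ (mpos mY2) (pos_ge0 Y2)).
- exact: (nul _ _ (mneg mY2) (neg_ge0 Y2)).
- move=> z; rewrite /r !patchE; case: ifPn => [|_]; last by rewrite !subr0.
  rewrite inE => nN; have q12 : q1 z = q2 z.
    by apply/eqP; apply: contrapT => /negP ?; apply: nN.
  by rewrite /q1 /q2 in q12; lra.
Qed.

End conditional_expectations.

(** * The functional equation *)

Section moments.
Context (R : realType).
Notation mu := (@lebesgue_measure R).
Implicit Types f : R -> R.

Definition itv_integrable f := forall x y, mu.-integrable `[x, y] (EFin \o f).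

Lemma itv_integrable_homo f : {homo f : x y / x <= y} -> itv_integrable f.
Proof.
move=> fhomo x y; apply: measurable_bounded_integrable => //.
- by rewrite /= lebesgue_measure_itv; case: ifP => // _; rewrite -EFinB ltry.
- apply: measurable_funTS; exact: nondecreasing_measurable.
exists (`|f x| + `|f y|); split; first by rewrite num_real.
move=> M MM z /=; rewrite in_itv/= => /andP[xz zy].
apply: ltW; apply: le_lt_trans MM; rewrite ler_norml; apply/andP; split.
  apply: (@le_trans _ _ (f x)); last exact: fhomo.
  by rewrite lerNl (le_trans (ler_norm _))// normrN lerDl.
apply: (@le_trans _ _ (f y)); first exact: fhomo.
by rewrite (le_trans (ler_norm _))// lerDr.
Qed.

Lemma itv_integrableM f (h : R -> R) : continuous h -> itv_integrable f ->
  itv_integrable (fun s => f s * h s).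
Proof.
move=> ch fi x y.
have := @integrableMl _ _ R mu `[x, y]%classic _ (EFin \o f) h (fi x y).
move=> /(_ _ _) H; apply: H => //.
  by apply: measurable_funTS; exact: continuous_measurable_fun.
have : compact (h @` `[x, y]).
  apply: continuous_compact; last exact: segment_compact.
  exact: continuous_subspaceT.
move=> /compact_bounded [M [Mr hM]]; exists M; split=> // z Mz s sxy.
by apply: (hM z Mz); exists s.
Qed.

(** An integral over [a, v] with weight (s - b)^n is a difference of two moments with base point
    [p]. The end point [x] and the centre [b] are separate arguments because the functional equation
    moves them together in some terms and singly in others. *)
Definition mom (n : nat) f (p x b : R) : R :=
  (\int[mu]_(s in `[p, x]) (f s * (s - b) ^+ n))%R.

Lemma itv_integrable_mulX f : itv_integrable f -> itv_integrable (fun s => f s * s).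
Proof. by apply: itv_integrableM => x; exact: cvg_id. Qed.

Lemma continuous_subX (b : R) n : continuous (fun s : R => (s - b) ^+ n).
Proof.
move=> x; apply: (@continuous_comp _ _ _ (fun s : R => s - b) (fun y => y ^+ n)).
  by apply: cvgB => //; exact: cvg_cst.
exact: exprn_continuous.
Qed.

(** Splitting off one factor [s - b] takes [b] out of the integral, at the cost of replacing [f s]
    by [f s * s]. Inductions on [n] thus end at moments that do not contain [b]. *)
Lemma momS n f p x b : itv_integrable f ->
  mom n.+1 f p x b = mom n (fun s => f s * s) p x b - b * mom n f p x b.
Proof.
move=> fi; have cX := @continuous_subX b n.
have i1 := itv_integrableM cX (itv_integrable_mulX fi) p x.
have i2 := itv_integrableM cX fi p x.
rewrite /mom -RintegralZl// -RintegralB//; last first.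
  exact: (integrableZl _ b i2).
by apply: eq_Rintegral => s _; rewrite exprS; ring.
Qed.

Lemma mom_continuous n f p (x0 b0 : R) : itv_integrable f -> p < x0 ->
  mom n f p z.1 z.2 @[z --> (x0, b0)] --> mom n f p x0 b0.
Proof.
move=> + px0; elim: n f => [|n IH] f fi.
  have E z : mom 0 f p z.1 z.2 = \int[mu]_(s in `[p, z.1]) f s.
    by apply: eq_Rintegral => s _; rewrite expr0 mulr1.
  under eq_fun do rewrite E.
  rewrite (E (x0, b0)) /=.
  apply: (@cvg_comp _ _ _ (fun z : R * R => z.1) (fun x => \int[mu]_(s in `[p, x]) f s)%R _ (nbhs x0)).
    exact: cvg_fst.
  have pb : p <= x0 + 1 by lra.
  have := parameterized_integral_continuous pb (fi _ _).
  move=> /continuous_within_itvP; have pb' : p < x0 + 1 by lra.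
  move=> /(_ pb') [H _ _].
  by apply: (H x0); rewrite in_itv/= px0 ltrDl ltr01.
rewrite momS//; under eq_fun do rewrite momS//.
apply: cvgB; first by apply: IH; exact: itv_integrable_mulX.
by apply: cvgM; [exact: cvg_snd|exact: IH].
Qed.

Lemma is_derive_mom n f p x b : itv_integrable f -> p < x ->
  {for x, continuous f} ->
  is_derive x 1 (fun y => mom n f p y b) (f x * (x - b) ^+ n).
Proof.
move=> fi px fx.
have xu : x < x + 1 by lra.
have := continuous_FTC1_closed xu (itv_integrableM (@continuous_subX b n) fi p (x + 1)) px.
move=> /(_ _) [|d D].
  by apply: cvgM => //; exact: continuous_subX.
by rewrite -D derive1E; exact: derivableP.
Qed.

Lemma is_derive_sub_lin (u h : R -> R) (x du dh : R) :
  is_derive x 1 u du -> is_derive x 1 h dh ->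
  is_derive x 1 (fun y => u y - y * h y) (du - (h x + x * dh)).
Proof.
move=> dU dH; rewrite (_ : (fun y => _) = u - id * h); last first.
  by apply/funext => y; rewrite !fctE.
apply: is_derive_eq; rewrite /GRing.scale /= mulr1; ring.
Qed.

Lemma is_derive_cast (u : R -> R) (x d d' : R) :
  is_derive x 1 u d -> d = d' -> is_derive x 1 u d'.
Proof. by move=> + <-. Qed.

Lemma is_derive_subc (u : R -> R) (x du c : R) :
  is_derive x 1 u du -> is_derive x 1 (fun y => u y - c) du.
Proof.
move=> dU; rewrite (_ : (fun y => _) = u - cst c)//.
by apply: is_derive_eq; rewrite subr0.
Qed.

(* Differentiating (-1)^n times the integral of f s (x - s)^n over [a, x]
   lowers n. *)
Lemma is_derive_mom_diag n f p a x : itv_integrable f -> p < x ->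
  {for x, continuous f} ->
  is_derive x 1 (fun y => mom n.+1 f p y y - mom n.+1 f p a y)
    (- n.+1%:R * (mom n f p x x - mom n f p a x)).
Proof.
move=> + px; elim: n f => [|n IH] f fi fx.
  have fxs : {for x, continuous (fun s => f s * s)}.
    by apply: cvgM => //; exact: cvg_id.
  have fis := itv_integrable_mulX fi.
  have mom0 h y b : mom 0 h p y b = mom 0 h p y 0.
    by apply: eq_Rintegral => s _; rewrite !expr0.
  rewrite (_ : (fun y => _) = (fun y => (mom 0 (fun s => f s * s) p y 0 - mom 0 (fun s => f s * s) p a 0)
      - y * (mom 0 f p y 0 - mom 0 f p a 0))); last first.
    apply/funext => y; rewrite !momS// mom0 (mom0 _ a) (mom0 f y) (mom0 f a); ring.
  have D1 := is_derive_mom 0 0 fis px fxs.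
  have D2 := is_derive_mom 0 0 fi px fx.
  have D1' : is_derive x 1 (fun y => mom 0 (fun s => f s * s) p y 0 - mom 0 (fun s => f s * s) p a 0) (f x * x).
    by move: (is_derive_subc (mom 0 (fun s => f s * s) p a 0) D1); rewrite expr0 mulr1.
  have D2' : is_derive x 1 (fun y => mom 0 f p y 0 - mom 0 f p a 0) (f x).
    by move: (is_derive_subc (mom 0 f p a 0) D2); rewrite expr0 mulr1.
  apply: (is_derive_cast (is_derive_sub_lin D1' D2')); rewrite (mom0 f x) (mom0 f a); ring.
have fxs : {for x, continuous (fun s => f s * s)}.
  by apply: cvgM => //; exact: cvg_id.
have fis := itv_integrable_mulX fi.
rewrite (_ : (fun y => _) = (fun y => (mom n.+1 (fun s => f s * s) p y y - mom n.+1 (fun s => f s * s) p a y)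
      - y * (mom n.+1 f p y y - mom n.+1 f p a y))); last first.
  by apply/funext => y; rewrite !(momS n.+1)//; ring.
apply: (is_derive_cast (is_derive_sub_lin (IH _ fis fxs) (IH _ fi fx))); rewrite !(@momS n f)//.
rewrite -[n.+2%:R]natr1; ring.
Qed.

Section functional_equation.
(* [gE] is the equation of the header, the left side being expanded so that the
   moments have a common base point [p]. *)
Variables (g : R -> R) (p : R) (M : nat).
Let N := M.+1.
Hypothesis gi : itv_integrable g.
Hypothesis gE : forall a v, p < a -> a < v ->
  mom N g p v a - mom N g p a a + N%:R * g a * ((v - a) ^+ N.+1 / N.+1%:R) =
  N.+1%:R * ((-1) ^+ N * (mom N g p v v - mom N g p a v)).

(** In [gE] the coefficient of [g a] is N (v - a)^(N+1) / (N + 1), nonzero because N > 0, and all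
    other terms are moments, continuous in [a]. Solving for [g a] with [v] fixed gives
    continuity. *)
Lemma functional_equation_continuous a : p < a -> {for a, continuous g}.
Proof.
move=> pa; pose v := a + 1.
have av : a < v by rewrite /v; lra.
pose Phi x := (N.+1%:R * ((-1) ^+ N * (mom N g p v v - mom N g p x v))
   - (mom N g p v x - mom N g p x x)) * N.+1%:R / N%:R * ((v - x) ^+ N.+1)^-1.
have E x : p < x -> x < v -> g x = Phi x.
  move=> px xv; rewrite /Phi -gE//.
  have vx : (v - x) ^+ N.+1 != 0 by rewrite expf_neq0// subr_eq0 gt_eqF.
  move: vx; set q := _ ^+ _ => q0.
  have N0 : N%:R != 0 :> R by rewrite pnatr_eq0.
  have N1 : N.+1%:R != 0 :> R by rewrite pnatr_eq0.
  by move: N0 N1; move: (N%:R) (N.+1%:R) => n0 n1 N0 N1; field; rewrite q0 N0.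
have m2 (u h : R -> R) : continuous u -> continuous h -> u a > p ->
    mom N g p (u x) (h x) @[x --> a] --> mom N g p (u a) (h a).
  move=> cu ch ua.
  apply: (@cvg_comp _ _ _ (fun x => (u x, h x)) (fun z => mom N g p z.1 z.2) _ (nbhs (u a, h a))).
    exact: (cvg_pair (cu a) (ch a)).
  exact: mom_continuous.
have cid' : continuous (fun x : R => x) by move=> x; exact: cvg_id.
have cv' : continuous (fun _ : R => v) by move=> x; exact: cvg_cst.
have pv : p < v by lra.
have cPhi : Phi x @[x --> a] --> Phi a.
  apply: cvgM.
    apply: cvgMl; apply: cvgMl; apply: cvgB.
      apply: cvgMr; apply: cvgMr; apply: cvgB; first exact: cvg_cst.
      exact: (m2 (fun x => x) (fun=> v)).
    apply: cvgB; first exact: (m2 (fun=> v) (fun x => x)).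
    exact: (m2 (fun x => x) (fun x => x)).
  apply: cvgV; first by rewrite expf_neq0// subr_eq0 gt_eqF.
  apply: (@cvg_comp _ _ _ (fun x => v - x) (fun y => y ^+ N.+1) _ (nbhs (v - a))).
    by apply: cvgB; [exact: cvg_cst|exact: cvg_id].
  exact: exprn_continuous.
rewrite /prop_for /continuous_at (E a)//.
apply: cvg_trans cPhi; apply: near_eq_cvg; near=> x; rewrite E//.
  by near: x; exact: lt_nbhsr.
by near: x; exact: lt_nbhsl.
Unshelve. all: by end_near. Qed.

(** The weight (v - s)^N vanishes at s = v, so differentiating the right side gives no boundary term
    and only lowers the power; the factor (-1)^N absorbs the sign from [is_derive_mom_diag]. *)
Lemma functional_equation_dv a v : p < a -> a < v ->
  (g v + N%:R * g a) * (v - a) ^+ N =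
  N.+1%:R * N%:R * ((-1) ^+ M * (mom M g p v v - mom M g p a v)).
Proof.
move=> pa av; have pv := lt_trans pa av.
have cv := functional_equation_continuous pv.
have D1 := is_derive_subc (mom N g p a a) (is_derive_mom N a gi pv cv).
have DX : is_derive v 1 (fun y : R => (y - a) ^+ N.+1) (N.+1%:R * (v - a) ^+ N).
  rewrite (_ : (fun y => _) = (id - cst a) ^+ N.+1); last by apply/funext => y; rewrite !fctE.
  by apply: is_derive_eq; rewrite subr0 /GRing.scale /= mulr1.
have D1' : is_derive v 1 (fun y => mom N g p y a - mom N g p a a +
    N%:R * g a * ((y - a) ^+ N.+1 / N.+1%:R)) ((g v + N%:R * g a) * (v - a) ^+ N).
  rewrite (_ : (fun y => _) = (fun y => mom N g p y a - mom N g p a a) +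
    (N%:R * g a / N.+1%:R) *: (fun y => (y - a) ^+ N.+1)); last first.
    by apply/funext => y; rewrite !fctE /GRing.scale /=; ring.
  apply: (is_derive_cast (is_deriveD D1 (is_deriveZ _ DX))).
  rewrite /GRing.scale /= mulrA divfK ?pnatr_eq0//.
  by rewrite -mulrDl.
have D2 := is_derive_mom_diag M a gi pv cv.
have D2' : is_derive v 1 (fun y => N.+1%:R * ((-1) ^+ N * (mom N g p y y - mom N g p a y)))
    (N.+1%:R * N%:R * ((-1) ^+ M * (mom M g p v v - mom M g p a v))).
  rewrite (_ : (fun y => _) = (N.+1%:R * (-1) ^+ N) *: (fun y => mom N g p y y - mom N g p a y)); last first.
    by apply/funext => y; rewrite !fctE /GRing.scale /=; ring.
  apply: (is_derive_cast (is_deriveZ _ D2)); rewrite /GRing.scale /= /N exprS.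
  ring.
have E : \near v, mom N g p v a - mom N g p a a + N%:R * g a * ((v - a) ^+ N.+1 / N.+1%:R) =
    N.+1%:R * ((-1) ^+ N * (mom N g p v v - mom N g p a v)).
  by near=> y; apply: gE => //; near: y; exact: lt_nbhsr.
rewrite -(@derive_val _ _ _ _ _ _ _ D1') -(@derive_val _ _ _ _ _ _ _ D2').
exact: near_eq_derive.
Unshelve. all: by end_near. Qed.

(** The identity of [functional_equation_dv], solved for its value at the lower point, expresses g
    near [a] by a moment with moving end point, which is differentiable as g is continuous. The
    moment left in the derivative is eliminated by the same identity. *)
Lemma functional_equation_da a v : p < a -> a < v ->
  is_derive a 1 g ((g v - g a) / (v - a)).
Proof.
move=> pa av.
have ca := functional_equation_continuous pa.
pose C := N.+1%:R * (-1) ^+ M : R.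
pose Psi x := C * (mom M g p v v - mom M g p x v) * ((v - x) ^+ N)^-1 - g v / N%:R.
have va : (v - a) != 0 by rewrite subr_eq0 gt_eqF.
have E x : p < x -> x < v -> g x = Psi x.
  move=> px xv; have := functional_equation_dv px xv.
  have vx : (v - x) ^+ N != 0 by rewrite expf_neq0// subr_eq0 gt_eqF.
  have N0 : N%:R != 0 :> R by rewrite pnatr_eq0.
  move=> e; rewrite /Psi /C.
  have -> : N.+1%:R * (-1) ^+ M * (mom M g p v v - mom M g p x v) =
      (g v + N%:R * g x) * (v - x) ^+ N / N%:R.
    by rewrite e; field.
  by field; rewrite N0 vx.
have D1 := is_derive_mom M v gi pa ca.
have DX : is_derive a 1 (fun y : R => (v - y) ^+ N) (- (N%:R * (v - a) ^+ M)).
  rewrite (_ : (fun y => _) = (cst v - id) ^+ N); last by apply/funext => y; rewrite !fctE.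
  by apply: is_derive_eq; rewrite sub0r /GRing.scale /= mulrN mulr1.
have vaN : (v - a) ^+ N != 0 by rewrite expf_neq0.
have DV := @is_deriveV _ (fun y : R => (v - y) ^+ N) _ _ _ vaN DX.
have DM : is_derive a 1 (fun x => mom M g p v v - mom M g p x v) (- (g a * (a - v) ^+ M)).
  rewrite (_ : (fun y => _) = cst (mom M g p v v) - (fun x => mom M g p x v))//.
  apply: (is_derive_cast (is_deriveB (is_derive_cst (mom M g p v v) a 1) D1)).
  by rewrite sub0r.
have DPsi : is_derive a 1 Psi ((g v - g a) / (v - a)).
  apply: (@near_eq_is_derive _ _ _ (C *: ((fun x => mom M g p v v - mom M g p x v) *
     (fun x => ((v - x) ^+ N)^-1)) - cst (g v / N%:R))).
    by near=> x; rewrite /Psi !fctE /GRing.scale /=; ring.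
  apply: (is_derive_cast (is_deriveB (is_deriveZ C (is_deriveM DM DV))
    (is_derive_cst (g v / N%:R) a 1))).
  rewrite subr0 /GRing.scale /=.
  have := functional_equation_dv pa av.
  have -> : (a - v) ^+ M = (-1) ^+ M * (v - a) ^+ M by rewrite -exprMn mulN1r opprB.
  move: (mom M g p v v - mom M g p a v) => m.
  rewrite /C /N -[M.+2%:R]natr1 [(v - a) ^+ M.+1]exprS.
  have s2 : (-1) ^+ M * (-1) ^+ M = 1 :> R by rewrite -exprMn mulrNN mulr1 expr1n.
  have q0 : (v - a) ^+ M != 0 by rewrite expf_neq0.
  have N0 : M.+1%:R != 0 :> R by rewrite pnatr_eq0.
  have N1 : M.+1%:R + 1 != 0 :> R by rewrite natr1 pnatr_eq0.
  move: s2 q0 N0 N1 va; move: ((-1) ^+ M : R) (M.+1%:R : R) (g v) (g a) => e n x y.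
  move: (v - a) ((v - a) ^+ M) => t q s2 q0 n0 n1 t0 eq.
  (* Here [e] is (-1)^M, [n] is N, [t] is v - a and [q] is (v - a)^M; the identity [eq] determines
     the moment [m] up to sign. *)
  have em : e * m = (x + n * y) * (t * q) / ((n + 1) * n).
    by rewrite eq; field; rewrite n1 n0.
  transitivity ((n + 1) * ((e * m) * (n * q) / (t * q) ^+ 2 - (e * e) * y * q / (t * q))).
    by field; rewrite t0 q0.
  by rewrite em s2; field; rewrite t0 q0 n1 n0.
apply: near_eq_is_derive DPsi; near=> x; rewrite E//.
  by near: x; exact: lt_nbhsr.
by near: x; exact: lt_nbhsl.
Unshelve. all: by end_near. Qed.

(** The derivative at [a] does not depend on [v], so all chords starting at [a] have the same
    slope. *)
Lemma functional_equation_affine a : p < a ->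
  exists beta, forall v, a <= v -> g v = g a + beta * (v - a).
Proof.
move=> pa; exists ('D_1 g a) => v.
rewrite le_eqVlt => /predU1P[<-|av]; first by rewrite subrr mulr0 addr0.
have D := functional_equation_da pa av.
have va : v - a != 0 by rewrite subr_eq0 gt_eqF.
have e := @derive_val _ _ _ _ _ _ _ D.
rewrite e mulfVK//; ring.
Qed.

End functional_equation.
End moments.

(** * Quantile transform *)

Section distribution_function.
Context (R : realType) d (T : measurableType d) (P : probability T R).
Variable X : nat -> {RV P >-> R}.
Variable F : R -> R.
Hypothesis X_cdf : forall j x, cdf (X j.+1) x = (F x)%:E.
Hypothesis F_ac : distribution P (X 1%N) `<< (@lebesgue_measure R).

Lemma prob_le j x : P (X j.+1 @^-1` `]-oo, x]) = (F x)%:E.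
Proof. exact: X_cdf. Qed.

Lemma F_homo x y : x <= y -> F x <= F y.
Proof.
by move=> xy; rewrite -lee_fin -!(X_cdf 0); exact: cdf_nondecreasing.
Qed.

Lemma F_ge0 x : 0 <= F x.
Proof. by rewrite -lee_fin -(X_cdf 0) cdf_ge0. Qed.

Lemma F_le1 x : F x <= 1.
Proof. by rewrite -lee_fin -(X_cdf 0) cdf_le1. Qed.

Lemma measurable_F : measurable_fun setT F.
Proof. exact: (nondecreasing_measurable measurableT F_homo). Qed.

Lemma prob_gt j x : P (X j.+1 @^-1` [set y | x < y]) = (1 - F x)%:E.
Proof.
rewrite EFinB -(prob_le j) -probability_setC; last exact: measurable_RV.
by congr (P _); apply/seteqP; split => w /=; rewrite in_itv/= ltNge => /negP.
Qed.

(** Absolute continuity enters here: a point has Lebesgue measure 0, so X_1 has no atom at [x], and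
    up to a null event X_1 <= x is the increasing union of the events X_1 <= x - 1/(n+1). *)
Lemma F_left_limit x q : (forall y, y < x -> F y <= q) -> F x <= q.
Proof.
move=> Fq; rewrite -lee_fin -(prob_le 0).
have mX B : measurable B -> measurable (X 1%N @^-1` B) by exact: measurable_RV.
have X0 : P (X 1%N @^-1` [set x]) = 0%E.
  have /null_content_dominatesP := F_ac.
  by apply => //; exact: lebesgue_measure_set1.
pose A n := X 1%N @^-1` `]-oo, x - n.+1%:R^-1].
have -> : P (X 1%N @^-1` `]-oo, x]) = P (\bigcup_n A n).
  rewrite -[RHS](measureU0 _ (mX _ (measurable_set1 x)) X0); last first.
    by apply: bigcup_measurable => n _; exact: mX.
  congr (P _); apply/seteqP; split => w /=.
    rewrite in_itv/= le_eqVlt => /predU1P[|xw]; [by right|left].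
    have e0 : 0 < x - X 1%N w by rewrite subr_gt0.
    have [n _ /(_ n (leqnn n))/= nx] := near_infty_natSinv_lt (PosNum e0).
    by exists n => //; rewrite /A /= in_itv/= lerBrDr -lerBrDl ltW.
  rewrite in_itv/= => -[[n _ /=]|->]; last by [].
  by rewrite /A /= in_itv/= => /le_trans; apply; rewrite gerBl.
have ndA : nondecreasing_seq A.
  move=> i j ij; apply/subsetPset => w; rewrite /A /= !in_itv/= => /le_trans; apply.
  by rewrite lerD2l lerN2 lef_pV2 ?posrE ?ltr0n// ler_nat.
have := nondecreasing_cvg_mu (mu := P) (fun n => mX _ (measurable_itv `]-oo, x - n.+1%:R^-1]))
  (bigcupT_measurable _ (fun n => mX _ (measurable_itv `]-oo, x - n.+1%:R^-1]))) ndA.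
move=> cv; apply: (cvge_to_le cv); apply: nearW => n /=.
by rewrite /A prob_le lee_fin; apply: Fq; rewrite gtrBl.
Qed.

Lemma F_right_limit x q : (forall y, x < y -> q <= F y) -> q <= F x.
Proof.
move=> Fq; rewrite -lee_fin -(X_cdf 0).
have cv := @cdf_right_continuous _ _ _ P (X 1%N) x.
apply: (cvge_to_ge cv); near=> y; rewrite (X_cdf 0) lee_fin; apply: Fq.
by near: y; exact: nbhs_right_gt.
Unshelve. all: by end_near. Qed.

(** The generalized inverse of F, meaningful for 0 < q < 1, where the infimum is taken over a
    nonempty set bounded below. *)
Definition qF (q : R) : R := inf [set x | q <= F x].

Lemma qF_has_inf q : 0 < q < 1 -> has_inf [set x | q <= F x].
Proof.
move=> /andP[q0 q1]; split.
  have := cvg_cdfy1 (X 1%N) => /fine_cvgP[_].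
  move=> /cvgrPdist_lt/(_ (1 - q)); rewrite subr_gt0 q1 => /(_ isT) H.
  have [M [_ HM]] := H; exists (M + 1); have := HM (M + 1).
  rewrite ltrDl ltr01 => /(_ isT); rewrite /= (X_cdf 0)/= => h.
  have := ler_norm (1 - F (M + 1)); lra.
have := cvg_cdfNy0 (X 1%N) => /fine_cvgP[_].
move=> /cvgrPdist_lt/(_ q q0) [M [_ HM]]; exists (M - 1) => x /= qx.
rewrite leNgt; apply/negP => xM.
have := HM (M - 1); rewrite gtrBl ltr01 => /(_ isT); rewrite /= (X_cdf 0)/= sub0r normrN.
rewrite ger0_norm ?F_ge0// => h.
have := F_homo (ltW xM); lra.
Qed.

Lemma qF_lt q y : 0 < q < 1 -> y < qF q -> F y < q.
Proof.
move=> q01 yq; rewrite ltNge; apply/negP => qy; move: yq; rewrite ltNge => /negP; apply.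
by apply: ge_inf => //; have [] := qF_has_inf q01.
Qed.

Lemma F_qF q : 0 < q < 1 -> F (qF q) = q.
Proof.
move=> q01; apply/eqP; rewrite eq_le; apply/andP; split.
  by apply: F_left_limit => y /(qF_lt q01)/ltW.
apply: F_right_limit => y qy.
have e0 : 0 < y - qF q by rewrite subr_gt0.
have [x /= qx xy] := inf_adherent e0 (qF_has_inf q01).
by apply: (le_trans qx); apply: F_homo; apply: ltW; move: xy; rewrite -/(qF q); lra.
Qed.

Lemma qF_le q x : 0 < q < 1 -> (qF q <= x) = (q <= F x).
Proof.
move=> q01; apply/idP/idP => [qx|].
  by rewrite -[leLHS](F_qF q01); exact: F_homo.
by move=> qFx; rewrite leNgt; apply/negP => /(qF_lt q01); rewrite ltNge qFx.
Qed.

Lemma measurable_F_preimage (B : set R) : measurable B -> measurable (F @^-1` B).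
Proof. by apply: measurable_preimageT; exact: measurable_F. Qed.

Lemma measurable_F_gt q : measurable [set y | q < F y].
Proof.
rewrite (_ : mkset _ = F @^-1` `]q, +oo[); first exact: measurable_F_preimage.
by apply/seteqP; split => y /=; rewrite in_itv/= andbT.
Qed.

(** F(X) is uniform. By monotonicity q < F y implies y > qF q, but the converse fails where F is
    constant just above [qF q]; the lower bound therefore uses y > qF q' for q' > q close to q. *)
Lemma prob_F_gt j q : 0 <= q < 1 -> P (X j.+1 @^-1` [set y | q < F y]) = (1 - q)%:E.
Proof.
move=> /andP[q0 q1].
have mX B : measurable B -> measurable (X j.+1 @^-1` B) by exact: measurable_RV.
have mgt q' : measurable (X j.+1 @^-1` [set y | q' < F y]) by apply: mX; exact: measurable_F_gt.
have mgt' x : measurable (X j.+1 @^-1` [set y | x < y]).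
  apply: mX; rewrite (_ : mkset _ = `]x, +oo[%classic); first exact: measurable_itv.
  by apply/seteqP; split => y /=; rewrite in_itv/= andbT.
apply/eqP; rewrite eq_le; apply/andP; split.
  have [->|qn0] := eqVneq q 0.
    by rewrite subr0; apply: probability_le1; exact: mgt.
  have q01 : 0 < q < 1 by rewrite lt_neqAle eq_sym qn0 q0.
  rewrite -[in leRHS](F_qF q01) -(prob_gt j); apply: le_measure; rewrite ?inE// => w /=.
  by move=> qF'; rewrite ltNge; apply/negP => /F_homo; rewrite (F_qF q01) leNgt qF'.
have lo q' : q < q' -> q' < 1 -> ((1 - q')%:E <= P (X j.+1 @^-1` [set y | (q < F y)%R]))%E.
  move=> qq' q'1; have q01 : 0 < q' < 1 by rewrite q'1 (le_lt_trans q0).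
  rewrite -[in leLHS](F_qF q01) -(prob_gt j); apply: le_measure; rewrite ?inE// => w /= /ltW/F_homo.
  by rewrite (F_qF q01); exact: lt_le_trans.
rewrite -(fineK (fin_num_measure P _ (mgt q))) lee_fin.
(* The minimum keeps [q'] below 1 and within [e] of [q]. *)
apply/ler_addgt0Pl => e e0; pose q' := Num.min (q + e) ((q + 1) / 2).
have h1 : q < q' by rewrite /q' lt_min; apply/andP; split; lra.
have h2 : q' < 1 by rewrite /q' gt_min; apply/orP; right; lra.
have h3 : q' <= q + e by rewrite /q' ge_min lexx.
have := lo q' h1 h2; rewrite -[leRHS](fineK (fin_num_measure P _ (mgt q))) lee_fin; lra.
Qed.

(* An interval on which F is constant would contain a rational, so [regular]
   leaves out only values that F takes with probability 0; on it [Gexp]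
   inverts [Hexp]. *)
Definition regular : set R :=
  [set x | 0 < F x < 1 /\ forall r : rat, F x <> F (ratr r)].

Lemma measurable_regular : measurable regular.
Proof.
rewrite (_ : regular = F @^-1` `]0, 1[ `&` \bigcap_(r : rat) F @^-1` (~` [set F (ratr r)])).
  apply: measurableI; first exact: measurable_F_preimage.
  rewrite -[X in measurable X]setCK setC_bigcap; apply: measurableC.
  apply: bigcupT_measurable_rat => r; rewrite -preimage_setC setCK.
  exact: measurable_F_preimage.
apply/seteqP; split => x /=; rewrite in_itv/=.
  by move=> [? h]; split => // r _ /=; exact: h.
by move=> [? h]; split => // r; exact: h.
Qed.

(** The event lies between the upper level sets of F at c - e and at c, so its probability is at
    most e. The cases are due to the range of levels that [prob_F_gt] admits. *)
Lemma prob_F_eq j c : P (X j.+1 @^-1` (F @^-1` [set c])) = 0%E.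
Proof.
have mX B : measurable B -> measurable (X j.+1 @^-1` B) by exact: measurable_RV.
have mc : measurable (X j.+1 @^-1` (F @^-1` [set c])).
  by apply: mX; exact: measurable_F_preimage.
have mgt q' : measurable (X j.+1 @^-1` [set y | q' < F y]) by apply: mX; exact: measurable_F_gt.
apply/eqP; rewrite -measure_le0.
have [c0|c0] := leP c 0.
  have h : P (X j.+1 @^-1` [set y | 0 < F y]) = 1%E by rewrite prob_F_gt ?lexx ?ltr01// subr0.
  have : P (~` (X j.+1 @^-1` [set y | 0 < F y])) = 0%E.
    by rewrite probability_setC// h subee.
  move=> <-; apply: le_measure; rewrite ?inE//; first exact: measurableC.
  by move=> w /= Fc; rewrite Fc; apply/negP; rewrite -leNgt.
apply/lee_addgt0Pr => e e0; rewrite add0e.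
have [c1|c1] := ltP 1 c.
  have h0 : X j.+1 @^-1` (F @^-1` [set c]) = set0.
    by apply/seteqP; split => // w /= Fc; have := F_le1 (X j.+1 w); rewrite Fc leNgt c1.
  by rewrite h0 measure0 lee_fin ltW.
pose q := Num.max 0 (c - e).
have qc : q < c by rewrite /q gt_max c0/=; lra.
have q0 : 0 <= q by rewrite /q le_max lexx.
have eq : c - e <= q by rewrite /q le_max lexx orbT.
have q01 : 0 <= q < 1 by rewrite q0 (lt_le_trans qc).
apply: (@le_trans _ _ (P (X j.+1 @^-1` [set y | (q < F y)%R] `\` X j.+1 @^-1` [set y | (c < F y)%R]))).
  apply: le_measure; rewrite ?inE//; first exact: measurableD.
  by move=> w /= ->; split=> //; rewrite ltxx.
have sub : X j.+1 @^-1` [set y | c < F y] `<=` X j.+1 @^-1` [set y | q < F y].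
  by move=> w /=; exact: lt_trans.
rewrite measureD//; last by rewrite ltey_eq fin_num_measure.
rewrite setIidr// [X in (X - _ <= _)%E](prob_F_gt j q01).
have [c1'|c1'] := ltP c 1.
  have c01 : 0 <= c < 1 by rewrite c1' ltW.
  by rewrite [X in (_ - X <= _)%E](prob_F_gt j c01) -EFinB lee_fin; lra.
apply: (@le_trans _ _ (1 - q)%:E); first by rewrite leeBlDr ?fin_num_measure// leeDl.
by rewrite lee_fin; lra.
Qed.

Lemma prob_nonregular j : P (X j.+1 @^-1` ~` regular) = 0%E.
Proof.
have mX B : measurable B -> measurable (X j.+1 @^-1` B) by exact: measurable_RV.
apply/negligibleP; first by apply: mX; apply: measurableC; exact: measurable_regular.
have nF c : P.-negligible (X j.+1 @^-1` (F @^-1` [set c])).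
  by apply/negligibleP; [apply: mX; exact: measurable_F_preimage|exact: prob_F_eq].
(* Rationals are enumerated by their codes; a number that codes no rational yields the default 0 and
   adds just another null event. *)
have nr : P.-negligible (\bigcup_(n : nat) X j.+1 @^-1` (F @^-1` [set F (odflt 0 (omap ratr (unpickle n)))])).
  by apply: negligible_bigcup => n; exact: nF.
apply: negligibleS (negligibleU (negligibleU (nF 0) (nF 1)) nr) => w /= nreg.
have [F0|F0] := eqVneq (F (X j.+1 w)) 0; first by left; left.
have [F1|F1] := eqVneq (F (X j.+1 w)) 1; first by left; right.
right; apply: contrapT => nex; apply: nreg; split.
  by rewrite !lt_neqAle F_ge0 F_le1 eq_sym F0 F1.
by move=> r Fr; apply: nex; exists (pickle r) => //; rewrite /preimage /mkset pickleK.
Qed.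

Lemma regular_lt x y : regular x -> y < x -> F y < F x.
Proof.
move=> [_ rx] yx; have [r] := rat_in_itvoo yx.
rewrite in_itv/= => /andP[yr rx'].
apply: (le_lt_trans (F_homo (ltW yr))).
by rewrite lt_neqAle F_homo ?ltW// andbT; apply/eqP => e; exact: (rx r).
Qed.

Lemma qF_regular x : regular x -> qF (F x) = x.
Proof.
move=> rx; have [F01 _] := rx; apply/eqP; rewrite eq_le qF_le// lexx/= leNgt.
by apply/negP => /(regular_lt rx); rewrite F_qF// ltxx.
Qed.

(** Where F = 1 the convention ln 0 = 0 gives the value 0, hence the condition F < 1 in the
    monotonicity statement. *)
Definition Hexp (x : R) : R := - ln (1 - F x).
Definition Gexp (s : R) : R := qF (1 - expR (- s)).

Lemma measurable_Hexp : measurable_fun setT Hexp.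
Proof.
apply: measurableT_comp => //; apply: (measurableT_comp (@measurable_ln R)).
by apply: measurable_funB => //; exact: measurable_F.
Qed.

Lemma Hexp_ge0 x : 0 <= Hexp x.
Proof. by rewrite /Hexp oppr_ge0 ln_le0// gerBl F_ge0. Qed.

Lemma expR_Hexp x : F x < 1 -> expR (- Hexp x) = 1 - F x.
Proof. by move=> Fx; rewrite /Hexp opprK lnK// posrE subr_gt0. Qed.

Lemma Hexp_homo x y : F y < 1 -> x <= y -> Hexp x <= Hexp y.
Proof.
move=> Fy xy; have Fxy := F_homo xy.
by rewrite -lerN2 -ler_expR !expR_Hexp ?(le_lt_trans Fxy)// lerB.
Qed.

Lemma Gexp01 (s : R) : 0 < s -> 0 < 1 - expR (- s) < 1.
Proof.
move=> s0; rewrite subr_gt0 gtrBl expR_gt0 andbT.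
by rewrite -expR0 ltr_expR oppr_lt0.
Qed.

Lemma prob_Hexp_gt j s : 0 <= s ->
  P (X j.+1 @^-1` [set y | s < Hexp y]) = (expR (- s))%:E.
Proof.
move=> s0.
have s01 : 0 <= 1 - expR (- s) < 1.
  rewrite subr_ge0 gtrBl expR_gt0 andbT -expR0 ler_expR oppr_le0//.
have mX B : measurable B -> measurable (X j.+1 @^-1` B) by exact: measurable_RV.
have m1 : measurable (X j.+1 @^-1` [set y | s < Hexp y]).
  apply: mX; rewrite (_ : mkset _ = Hexp @^-1` `]s, +oo[).
    by apply: measurable_preimageT => //; exact: measurable_Hexp.
  by apply/seteqP; split => y /=; rewrite in_itv/= andbT.
have m2 : measurable (X j.+1 @^-1` [set y | 1 - expR (- s) < F y]).
  by apply: mX; exact: measurable_F_gt.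
have m3 : measurable (X j.+1 @^-1` ~` regular).
  by apply: mX; apply: measurableC; exact: measurable_regular.
have <- : 1 - (1 - expR (- s)) = expR (- s) by ring.
rewrite -(prob_F_gt j s01).
rewrite -(measureU0 m1 m3 (prob_nonregular j)) -(measureU0 m2 m3 (prob_nonregular j)).
congr (P _); rewrite -!preimage_setU; apply/seteqP.
have E x : regular x -> (s < Hexp x) = (1 - expR (- s) < F x).
  move=> [/andP[_ F1] _].
  by rewrite -ltrN2 -ltr_expR expR_Hexp// ltrBlDr -ltrBlDl.
by split => w /= [|nr]; [|by right|..|by right];
  have [rw|nr] := pselect (regular (X j.+1 w)); (try by right); rewrite E//; left.
Qed.

Lemma prob_gt_Hexp j x : regular x ->
  P (X j.+1 @^-1` [set y | x < y]) = (expR (- Hexp x))%:E.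
Proof. by move=> [/andP[_ F1] _]; rewrite expR_Hexp// prob_gt. Qed.

Lemma Gexp_Hexp x : regular x -> Gexp (Hexp x) = x.
Proof.
move=> rx; have [/andP[_ F1] _] := rx.
by rewrite /Gexp expR_Hexp// opprB addrC subrK qF_regular.
Qed.

Lemma F_Gexp s : 0 < s -> F (Gexp s) = 1 - expR (- s).
Proof. by move=> /Gexp01; exact: F_qF. Qed.

Lemma Gexp_le s x : 0 < s -> (Gexp s <= x) = (1 - expR (- s) <= F x).
Proof. by move=> /Gexp01; exact: qF_le. Qed.

Lemma Gexp_lt s t : 0 < s -> s < t -> Gexp s < Gexp t.
Proof.
move=> s0 st; have t0 := lt_trans s0 st.
rewrite ltNge Gexp_le// F_Gexp// -ltNge ltrD2l ltrN2 ltr_expR ltrN2//.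
Qed.

(** By [Gexp_le], F (Gexp s - e) is strictly below 1 - expR (- s), and stays below it for arguments
    near [s]. From the right [Gexp] may jump across an interval on which F is constant. *)
Lemma Gexp_left_continuous s : 0 < s -> Gexp x @[x --> s^'-] --> Gexp s.
Proof.
move=> s0; apply/cvgrPdist_le => e e0.
have h : 1 - expR (- s) > F (Gexp s - e).
  by rewrite ltNge -Gexp_le// -ltNge gtrBl.
have cE : (1 - expR (- x)) @[x --> s] --> 1 - expR (- s).
  apply: cvgB; first exact: cvg_cst.
  apply: (@cvg_comp _ _ _ -%R expR _ (nbhs (- s))); last exact: continuous_expR.
  by apply: cvgN; exact: cvg_id.
have near_gt : \forall x \near s, F (Gexp s - e) < 1 - expR (- x) by exact: (cvgr_gt _ cE).
near=> x.
have x0 : 0 < x by near: x; exact: nbhs_left_gt.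
have xs : x < s by near: x; exact: nbhs_left_lt.
have xh : F (Gexp s - e) < 1 - expR (- x).
  by near: x; apply: cvg_at_left_filter near_gt; exact: cvg_id.
have h1 := Gexp_lt x0 xs.
have h2 : Gexp s - e < Gexp x by rewrite ltNge Gexp_le// -ltNge.
by rewrite ger0_norm ?subr_ge0 ?ltW//; lra.
Unshelve. all: by end_near. Qed.

(** Every [Gexp t] with t > 0 belongs to the support, hence is at least [lF]; passing from s / 2 to
    s makes the inequality strict. *)
Lemma left_endpoint_lt_Gexp lF s : left_endpoint F = lF%:E -> 0 < s -> lF < Gexp s.
Proof.
move=> lFE s0.
have le t : 0 < t -> lF <= Gexp t.
  move=> t0; rewrite -lee_fin -lFE; apply: ereal_inf_lbound; exists (Gexp t) => // e e0.
  apply: (@lt_le_trans _ _ (1 - expR (- t))).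
    by rewrite ltNge -Gexp_le// -ltNge gtrBl.
  by rewrite -F_Gexp//; apply: F_homo; rewrite lerDl ltW.
apply: (le_lt_trans (le (s / 2) _)); first by rewrite divr_gt0.
by apply: Gexp_lt; rewrite ?divr_gt0// ltr_pdivrMr// mulr_natr mulr2n ltrDl.
Qed.

End distribution_function.

Lemma norm_le_between (R : realDomainType) (x y z : R) : x <= y -> y <= z ->
  `|y| <= `|x| + `|z|.
Proof.
move=> xy yz; have := ler_norm z; have := ler_norm (- x); rewrite normrN => hx hz.
have := normr_ge0 z; have := normr_ge0 x => x0 z0.
by rewrite ler_norml; apply/andP; split; lra.
Qed.

(** [C] and [C'] may have infinite integrals, so only the finite integral of [A] is cancelled. Both
    directions use this: once [A] and [A'] are multiples of gaps, once they are sums of positive and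
    negative parts on an event where these are bounded. *)
Lemma ge0_integral_cancel d (T : measurableType d) (R : realType)
    (mu : {measure set T -> \bar R}) (E : set T) (A A' C C' : T -> R) :
  measurable E ->
  measurable_fun E A -> measurable_fun E A' ->
  measurable_fun E C -> measurable_fun E C' ->
  (forall w, 0 <= A w) -> (forall w, 0 <= A' w) ->
  (forall w, 0 <= C w) -> (forall w, 0 <= C' w) ->
  (forall w, E w -> A w + C w = A' w + C' w) ->
  (\int[mu]_(w in E) (A w)%:E = \int[mu]_(w in E) (A' w)%:E)%E ->
  (\int[mu]_(w in E) (A w)%:E < +oo)%E ->
  (\int[mu]_(w in E) (C w)%:E = \int[mu]_(w in E) (C' w)%:E)%E.
Proof.
move=> mE mA mA' mC mC' A0 A'0 C0 C'0 ACE AA' Afin.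
have AD (U V : T -> R) : measurable_fun E U -> measurable_fun E V ->
    (forall w, 0 <= U w) -> (forall w, 0 <= V w) ->
    (\int[mu]_(w in E) (U w + V w)%:E =
     \int[mu]_(w in E) (U w)%:E + \int[mu]_(w in E) (V w)%:E)%E.
  move=> mU mV U0 V0; under eq_integral do rewrite EFinD.
  by rewrite ge0_integralD//; try exact/measurable_EFinP; move=> w _; rewrite lee_fin.
have : (\int[mu]_(w in E) (A w + C w)%:E = \int[mu]_(w in E) (A' w + C' w)%:E)%E.
  by apply: eq_integral => w; rewrite inE => Ew; rewrite ACE.
rewrite !AD// -AA' => /(congr1 (fun z => z - \int[mu]_(w in E) (A w)%:E)%E).
rewrite ![(\int[mu]_(w in E) (A w)%:E + _)%E]addeC !addeK//.
all: by rewrite ge0_fin_numE// integral_ge0// => w _; rewrite lee_fin.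
Qed.

(** * Intermediate records given two others *)

Section gamma_window.
Context (R : realType).
Notation mu := (@lebesgue_measure R).

Lemma integral_is_derive (F f : R -> R) (a b : R) : a <= b ->
  (forall x : R, is_derive x 1 F (f x)) -> continuous f ->
  (\int[mu]_(x in `[a, b]) (f x)%:E = (F b - F a)%:E)%E.
Proof.
move=> ab dF cf; move: ab; rewrite le_eqVlt => /predU1P[<-|ab].
  by rewrite set_itv1 integral_set1 subrr.
have cF : continuous F.
  by move=> x; apply/differentiable_continuous/derivable1_diffP; apply: ex_derive; exact: dF.
rewrite (@continuous_FTC2 _ f F a b ab) ?EFinB//.
- exact: continuous_subspaceT.
- split.
  + by move=> x _; apply: ex_derive; exact: dF.
  + by apply: cvg_at_right_filter; exact: cF.
  + by apply: cvg_at_left_filter; exact: cF.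
- by move=> x _; rewrite derive1E; apply: derive_val; exact: dF.
Qed.

Lemma is_derive_subX (b x : R) n :
  is_derive x 1 (fun y => (y - b) ^+ n.+1) (n.+1%:R * (x - b) ^+ n).
Proof.
rewrite (_ : (fun y => _) = (id - cst b) ^+ n.+1); last by apply/funext => y; rewrite !fctE.
apply: (is_derive_cast (is_deriveX n.+1 (is_deriveB (is_derive_id x 1) (is_derive_cst b x 1)))).
by rewrite subr0 /GRing.scale /= mulr1.
Qed.

Lemma is_derive_Xsub (b x : R) n :
  is_derive x 1 (fun y => (b - y) ^+ n.+1) (- (n.+1%:R * (b - x) ^+ n)).
Proof.
rewrite (_ : (fun y => _) = (cst b - id) ^+ n.+1); last by apply/funext => y; rewrite !fctE.
apply: (is_derive_cast (is_deriveX n.+1 (is_deriveB (is_derive_cst b x 1) (is_derive_id x 1)))).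
by rewrite sub0r /GRing.scale /= mulrN mulr1.
Qed.

Lemma continuous_Xsub (b : R) n : continuous (fun s : R => (b - s) ^+ n).
Proof.
move=> x; apply: (@continuous_comp _ _ _ (fun s : R => b - s) (fun y => y ^+ n)).
  by apply: cvgB => //; exact: cvg_cst.
exact: exprn_continuous.
Qed.

Lemma integral_subX (a v : R) n : a <= v ->
  (\int[mu]_(s in `[a, v]) ((s - a) ^+ n)%:E = ((v - a) ^+ n.+1 / n.+1%:R)%:E)%E.
Proof.
move=> av.
transitivity (n.+1%:R^-1 * (v - a) ^+ n.+1 - n.+1%:R^-1 * (a - a) ^+ n.+1)%:E;
  first apply: (@integral_is_derive (fun s => n.+1%:R^-1 * (s - a) ^+ n.+1)) => //.
- move=> x; rewrite (_ : (fun y => _) = n.+1%:R^-1 *: (fun y => (y - a) ^+ n.+1))//.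
  apply: (is_derive_cast (is_deriveZ _ (is_derive_subX a x n))).
  by rewrite /GRing.scale /= mulKf// pnatr_eq0.
- exact: continuous_subX.
- by rewrite subrr expr0n mulr0 subr0 mulrC.
Qed.

Lemma integral_sub_Xsub (a v : R) n : a <= v ->
  (\int[mu]_(s in `[a, v]) ((s - a) * (v - s) ^+ n)%:E =
   ((v - a) ^+ n.+2 / (n.+1%:R * n.+2%:R))%:E)%E.
Proof.
move=> av.
(* One integration by parts gives this primitive; both of its terms vanish at v, and only the second
   survives at a. *)
pose f1 (s : R) := - n.+1%:R^-1 * ((s - a) * (v - s) ^+ n.+1).
pose F s : R := f1 s - (n.+1%:R * n.+2%:R)^-1 * (v - s) ^+ n.+2.
transitivity (F v - F a)%:E.
  apply: (@integral_is_derive F (fun s => (s - a) * (v - s) ^+ n) a v av).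
  - move=> x.
    rewrite (_ : F = (- n.+1%:R^-1) *: ((fun s => s - a) * (fun s => (v - s) ^+ n.+1))
        - (n.+1%:R * n.+2%:R)^-1 *: (fun s => (v - s) ^+ n.+2)); last first.
      by apply/funext => s; rewrite /F /f1 !fctE.
    have D0 : is_derive x 1 (fun s => s - a) 1.
      exact: (is_derive_subc a (is_derive_id x 1)).
    apply: (is_derive_cast (is_deriveB (is_deriveZ _ (is_deriveM D0 (is_derive_Xsub v x n)))
      (is_deriveZ _ (is_derive_Xsub v x n.+1)))).
    rewrite /GRing.scale /= mulr1.
    have n1 : n.+1%:R != 0 :> R by rewrite pnatr_eq0.
    have n2 : n.+2%:R != 0 :> R by rewrite pnatr_eq0.
    rewrite exprS; move: n1 n2; move: (n.+1%:R : R) (n.+2%:R : R) ((v - x) ^+ n) => c e q c0 e0.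
    by field; rewrite c0 e0.
  - move=> x; apply: cvgM; last exact: continuous_Xsub.
    by apply: cvgB; [exact: cvg_id|exact: cvg_cst].
rewrite /F /f1 !subrr !expr0n /= !(mul0r, mulr0).
by rewrite subr0 add0r sub0r opprK mulrC.
Qed.

(** The two exponentials multiply to [expR (- (v - a))], free of s, so only the powers weigh the
    intermediate position. *)
Lemma gpdf_window i j (a v : R) (h : R -> R) :
  measurable_fun setT h -> (forall s, 0 <= h s) ->
  (\int[mu]_s ((h s)%:E * (gpdf i (s - a) * gpdf j (v - s))%:E) =
   (expR (- (v - a)) / (i`! * j`!)%:R)%:E *
   \int[mu]_(s in `[a, v]) (h s * ((s - a) ^+ i * (v - s) ^+ j))%:E)%E.
Proof.
move=> mh h0.
have mX : measurable_fun setT (fun s => h s * ((s - a) ^+ i * (v - s) ^+ j)).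
  apply: measurable_funM => //; apply: measurable_funM.
    by apply: continuous_measurable_fun; exact: continuous_subX.
  by apply: continuous_measurable_fun; exact: continuous_Xsub.
rewrite -ge0_integralZl//; last 2 first.
- by apply/measurable_EFinP; exact: measurable_funTS.
- move=> s /=; rewrite in_itv/= => /andP[s1 s2].
  by rewrite lee_fin !mulr_ge0// exprn_ge0// subr_ge0.
rewrite [RHS]integral_mkcond; apply: eq_integral => s _.
rewrite patchE; case: ifPn => [|/negP]; rewrite inE/= in_itv/=.
  move=> /andP[s1 s2]; rewrite /gpdf !subr_ge0 s1 s2 -!EFinM natrM invfM.
  have -> : expR (- (v - a)) = expR (- (s - a)) * expR (- (v - s)) by rewrite -expRD; congr expR; ring.
  by congr (_%:E); ring.
move=> nav; rewrite -[point]/0%E /gpdf !subr_ge0.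
case: ifPn => s1; last by rewrite mul0r mule0.
case: ifPn => s2; last by rewrite mulr0 mule0.
by exfalso; apply: nav; rewrite s1.
Qed.

End gamma_window.

(** The integral of a nonnegative function is a supremum over the simple functions below it, so
    monotonicity does not involve measurability. In [rectangle_compare] the integrands are known
    explicitly only for p < a < v. *)
Lemma ge0_le_integralT d (T : measurableType d) (R : realType)
    (m : {measure set T -> \bar R}) (f g : T -> \bar R) :
  (forall x, 0 <= f x)%E -> (forall x, f x <= g x)%E ->
  (\int[m]_x f x <= \int[m]_x g x)%E.
Proof.
move=> f0 fg; have g0 x : (0 <= g x)%E by exact: le_trans (fg x).
rewrite !ge0_integralTE//; apply: ge_ereal_sup => _ [h hf <-].
by apply: ereal_sup_ubound; exists h => // x; exact: le_trans (fg x).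
Qed.

(** * From integrals over rectangles to pointwise inequalities *)

Section rectangles.
Context (R : realType).
Notation mu := (@lebesgue_measure R).
Variable nu : {finite_measure set R -> \bar R}.

Definition rectangle (a1 a2 v1 v2 : R) : set (R * R) :=
  `]a1, a2]%classic `*` `]v1, v2]%classic.

Lemma measurable_rectangle a1 a2 v1 v2 : measurable (rectangle a1 a2 v1 v2).
Proof. exact: measurableX. Qed.

Lemma integral_rectangle_cst (a1 a2 v1 v2 k : R) : v1 < v2 -> 0 <= k ->
  (\int[nu]_a \int[mu]_v ((\1_(rectangle a1 a2 v1 v2) (a, v))%:E * k%:E) =
   (k * (v2 - v1))%:E * nu `]a1, a2]%classic)%E.
Proof.
move=> v12 k0.
transitivity (\int[nu]_a ((k * (v2 - v1))%:E * (\1_(`]a1, a2]%classic) a)%:E))%E; last first.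
  rewrite ge0_integralZl//.
  - by rewrite integral_indic// setIT.
  - by apply/measurable_EFinP; exact: measurable_indic.
  - by rewrite lee_fin mulr_ge0// subr_ge0 ltW.
apply: eq_integral => a _.
transitivity (\int[mu]_v ((\1_(`]a1, a2]%classic) a * k)%:E * (\1_(`]v1, v2]%classic) v)%:E))%E.
  apply: eq_integral => v _.
  rewrite -!EFinM !indicE /rectangle in_setX /=.
  by do 2!case: (_ \in _); rewrite ?(mul0r, mul1r, mulr0, mulr1).
rewrite ge0_integralZl//.
- rewrite integral_indic// setIT [X in (_ * X)%E](_ : _ = (v2 - v1)%:E).
    by rewrite -!EFinM; congr (_%:E); ring.
  have := lebesgue_measure_itv `]v1, v2]; rewrite /= lte_fin v12 -EFinB; exact.
- by apply/measurable_EFinP; exact: measurable_indic.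
- by rewrite lee_fin mulr_ge0.
Qed.

(** If U1 < U2 at (a0, v0), left continuity yields a small rectangle on which constants k1 < k2
    separate them. Integrating there gives k2 <= k1, since the rectangle has positive finite
    mass. *)
Lemma rectangle_compare (p a0 v0 : R) (W1 W2 : R -> R -> \bar R) (U1 U2 : R * R -> R) :
  (forall q r, p < q -> q < r -> (0 < nu `]q, r]%classic)%E) ->
  (forall a v, 0 <= W1 a v)%E -> (forall a v, 0 <= W2 a v)%E ->
  (forall a v, p < a -> a < v -> W1 a v = (U1 (a, v))%:E) ->
  (forall a v, p < a -> a < v -> W2 a v = (U2 (a, v))%:E) ->
  (forall a1 a2 v1 v2, p < a1 -> a1 < a2 -> a2 <= v1 -> v1 < v2 ->
    (\int[nu]_a \int[mu]_v ((\1_(rectangle a1 a2 v1 v2) (a, v))%:E * W1 a v) =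
    \int[nu]_a \int[mu]_v ((\1_(rectangle a1 a2 v1 v2) (a, v))%:E * W2 a v))%E) ->
  p < a0 -> a0 < v0 ->
  U1 z @[z --> filter_prod (a0^'-) (v0^'-)] --> U1 (a0, v0) ->
  U2 z @[z --> filter_prod (a0^'-) (v0^'-)] --> U2 (a0, v0) ->
  U2 (a0, v0) <= U1 (a0, v0).
Proof.
move=> nu_gt0 W10 W20 W1E W2E WE pa av cU1 cU2; rewrite leNgt; apply/negP => U12.
pose k1 := (2 * U1 (a0, v0) + U2 (a0, v0)) / 3.
pose k2 := (U1 (a0, v0) + 2 * U2 (a0, v0)) / 3.
have U10 : 0 <= U1 (a0, v0) by rewrite -lee_fin -W1E.
have k12 : k1 < k2 by rewrite /k1 /k2; lra.
have k10 : 0 <= k1 by rewrite /k1; lra.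
have n1 : \forall z \near filter_prod (a0^'-) (v0^'-), U1 z < k1.
  by apply: (cvgr_lt _ cU1); rewrite /k1; lra.
have n2 : \forall z \near filter_prod (a0^'-) (v0^'-), k2 < U2 z.
  by apply: (cvgr_gt _ cU2); rewrite /k2; lra.
have [[A B] [/= hA hB] AB] := filterI n1 n2.
have /nbhs_ballP[eA /= eA0 {}hA] := hA; have /nbhs_ballP[eB /= eB0 {}hB] := hB.
pose e := Num.min (Num.min eA eB) (Num.min (a0 - p) (v0 - a0)).
have e0 : 0 < e by rewrite !lt_min eA0 eB0 !subr_gt0 pa av.
have [ea eb ep ev] : [/\ e <= eA, e <= eB, e <= a0 - p & e <= v0 - a0].
  by split; rewrite !ge_min lexx ?orbT.
(* Both sides end strictly before a0 and v0, as limits are known from the left only; the bounds on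
   [e] also keep p < a < v inside. *)
pose a1 := a0 - e / 2; pose a2 := a0 - e / 4; pose v1 := v0 - e / 2; pose v2 := v0 - e / 4.
have inside a v : rectangle a1 a2 v1 v2 (a, v) -> [/\ p < a, a < v, U1 (a, v) < k1 & k2 < U2 (a, v)].
  move=> [/=]; rewrite !in_itv/= /a1 /a2 /v1 /v2 => /andP[h1 h2] /andP[h3 h4].
  have [] : U1 (a, v) < k1 /\ k2 < U2 (a, v).
    have ha : ball a0 eA a by rewrite /ball/= ltr_norml; apply/andP; split; lra.
    have hv : ball v0 eB v by rewrite /ball/= ltr_norml; apply/andP; split; lra.
    by apply: (AB (a, v)); split => /=; [apply: hA => //; lra|apply: hB => //; lra].
  by split => //; lra.
have v12 : v1 < v2 by rewrite /v1 /v2; lra.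
have a12 : a1 < a2 by rewrite /a1 /a2; lra.
have pa1 : p < a1 by rewrite /a1; lra.
have nu12 := nu_gt0 _ _ pa1 a12.
have : ((k2 * (v2 - v1))%:E * nu `]a1, a2]%classic <= (k1 * (v2 - v1))%:E * nu `]a1, a2]%classic)%E.
  rewrite -!integral_rectangle_cst //; last by lra.
  apply: (@le_trans _ _ (\int[nu]_a \int[mu]_v ((\1_(rectangle a1 a2 v1 v2) (a, v))%:E * W2 a v))%E).
    apply: ge0_le_integralT => a.
      by apply: integral_ge0 => v _; rewrite -EFinM lee_fin mulr_ge0//; lra.
    apply: ge0_le_integralT => v; first by rewrite -EFinM lee_fin mulr_ge0//; lra.
    rewrite indicE; case: (boolP (_ \in _)); last by rewrite !mul0e.
    by rewrite inE => /inside[pa' av' _ h]; rewrite !mul1e W2E// lee_fin ltW.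
  rewrite -WE//; last by rewrite /a2 /v1; lra.
  apply: ge0_le_integralT => a.
    by apply: integral_ge0 => v _; rewrite mule_ge0// lee_fin.
  apply: ge0_le_integralT => v; first by rewrite mule_ge0// lee_fin.
  rewrite indicE; case: (boolP (_ \in _)); last by rewrite !mul0e.
  by rewrite inE => /inside[pa' av' h _]; rewrite !mul1e W1E// lee_fin ltW.
have nfin : nu `]a1, a2]%classic \is a fin_num by exact: fin_num_measure.
rewrite -(fineK nfin) -!EFinM lee_fin; rewrite -(fineK nfin) lte_fin in nu12.
by rewrite ler_pM2r// ler_pM2r ?subr_gt0// leNgt k12.
Qed.

End rectangles.

(** * Windows expressed by moments *)

Section window_moments.
Context (R : realType).
Notation mu := (@lebesgue_measure R).

Lemma integral_mom n (f : R -> R) p a v b : itv_integrable f -> p <= a -> a <= v ->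
  (\int[mu]_(s in `[a, v]) (f s * (s - b) ^+ n)%:E = (mom n f p v b - mom n f p a b)%:E)%E.
Proof.
move=> fi pa av.
have fXi := itv_integrableM (@continuous_subX _ b n) fi.
rewrite -[LHS]fineK; last by apply: integrable_fin_num => //; exact: fXi.
congr (_%:E); rewrite /mom Rintegral_itvB ?bnd_simp//.
rewrite Rintegral_itv_obnd_cbnd//.
apply: integrableS (fXi a v) => //.
by apply: subset_itvr; rewrite bnd_simp.
Qed.

(** The result of integrating out the position s of an intermediate record between a and v, in the
    form of [gpdf_window]. The indices [N 0] place it at record n, the indices [0 N] at record m. *)
Definition window i j (h : R * R -> R) (a v : R) : \bar R :=
  ((expR (- (v - a)) / (i`! * j`!)%:R)%:E *
   \int[mu]_(s in `[a, v]) (h (a, s) * ((s - a) ^+ i * (v - s) ^+ j))%:E)%E.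

Lemma window_ge0 i j h a v : (forall z, 0 <= h z) -> (0 <= window i j h a v)%E.
Proof.
move=> h0; apply: mule_ge0; first by rewrite lee_fin divr_ge0// expR_ge0.
apply: integral_ge0 => s /=; rewrite in_itv/= => /andP[s1 s2].
by rewrite lee_fin !mulr_ge0// exprn_ge0// subr_ge0.
Qed.

Section smooth_window.
Variables (g : R -> R) (p : R) (N : nat).
Hypothesis gi : itv_integrable g.

(** The real values of the windows, to which continuity arguments apply. [lower_moment] is built
    from moments of g alone, while [upper_moment] also contains [g z.1] and takes over its left
    continuity. *)
Definition upper_moment (z : R * R) : R :=
  expR (- (z.2 - z.1)) / N`!%:R *
  (mom N g p z.2 z.1 - mom N g p z.1 z.1 +
   N%:R * g z.1 * ((z.2 - z.1) ^+ N.+1 / N.+1%:R)).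

Definition lower_moment (z : R * R) : R :=
  expR (- (z.2 - z.1)) / N`!%:R *
  (N.+1%:R * ((-1) ^+ N * (mom N g p z.2 z.2 - mom N g p z.1 z.2))).

Lemma window_upper_moment a v : (forall s, 0 <= g s) -> p < a -> a < v ->
  window N 0 (fun z => g z.2 + N%:R * g z.1) a v = (upper_moment (a, v))%:E.
Proof.
move=> g0 pa av; rewrite /window fact0 muln1 /upper_moment/= [in RHS]EFinM; congr (_ * _)%E.
rewrite EFinD -(integral_mom N _ gi (ltW pa) (ltW av)).
transitivity (\int[mu]_(s in `[a, v]) ((g s * (s - a) ^+ N)%:E +
    (N%:R * g a)%:E * ((s - a) ^+ N)%:E))%E.
  by apply: eq_integral => s _; rewrite -EFinM -EFinD expr0 mulr1 mulrDl.
have mX : measurable_fun `[a, v] (fun s : R => (s - a) ^+ N).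
  by apply: measurable_funTS; apply: continuous_measurable_fun; exact: continuous_subX.
have X0 (s : R) : `[a, v]%classic s -> (0 <= ((s - a) ^+ N)%:E)%E.
  by rewrite /= in_itv/= => /andP[s1 _]; rewrite lee_fin exprn_ge0// subr_ge0.
have Ng0 : 0 <= N%:R * g a by rewrite mulr_ge0.
rewrite ge0_integralD//.
- congr (_ + _)%E; rewrite ge0_integralZl//.
  + by rewrite integral_subX ?(ltW av)// -EFinM.
  + exact/measurable_EFinP.
- by move=> s s1; rewrite EFinM mule_ge0 ?X0// lee_fin.
- by apply: (measurable_int mu); apply: (itv_integrableM (@continuous_subX _ a N) gi a v).
- by move=> s s1; rewrite mule_ge0 ?X0.
- by apply: emeasurable_funM => //; exact/measurable_EFinP.
Qed.

Lemma window_lower_moment a v : p < a -> a < v ->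
  window 0 N (fun z => N.+1%:R * g z.2) a v = (lower_moment (a, v))%:E.
Proof.
move=> pa av; rewrite /window fact0 mul1n /lower_moment/= [in RHS]EFinM; congr (_ * _)%E.
rewrite mulrA EFinM -(integral_mom N _ gi (ltW pa) (ltW av)) -integralZl//; last first.
  exact: (itv_integrableM (@continuous_subX _ v N) gi a v).
apply: eq_integral => s _; rewrite -EFinM; congr (_%:E).
have -> : (v - s) ^+ N = (-1) ^+ N * (s - v) ^+ N by rewrite -exprMn mulN1r opprB.
by rewrite expr0 mul1r; ring.
Qed.

Let cvg_left1 (a v : R) : z.1 @[z --> filter_prod (a^'-) (v^'-)] --> a.
Proof. by apply: cvg_trans (@cvg_fst _ _ _ _ _) _; exact: cvg_within. Qed.

Let cvg_left2 (a v : R) : z.2 @[z --> filter_prod (a^'-) (v^'-)] --> v.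
Proof. by apply: cvg_trans (@cvg_snd _ _ _ _ _) _; exact: cvg_within. Qed.

Let cvg_mom (u h : R * R -> R) (a v x b : R) : p < x ->
  u z @[z --> filter_prod (a^'-) (v^'-)] --> x ->
  h z @[z --> filter_prod (a^'-) (v^'-)] --> b ->
  mom N g p (u z) (h z) @[z --> filter_prod (a^'-) (v^'-)] --> mom N g p x b.
Proof.
move=> px cu ch.
apply: (@cvg_comp _ _ _ (fun z => (u z, h z)) (fun z => mom N g p z.1 z.2) _ (nbhs (x, b))).
  exact: (cvg_pair cu ch).
exact: mom_continuous.
Qed.

Let cvg_factor (a v : R) :
  expR (- (z.2 - z.1)) / N`!%:R @[z --> filter_prod (a^'-) (v^'-)] -->
  expR (- (v - a)) / N`!%:R.
Proof.
apply: cvgMl.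
apply: (@cvg_comp _ _ _ (fun z : R * R => - (z.2 - z.1)) expR _ (nbhs (- (v - a)))).
  by apply: cvgN; apply: cvgB.
exact: continuous_expR.
Qed.

Lemma lower_moment_left_continuous a v : p < a -> a < v ->
  lower_moment z @[z --> filter_prod (a^'-) (v^'-)] --> lower_moment (a, v).
Proof.
move=> pa av; have pv := lt_trans pa av.
apply: cvgM; first exact: cvg_factor.
by apply: cvgMr; apply: cvgMr; apply: cvgB; apply: cvg_mom.
Qed.

Lemma upper_moment_left_continuous a v : p < a -> a < v ->
  g x @[x --> a^'-] --> g a ->
  upper_moment z @[z --> filter_prod (a^'-) (v^'-)] --> upper_moment (a, v).
Proof.
move=> pa av ga; have pv := lt_trans pa av.
apply: cvgM; first exact: cvg_factor.
apply: cvgD; first by apply: cvgB; apply: cvg_mom.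
apply: cvgM.
  apply: cvgMr; apply: (@cvg_comp _ _ _ (fun z : R * R => z.1) g _ (a^'-)) => //.
  exact: cvg_fst.
apply: cvgMl.
apply: (@cvg_comp _ _ _ (fun z : R * R => z.2 - z.1) (fun y => y ^+ N.+1) _ (nbhs (v - a))).
  exact: cvgB.
exact: exprn_continuous.
Qed.

End smooth_window.
End window_moments.

(** * The characterization *)

Section records_exponential.
Context (R : realType) d (T : measurableType d) (P : probability T R).
Variable X : nat -> {RV P >-> R}.
Variable F : R -> R.
Hypothesis X_indep : mutually_independent P (fun j => X j.+1 : T -> R).
Hypothesis X_cdf : forall j x, cdf (X j.+1) x = (F x)%:E.
Hypothesis F_ac : distribution P (X 1%N) `<< (@lebesgue_measure R).
Notation mu := (@lebesgue_measure R).
Notation Rec := (record_value (fun j => X j : T -> R)).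
Notation G := (Gam X (Hexp F)).

Let mH : measurable_fun setT (Hexp F) := measurable_Hexp X_cdf.
Let mV : measurable (regular F) := measurable_regular X_cdf.
Let XV := prob_nonregular X_cdf F_ac.
Let H_ge0 : forall x, 0 <= Hexp F x := Hexp_ge0 X_cdf.
Let XH := prob_Hexp_gt X_cdf F_ac.
Let X_gt := prob_gt_Hexp X_cdf.

Let H_homo x y : regular F x -> regular F y -> x <= y -> Hexp F x <= Hexp F y.
Proof. by move=> _ [/andP[_ F1] _]; exact: (Hexp_homo X_cdf). Qed.

Lemma record_value_homo w : {homo (fun k => Rec k w) : i j / (i <= j)%N >-> i <= j}.
Proof.
apply: homo_leq => //; first by move=> ? ? ?; exact: le_trans.
move=> [|k]; first by [].
exact: (le_next_record (X ^~ w)).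
Qed.

(** On this almost sure event every observation, hence every record, is recovered from its image
    under [Hexp], and statements about records become statements about [Gam]. *)
Definition all_regular : set T := \bigcap_j (X j.+1 @^-1` regular F).

Lemma measurable_all_regular : measurable all_regular.
Proof. by apply: bigcap_measurableType => j _; exact: measurable_RV. Qed.

Lemma prob_not_all_regular : P (~` all_regular) = 0%E.
Proof.
rewrite setC_bigcap; apply/eqP; rewrite eq_le measure_ge0 andbT.
have mj j : measurable (~` (X j.+1 @^-1` regular F)).
  by apply: measurableC; exact: measurable_RV.
apply: le_trans (measure_sigma_subadditive P mj _ (@subset_refl _ _)) _.
  exact: bigcup_measurable.
by rewrite eseries0// => j _ _; exact: (XV j).
Qed.

Lemma record_value_regular w k : all_regular w -> regular F (Rec k w).
Proof.
move=> wr; rewrite /record_value.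
have := record_time_gt0 (X ^~ w) k; case: (record_time _ _) => // j _.
exact: (wr j).
Qed.

Lemma law_window p i j (h : R * R -> R) (D : set (R * R)) :
  measurable_fun setT h -> (forall z, 0 <= h z) -> measurable D ->
  (\int[P]_(w in (fun w => (G p w, G (p + i.+1 + j.+1) w)) @^-1` D)
      (h (G p w, G (p + i.+1) w))%:E =
   \int[event_law P measurableT (measurable_Gam X mH p)]_a
     \int[mu]_v ((\1_D (a, v))%:E * window i j h a v))%E.
Proof.
move=> mh h0 mD.
pose f (z : R * (R * R)) : \bar R := (h (z.1, z.2.1) * \1_D (z.1, z.2.2))%:E.
have m2 : measurable_fun setT (fun z : R * (R * R) => (z.1, z.2.2)).
  by apply: measurable_fun_pair => //; exact: (measurableT_comp measurable_snd).
have m1 : measurable_fun setT (fun z : R * (R * R) => (z.1, z.2.1)).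
  by apply: measurable_fun_pair => //; exact: (measurableT_comp measurable_fst).
have mf : measurable_fun setT f.
  apply/measurable_EFinP; apply: measurable_funM; first exact: (measurableT_comp mh).
  by apply: (@measurableT_comp _ _ _ _ _ _ (\1_D : R * R -> R)) => //; exact: measurable_indic.
have f0 z : (0 <= f z)%E by rewrite lee_fin mulr_ge0// indicE.
transitivity (\int[P]_w f (G p w, (G (p + i.+1) w, G (p + i.+1 + j.+1) w)))%E.
  rewrite integral_mkcond; apply: eq_integral => w _.
  rewrite /f /= indicE patchE [in LHS](_ : (w \in _) = ((G p w, G (p + i.+1 + j.+1) w) \in D)); last first.
    by apply/idP/idP; rewrite !inE.
  by case: (_ \in D); rewrite ?mulr1// mulr0.
rewrite (law_Gam3_density X_indep mH mV XV H_ge0 H_homo XH X_gt p i j mf f0).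
apply: eq_integral => a _; apply: eq_integral => v _.
rewrite /f /window /= -(gpdf_window i j a v (h := fun s => h (a, s)))//; last first.
  by apply: (measurableT_comp mh); exact: measurable_fun_pair.
rewrite -ge0_integralZl//.
- by apply: eq_integral => s _; rewrite EFinM -muleA [RHS]muleCA.
- apply: emeasurable_funM; apply/measurable_EFinP.
    by apply: (measurableT_comp mh); exact: measurable_fun_pair.
  apply: measurable_funM; apply: (measurableT_comp (measurable_gpdf _)).
    by apply: measurable_funB.
  by apply: measurable_funB.
- by move=> s _; rewrite -EFinM lee_fin mulr_ge0// mulr_ge0// gpdf_ge0.
Qed.

Definition gap (z : R * R) : R := Num.max (z.2 - z.1) 0.

Lemma gap_ge0 z : 0 <= gap z.
Proof. by rewrite le_max lexx orbT. Qed.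

Lemma measurable_gap : measurable_fun setT gap.
Proof. by apply: measurable_maxr => //; apply: measurable_funB. Qed.

(** Both sides reduce to Beta integrals. In terms of records: given the outer two, the N + 2
    spacings between them are exchangeable, so N + 1 of them average N + 1 times a single one. *)
Lemma window_gap N a v :
  window N 0 gap a v = window 0 N (fun z => N.+1%:R * gap z) a v.
Proof.
rewrite /window fact0 muln1 mul1n; congr (_ * _)%E.
have [va|av] := ltP v a; first by rewrite set_itv_ge ?bnd_simp -?ltNge// !integral_set0.
transitivity (\int[mu]_(s in `[a, v]) ((s - a) ^+ N.+1)%:E)%E.
  apply: eq_integral => s; rewrite inE/= in_itv/= => /andP[s1 _].
  by rewrite /gap /= max_l ?subr_ge0// expr0 mulr1 exprS.
rewrite integral_subX//.
transitivity (N.+1%:R%:E * \int[mu]_(s in `[a, v]) ((s - a) * (v - s) ^+ N)%:E)%E; last first.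
  rewrite -ge0_integralZl//.
  - apply: eq_integral => s; rewrite inE/= in_itv/= => /andP[s1 _].
    by rewrite /gap /= max_l ?subr_ge0// expr0 mul1r -EFinM mulrA.
  - apply/measurable_EFinP; apply: measurable_funTS; apply: continuous_measurable_fun => x.
    apply: cvgM; last exact: continuous_Xsub.
    by apply: cvgB; [exact: cvg_id|exact: cvg_cst].
  - move=> s /=; rewrite in_itv/= => /andP[s1 s2].
    by rewrite lee_fin mulr_ge0 ?exprn_ge0 ?subr_ge0.
rewrite integral_sub_Xsub// -EFinM; congr (_%:E).
by rewrite invfM [N.+1%:R * _]mulrCA mulVKf ?pnatr_eq0.
Qed.

Lemma integral_gap p N (D : set (R * R)) : measurable D ->
  (\int[P]_(w in (fun w => (G p w, G (p + N.+2) w)) @^-1` D)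
      (gap (G p w, G (p + N.+1) w))%:E =
   \int[P]_(w in (fun w => (G p w, G (p + N.+2) w)) @^-1` D)
      (N.+1%:R * gap (G p w, G p.+1 w))%:E)%E.
Proof.
move=> mD.
have := law_window p N 0 measurable_gap gap_ge0 mD.
rewrite -addnA addn1 => ->.
have mgap : measurable_fun setT (fun z => N.+1%:R * gap z).
  by apply: measurable_funM => //; exact: measurable_gap.
have gap0 z : 0 <= N.+1%:R * gap z by rewrite mulr_ge0// gap_ge0.
have := law_window p 0 N mgap gap0 mD.
rewrite -addnA add1n addn1 => ->.
by apply: eq_integral => a _; apply: eq_integral => v _; rewrite window_gap.
Qed.

(** The gap is a gamma variable of mean N + 1, because x times [gpdf N x] is N + 1 times
    [gpdf N.+1 x]. Finiteness is what [ge0_integral_cancel] requires. *)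
Lemma integral_gap_lty p N (D : set T) : measurable D ->
  (\int[P]_(w in D) (gap (G p w, G (p + N.+1) w))%:E < +oo)%E.
Proof.
move=> mD.
pose f (z : R * (R * R)) : \bar R := (Num.max z.2.1 0)%:E.
have mf : measurable_fun setT f.
  apply/measurable_EFinP; apply: measurable_maxr => //.
  exact: (measurableT_comp measurable_fst).
have f0 z : (0 <= f z)%E by rewrite lee_fin le_max lexx orbT.
have mG2 : measurable_fun setT (fun w => (gap (G p w, G (p + N.+1) w))%:E).
  apply/measurable_EFinP; apply: (measurableT_comp measurable_gap).
  by apply: measurable_fun_pair; exact: measurable_Gam.
apply: (@le_lt_trans _ _ (\int[P]_w (gap (G p w, G (p + N.+1) w))%:E)%E).
  by apply: ge0_subset_integral => // w _; rewrite lee_fin gap_ge0.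
have -> : (\int[P]_w (gap (G p w, G (p + N.+1) w))%:E =
    \int[P]_w f (G p w, ((G (p + N.+1) w - G p w)%R,
      (G (p + N.+1 + 1) w - G (p + N.+1) w)%R)))%E by [].
rewrite (law_Gam3 X_indep mH mV XV H_ge0 H_homo XH X_gt p N 0 mf f0).
have E a : (\int[gam N]_x \int[@gam R 0]_y f (a, (x, y)) = N.+1%:R%:E)%E.
  have E0 x : (\int[@gam R 0]_y f (a, (x, y)) = (Num.max x 0)%:E)%E.
    rewrite /f/= integral_cst//.
    by rewrite [X in (_ * X)%E](_ : _ = 1%E) ?mule1//; exact: probability_setT.
  under eq_integral do rewrite E0.
  rewrite (@ge0_integral_gam R N (fun x => (Num.max x 0)%:E)); last first.
  - by move=> x; rewrite lee_fin le_max lexx orbT.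
  - by apply/measurable_EFinP; exact: measurable_maxr.
  transitivity (\int[mu]_x (N.+1%:R%:E * (gpdf N.+1 x)%:E))%E; last first.
    rewrite ge0_integralZl// ?integral_gpdf ?mule1//.
      by apply/measurable_EFinP; exact: measurable_gpdf.
    by move=> x _; rewrite lee_fin gpdf_ge0.
  apply: eq_integral => x _.
  rewrite -!EFinM; congr (_%:E).
  rewrite /gpdf; case: ifP => x0; last by rewrite !mulr0.
  rewrite max_l// factS natrM invfM exprS.
  have N1 : N.+1%:R != 0 :> R by rewrite pnatr_eq0.
  by move: N1; move: (N.+1%:R : R) (N`!%:R^-1 : R) => c e c0; field.
under eq_integral do rewrite E.
rewrite integral_cst// ltey_eq fin_numM// fin_num_measure//.
Qed.

Lemma integral_setI_all_regular A (f : T -> R) : measurable A ->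
  measurable_fun setT f -> (forall w, 0 <= f w) ->
  (\int[P]_(w in A `&` all_regular) (f w)%:E = \int[P]_(w in A) (f w)%:E)%E.
Proof.
move=> mA mf f0; have mO := measurable_all_regular.
rewrite [in RHS](_ : A = (A `&` all_regular) `|` (A `\` all_regular)); last by rewrite setUIDK.
have mAO : measurable (A `\` all_regular) by exact: measurableD.
have AO : P (A `\` all_regular) = 0%E.
  apply: (subset_measure0 mAO (measurableC mO) _ prob_not_all_regular).
  by move=> w [].
rewrite ge0_integral_setU//.
- rewrite [X in (_ + X)%E]null_set_integral ?adde0//.
  by apply/measurable_EFinP; exact: measurable_funTS.
- exact: measurableI.
- by apply/measurable_EFinP; exact: measurable_funTS.
- by move=> w _; rewrite lee_fin.
- by apply/disj_setPS => w [[_ ?] [_]].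
Qed.

(** * Exponential F gives equal conditional expectations *)

Section exponential_records.
Variables (lF c : R) (p N : nat).
Hypothesis c_gt0 : 0 < c.
Hypothesis F_exp : forall x, lF <= x -> F x = 1 - expR (- c * (x - lF)).

Lemma regular_exponential x : regular F x -> x = lF + c^-1 * Hexp F x.
Proof.
move=> [/andP[Fx0 _] _].
have lx : lF <= x.
  rewrite leNgt; apply/negP => /ltW /(F_homo X_cdf).
  by rewrite (F_exp (lexx lF)) subrr mulr0 expR0 subrr leNgt Fx0.
rewrite /Hexp F_exp// subKr expRK; field.
exact: lt0r_neq0.
Qed.

Let Z w := (Rec p.+1 w, Rec (p + N.+3) w).
Let Y1 w := Rec (p + N.+2) w - N%:R * Rec p.+2 w.
Let Y2 w := Rec p.+2 w - N%:R * Rec p.+1 w.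

Let mRec k : measurable_fun setT (Rec k) := measurable_record_value X k.
Let mZ : measurable_fun setT Z.
Proof. by apply: measurable_fun_pair. Qed.
Let mY1 : measurable_fun setT Y1.
Proof. by apply: measurable_funB => //; exact: measurable_funM. Qed.
Let mY2 : measurable_fun setT Y2.
Proof. by apply: measurable_funB => //; exact: measurable_funM. Qed.

(** Intermediate records lie between the two components of [Z], which bounds the combination by a
    function of [Z]; 1 + x <= e^x turns this into an exponential bound. The sign [e] covers positive
    and negative parts at once. *)
Lemma record_combination_version (i j : nat) (e : R) : `|e| = 1 ->
  (p.+1 <= i <= p + N.+3)%N -> (p.+1 <= j <= p + N.+3)%N ->
  exists g, cond_expect_ge0 P
    (fun w => Num.max (e * (Rec i w - N%:R * Rec j w)) 0) Z g.
Proof.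
move=> e1 ip jp.
pose b (z : R * R) := N.+1%:R * (`|z.1| + `|z.2|).
apply: (@cond_expect_ge0_exists _ _ _ _ R P _ _ b).
- by apply: measurable_maxr => //; do 2![apply: measurable_funM => //; apply: measurable_funB => //].
- exact: mZ.
- apply: measurable_funM => //; apply: measurable_funD.
  + exact: (measurableT_comp (@normr_measurable R setT)).
  + exact: (measurableT_comp (@normr_measurable R setT)).
have le k w : (p.+1 <= k <= p + N.+3)%N -> `|Rec k w| <= `|(Z w).1| + `|(Z w).2|.
  move=> /andP[/(record_value_homo w) h1 /(record_value_homo w) h2] /=.
  exact: norm_le_between.
move=> w; rewrite le_max lexx orbT /= ge_max expR_ge0 andbT.
apply: (le_trans (ler_norm _)); rewrite normrM e1 mul1r.
apply: (@le_trans _ _ (b (Z w))); last by apply: le_trans (expR_ge1Dx _); rewrite lerDr.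
apply: (le_trans (ler_normB _ _)); rewrite /b -natr1 mulrDl mul1r addrC.
by rewrite lerD ?le// normrM ger0_norm// ler_wpM2l// le.
Qed.

(** On [all_regular], Y1 - Y2 equals [A w - A' w], a difference of rescaled gaps of [Gam]. By
    [integral_gap] these have equal finite integrals over every event about [Z]; cancelling them
    leaves the equality of the crossed sums of positive and negative parts. *)
Lemma exponential_cond_expect : exists g, cond_expect P Y1 Z g /\ cond_expect P Y2 Z g.
Proof.
have v i j : (p.+1 <= i <= p + N.+3)%N -> (p.+1 <= j <= p + N.+3)%N ->
    (exists g, cond_expect_ge0 P (fun w => Num.max (Rec i w - N%:R * Rec j w) 0) Z g) /\
    (exists g, cond_expect_ge0 P (fun w => Num.max (- (Rec i w - N%:R * Rec j w)) 0) Z g).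
  move=> ip jp; split.
    have [g hg] := record_combination_version (@normr1 R) ip jp; exists g.
    by move: hg; under eq_fun do rewrite mul1r.
  have [g hg] := record_combination_version (@normrN1 R) ip jp; exists g.
  by move: hg; under eq_fun do rewrite mulN1r.
have [[gp1 hp1] [gn1 hn1]] : _ /\ _ := v (p + N.+2)%N p.+2 ltac:(lia) ltac:(lia).
have [[gp2 hp2] [gn2 hn2]] : _ /\ _ := v p.+2 p.+1 ltac:(lia) ltac:(lia).
apply: (cond_expect_common mZ mY1 mY2 hp1 hn1 hp2 hn2) => B mB.
have pos_ge0 (y : R) : 0 <= Num.max y 0 by rewrite le_max lexx orbT.
have mpos (Y : T -> R) : measurable_fun setT Y -> measurable_fun setT (fun w => Num.max (Y w) 0).
  by move=> mY; apply: measurable_maxr.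
have mneg (Y : T -> R) : measurable_fun setT Y -> measurable_fun setT (fun w => Num.max (- Y w) 0).
  by move=> mY; apply: mpos; exact: measurable_funN.
have mC1 := measurable_funD (mpos _ mY1) (mneg _ mY2).
have mC2 := measurable_funD (mpos _ mY2) (mneg _ mY1).
have mZB := measurable_preimageT mZ mB.
have mO := measurable_all_regular.
rewrite -integral_setI_all_regular//; last by move=> w; rewrite addr_ge0.
rewrite -[RHS]integral_setI_all_regular//; last by move=> w; rewrite addr_ge0.
pose A w := c^-1 * gap (G p w, G (p + N.+1) w).
pose A' w := c^-1 * (N.+1%:R * gap (G p w, G p.+1 w)).
have mgG i j : measurable_fun setT (fun w => gap (G i w, G j w)).
  apply: (measurableT_comp measurable_gap); apply: measurable_fun_pair; exact: measurable_Gam.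
have mA : measurable_fun setT A by apply: measurable_funM.
have mA' : measurable_fun setT A' by do 2!apply: measurable_funM => //.
have c0 : 0 <= c^-1 by rewrite invr_ge0 ltW.
have A0 w : 0 <= A w by rewrite mulr_ge0// gap_ge0.
have A'0 w : 0 <= A' w by rewrite mulr_ge0// mulr_ge0// gap_ge0.
have RecE w k : all_regular w -> Rec k.+1 w = lF + c^-1 * G k w.
  by move=> wr; exact: (regular_exponential (record_value_regular k.+1 wr)).
(* [B] carried to the scale of [Gam] by the affine quantile function. *)
pose D := (fun z : R * R => (lF + c^-1 * z.1, lF + c^-1 * z.2)) @^-1` B.
have mD : measurable D.
  apply: measurable_preimageT => //; apply: measurable_fun_pair.
    by apply: measurable_funD => //; apply: measurable_funM.
  by apply: measurable_funD => //; apply: measurable_funM.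
have ZD : Z @^-1` B `&` all_regular =
    (fun w => (G p w, G (p + N.+2) w)) @^-1` D `&` all_regular.
  by apply/seteqP; split => w [+ wr]; rewrite /D /Z /= -!RecE// -addnS.
have mGD : measurable ((fun w => (G p w, G (p + N.+2) w)) @^-1` D).
  apply: measurable_preimageT => //; apply: measurable_fun_pair; exact: measurable_Gam.
have gl := integral_gap_lty p N mGD.
have intA : (\int[P]_(w in Z @^-1` B `&` all_regular) (A w)%:E =
    c^-1%:E * \int[P]_(w in (fun w => (G p w, G (p + N.+2) w)) @^-1` D)
       (gap (G p w, G (p + N.+1) w))%:E)%E.
  rewrite ZD integral_setI_all_regular//; under eq_integral do rewrite EFinM.
  rewrite ge0_integralZl//; first by apply/measurable_EFinP; exact: measurable_funTS.
  by move=> w _; rewrite lee_fin gap_ge0.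
apply: esym; apply: (ge0_integral_cancel (A := A) (A' := A')) => //.
- exact: measurableI.
- exact: measurable_funTS.
- exact: measurable_funTS.
- exact: measurable_funTS.
- exact: measurable_funTS.
- by move=> w; rewrite addr_ge0.
- by move=> w; rewrite addr_ge0.
- move=> w [_ wr].
  have maxB (y : R) : Num.max y 0 = y + Num.max (- y) 0.
    by have [?|?] := leP y 0; have [?|?] := leP (- y) 0; lra.
  have gapE k : (p.+1 <= k.+1)%N -> c^-1 * gap (G p w, G k w) = Rec k.+1 w - Rec p.+1 w.
    move=> /(record_value_homo w); rewrite !RecE// lerD2l ler_pM2l ?invr_gt0// => h.
    by rewrite /gap/= max_l ?subr_ge0//; ring.
  have e1 := gapE (p + N.+1)%N ltac:(lia); have e2 := gapE p.+1 ltac:(lia).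
  rewrite /A /A' mulrCA e1 e2 (maxB (Y1 w)) (maxB (Y2 w)) /Y1 /Y2 -addnS -natr1.
  ring.
- rewrite intA integral_gap// ZD integral_setI_all_regular//.
  under [RHS]eq_integral do rewrite EFinM.
  rewrite [RHS]ge0_integralZl//.
    by apply/measurable_EFinP; apply: measurable_funTS; exact: measurable_funM.
  by move=> w _; rewrite lee_fin mulr_ge0// gap_ge0.
- by rewrite intA lte_mul_pinfty.
Qed.

End exponential_records.

(** * Equal conditional expectations give an affine quantile function *)

Section affine_quantile.
Variables (lF : R) (p M : nat).
Let N := M.+1.
Hypothesis lF_def : left_endpoint F = lF%:E.

Let Z w := (Rec p.+1 w, Rec (p + N.+3) w).
Let Y1 w := Rec (p + N.+2) w - N%:R * Rec p.+2 w.
Let Y2 w := Rec p.+2 w - N%:R * Rec p.+1 w.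

Variables g1 g2 : R * R -> R.
Hypothesis cond1 : cond_expect P Y1 Z g1.
Hypothesis cond2 : cond_expect P Y2 Z g2.
Hypothesis g12 : forall u v, lF < u -> u < v -> g1 (u, v) = g2 (u, v).

Section truncation.
Variable q : R.
Hypothesis q_gt0 : 0 < q.

(* [Gexp F] may be unbounded near 0, so it is cut off at [q]. *)
Definition truncated s : R := if s <= q then 0 else Gexp F s - Gexp F q.

Lemma truncated_ge0 s : 0 <= truncated s.
Proof.
rewrite /truncated; case: (leP s q) => // qs.
by rewrite subr_ge0 ltW// (Gexp_lt X_cdf F_ac).
Qed.

Lemma truncatedE s : q < s -> truncated s = Gexp F s - Gexp F q.
Proof. by move=> qs; rewrite /truncated leNgt qs. Qed.

Lemma truncated_homo : {homo truncated : x y / x <= y}.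
Proof.
move=> x y xy; rewrite {1}/truncated; case: (leP x q) => [_|qx]; first exact: truncated_ge0.
rewrite (truncatedE (lt_le_trans qx xy)) lerD2r.
move: xy; rewrite le_eqVlt => /predU1P[->//|xy].
by rewrite ltW// (Gexp_lt X_cdf F_ac)// (lt_trans q_gt0).
Qed.

Lemma truncated_left_continuous s : q < s -> truncated x @[x --> s^'-] --> truncated s.
Proof.
move=> qs; rewrite truncatedE//.
have c : Gexp F x - Gexp F q @[x --> s^'-] --> Gexp F s - Gexp F q.
  apply: cvgB; last exact: cvg_cst.
  by apply: (Gexp_left_continuous X_cdf F_ac); exact: lt_trans qs.
apply: cvg_trans c; apply: near_eq_cvg; near=> x.
have qx : q < x by near: x; exact: nbhs_left_gt.
by rewrite truncatedE.
Unshelve. all: by end_near. Qed.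

Let measurable_truncated : measurable_fun setT truncated.
Proof. exact: (nondecreasing_measurable _ truncated_homo). Qed.

(** On the rectangle the records concerned lie beyond [q] in the scale of [Gam], where [truncated]
    is [Gexp F] minus a constant, and the constants cancel since 1 + N = N + 1. The combinations are
    bounded there, so their positive and negative parts can be cancelled. *)
Lemma integral_truncated a1 a2 v1 v2 : q < a1 -> a1 < a2 -> a2 <= v1 -> v1 < v2 ->
  (\int[P]_(w in (fun w => (G p w, G (p + N.+2) w)) @^-1` rectangle a1 a2 v1 v2)
     (truncated (G (p + N.+1) w) + N%:R * truncated (G p w))%:E =
   \int[P]_(w in (fun w => (G p w, G (p + N.+2) w)) @^-1` rectangle a1 a2 v1 v2)
     (N.+1%:R * truncated (G p.+1 w))%:E)%E.
Proof.
move=> qa1 a12 av1 v12.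
have mRec k : measurable_fun setT (Rec k) by exact: measurable_record_value.
have mZ : measurable_fun setT Z by apply: measurable_fun_pair.
have mY1 : measurable_fun setT Y1 by apply: measurable_funB => //; exact: measurable_funM.
have mY2 : measurable_fun setT Y2 by apply: measurable_funB => //; exact: measurable_funM.
have mO := measurable_all_regular.
(* The rectangle in the original scale. On it [g12] applies: lF < u because a1 > 0, and u < v
   because a2 <= v1. *)
pose B := ((Hexp F @^-1` `]a1, a2]) `&` regular F) `*` ((Hexp F @^-1` `]v1, v2]) `&` regular F).
have mB : measurable B.
  by apply: measurableX; apply: measurableI => //; exact: (measurable_preimageT mH).
have gB z : B z -> g1 z = g2 z.
  case: z => u v [[/=]]; rewrite !in_itv/= => /andP[u1 u2] ru [/andP[w1 w2] rv].
  have Hu : 0 < Hexp F u by rewrite (lt_trans q_gt0)// (lt_trans qa1).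
  apply: g12; first by rewrite -(Gexp_Hexp X_cdf F_ac ru) (left_endpoint_lt_Gexp X_cdf F_ac).
  rewrite -(Gexp_Hexp X_cdf F_ac ru) -(Gexp_Hexp X_cdf F_ac rv) (Gexp_lt X_cdf F_ac)//.
  by rewrite (le_lt_trans u2)// (le_lt_trans av1).
have := cond_expect_agree mZ mY1 mY2 cond1 cond2 mB gB.
have pos_ge0 (y : R) : 0 <= Num.max y 0 by rewrite le_max lexx orbT.
have mpos (Y : T -> R) : measurable_fun setT Y -> measurable_fun setT (fun w => Num.max (Y w) 0).
  by move=> mY; apply: measurable_maxr.
have mneg (Y : T -> R) : measurable_fun setT Y -> measurable_fun setT (fun w => Num.max (- Y w) 0).
  by move=> mY; apply: mpos; exact: measurable_funN.
have mC1 := measurable_funD (mpos _ mY1) (mneg _ mY2).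
have mC2 := measurable_funD (mpos _ mY2) (mneg _ mY1).
have mZB := measurable_preimageT mZ mB.
rewrite -integral_setI_all_regular//; last by move=> w; rewrite addr_ge0.
rewrite -[RHS]integral_setI_all_regular//; last by move=> w; rewrite addr_ge0.
set D := rectangle a1 a2 v1 v2.
have ZD : Z @^-1` B `&` all_regular =
    (fun w => (G p w, G (p + N.+2) w)) @^-1` D `&` all_regular.
  apply/seteqP; split => w [+ wr]; rewrite /D /B /Z /rectangle /Gam /= -!addnS.
    by move=> [[h1 _] [h2 _]].
  by move=> [h1 h2]; split => //; split; split => //; exact: record_value_regular.
have mG k : measurable_fun setT (G k) by exact: measurable_Gam.
have mGD : measurable ((fun w => (G p w, G (p + N.+2) w)) @^-1` D).
  by apply: measurable_preimageT; [exact: measurable_fun_pair|exact: measurable_rectangle].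
pose W1 w := truncated (G (p + N.+1) w) + N%:R * truncated (G p w).
pose W2 w := N.+1%:R * truncated (G p.+1 w).
have mtG k : measurable_fun setT (fun w => truncated (G k w)).
  exact: (measurableT_comp measurable_truncated).
have mW1 : measurable_fun setT W1 by apply: measurable_funD => //; exact: measurable_funM.
have mW2 : measurable_fun setT W2 by exact: measurable_funM.
have W10 w : 0 <= W1 w by rewrite addr_ge0 ?mulr_ge0 ?truncated_ge0.
have W20 w : 0 <= W2 w by rewrite mulr_ge0 ?truncated_ge0.
move=> C12.
rewrite -[in LHS](integral_setI_all_regular mGD mW1 W10).
rewrite -[in RHS](integral_setI_all_regular mGD mW2 W20) -ZD.
have RecE w k : all_regular w -> Rec k.+1 w = Gexp F (G k w).
  by move=> wr; rewrite /Gam (Gexp_Hexp X_cdf F_ac)//; exact: record_value_regular.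
have G_homo w : all_regular w -> {homo (fun k => G k w) : i j / (i <= j)%N >-> i <= j}.
  move=> wr i j ij; apply: H_homo; try exact: record_value_regular.
  exact: record_value_homo.
have bound w : (Z @^-1` B `&` all_regular) w ->
    forall k, (p <= k <= p + N.+2)%N -> a1 < G k w <= v2.
  rewrite ZD => -[[/=]]; rewrite !in_itv/= => /andP[h1 _] /andP[_ h2] wr k /andP[pk kp].
  by rewrite (lt_le_trans h1) ?G_homo//= (le_trans _ h2)// G_homo.
apply: (ge0_integral_cancel (A := fun w => Num.max (Y2 w) 0 + Num.max (- Y1 w) 0)
  (A' := fun w => Num.max (Y1 w) 0 + Num.max (- Y2 w) 0)) => //.
- exact: measurableI.
- exact: measurable_funTS.
- exact: measurable_funTS.
- exact: measurable_funTS.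
- exact: measurable_funTS.
- by move=> w; rewrite addr_ge0.
- by move=> w; rewrite addr_ge0.
- move=> w wB; have b := bound w wB; have wr := wB.2.
  have maxB (y : R) : Num.max y 0 = y + Num.max (- y) 0.
    by have [?|?] := leP y 0; have [?|?] := leP (- y) 0; lra.
  have tE k : (p <= k <= p + N.+2)%N -> truncated (G k w) = Rec k.+1 w - Gexp F q.
    by move=> /b/andP[h _]; rewrite truncatedE ?RecE// (lt_trans qa1).
  rewrite /W1 /W2 !tE; try lia.
  by rewrite (maxB (Y1 w)) (maxB (Y2 w)) /Y1 /Y2 -addnS -[N.+1%:R]natr1; ring.
pose K : R := `|Gexp F a1| + `|Gexp F v2|.
apply: (@le_lt_trans _ _ (\int[P]_(w in Z @^-1` B `&` all_regular) (2 * (N.+1%:R * K))%:E)%E); last first.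
  have mE : measurable (Z @^-1` B `&` all_regular) by exact: measurableI.
  by rewrite integral_cst// ltey_eq fin_numM// fin_num_measure.
apply: ge0_le_integral => //.
- exact: measurableI.
- by move=> w _; rewrite lee_fin addr_ge0.
- by apply/measurable_EFinP; exact: measurable_funTS.
- move=> w wB; have b := bound w wB; have wr := wB.2.
  have Rb k : (p <= k <= p + N.+2)%N -> `|Rec k.+1 w| <= K.
    move=> /b/andP[h1 h2]; rewrite RecE//.
    have Ga1 : Gexp F a1 <= Gexp F (G k w).
      by rewrite ltW// (Gexp_lt X_cdf F_ac)// (lt_trans q_gt0).
    have Gv2 : Gexp F (G k w) <= Gexp F v2.
      move: h2; rewrite le_eqVlt => /predU1P[->//|h2].
      by rewrite ltW// (Gexp_lt X_cdf F_ac)// (lt_trans q_gt0)// (lt_trans qa1).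
    exact: norm_le_between.
  have Yb i j : (p <= i <= p + N.+2)%N -> (p <= j <= p + N.+2)%N ->
      `|Rec i.+1 w - N%:R * Rec j.+1 w| <= N.+1%:R * K.
    move=> ip jp; apply: (le_trans (ler_normB _ _)); rewrite -natr1 mulrDl mul1r addrC.
    by rewrite lerD ?Rb// normrM ger0_norm// ler_wpM2l// Rb.
  have pb (y k : R) : `|y| <= k -> Num.max y 0 <= k.
    by move=> yk; rewrite ge_max (le_trans (ler_norm y) yk) (le_trans _ yk).
  have Y1b : `|Y1 w| <= N.+1%:R * K by rewrite /Y1 addnS; apply: Yb; lia.
  have Y2b : `|Y2 w| <= N.+1%:R * K by apply: Yb; lia.
  by rewrite lee_fin mulr_natl mulr2n; apply: lerD; apply: pb; rewrite ?normrN.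
Qed.

End truncation.

Lemma truncated_moments q a v : 0 < q -> q < a -> a < v ->
  upper_moment (truncated q) q N (a, v) = lower_moment (truncated q) q N (a, v).
Proof.
move=> q0 qa av.
pose t := truncated q.
have thomo : {homo t : x y / x <= y} := truncated_homo q0.
have t0 : forall s, 0 <= t s := truncated_ge0 q0.
have ti := itv_integrable_homo thomo.
have mt : measurable_fun setT t := nondecreasing_measurable measurableT thomo.
pose h1 (z : R * R) := t z.2 + N%:R * t z.1.
pose h2 (z : R * R) := N.+1%:R * t z.2.
have mh1 : measurable_fun setT h1.
  apply: measurable_funD; last apply: measurable_funM => //.
    exact: (measurableT_comp mt).
  exact: (measurableT_comp mt).
have mh2 : measurable_fun setT h2.
  by apply: measurable_funM => //; exact: (measurableT_comp mt).
have h10 z : 0 <= h1 z by rewrite addr_ge0// mulr_ge0.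
have h20 z : 0 <= h2 z by rewrite mulr_ge0.
pose nu : {finite_measure set R -> \bar R} := event_law P measurableT (measurable_Gam X mH p).
have nu_gt0 (x y : R) : q < x -> x < y -> (0 < nu `]x, y]%classic)%E.
  move=> qx xy; rewrite /nu /= /event_law setTI.
  apply: (Gam_prob_gt0 X_indep mH mV XV H_ge0 H_homo XH X_gt) => //.
  by rewrite ltW// (lt_trans q0).
have WE a1 a2 v1 v2 : q < a1 -> a1 < a2 -> a2 <= v1 -> v1 < v2 ->
    (\int[nu]_a \int[mu]_v ((\1_(rectangle a1 a2 v1 v2) (a, v))%:E * window N 0 h1 a v) =
     \int[nu]_a \int[mu]_v ((\1_(rectangle a1 a2 v1 v2) (a, v))%:E * window 0 N h2 a v))%E.
  move=> qa1 a12 av1 v12.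
  have mD := measurable_rectangle a1 a2 v1 v2.
  have := law_window p N 0 mh1 h10 mD; rewrite -addnA addn1 => <-.
  have := law_window p 0 N mh2 h20 mD; rewrite -addnA add1n addn1 => <-.
  exact: integral_truncated.
have W1E x y : q < x -> x < y -> window N 0 h1 x y = (upper_moment t q N (x, y))%:E.
  exact: window_upper_moment.
have W2E x y : q < x -> x < y -> window 0 N h2 x y = (lower_moment t q N (x, y))%:E.
  exact: window_lower_moment.
have ct : t x @[x --> a^'-] --> t a by exact: truncated_left_continuous.
have cU := upper_moment_left_continuous (N := N) ti qa av ct.
have cL := lower_moment_left_continuous (N := N) ti qa av.
have W10 x y : (0 <= window N 0 h1 x y)%E by exact: window_ge0.
have W20 x y : (0 <= window 0 N h2 x y)%E by exact: window_ge0.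
apply/eqP; rewrite eq_le; apply/andP; split.
  apply: (rectangle_compare nu_gt0 W20 W10 W2E W1E _ qa av cL cU).
  by move=> *; rewrite WE.
exact: (rectangle_compare nu_gt0 W10 W20 W1E W2E WE qa av cU cL).
Qed.

(** Any q in ]0, a[ would do. The factor common to both moments is nonzero and cancels, which leaves
    the functional equation for [truncated]; beyond q this differs from [Gexp F] by a constant. *)
Lemma Gexp_affine_above a : 0 < a ->
  exists b, forall v, a <= v -> Gexp F v = Gexp F a + b * (v - a).
Proof.
move=> a0; pose q := a / 2.
have q0 : 0 < q by rewrite divr_gt0.
have qa : q < a by rewrite /q; lra.
have ti := itv_integrable_homo (truncated_homo q0).
have [|b hb] := functional_equation_affine (M := M) ti _ qa.
  move=> x y qx xy; have := truncated_moments q0 qx xy.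
  rewrite /upper_moment /lower_moment /= => /mulfI -> //.
  by rewrite mulf_neq0 ?invr_eq0 ?pnatr_eq0 -?lt0n ?fact_gt0// gt_eqF ?expR_gt0.
exists b => v av; have := hb v av.
rewrite !truncatedE ?(lt_le_trans qa av)//; lra.
Qed.

Lemma Gexp_affine : exists al be, 0 < be /\ forall s, 0 < s -> Gexp F s = al + be * s.
Proof.
have [b hb] := Gexp_affine_above ltr01.
exists (Gexp F 1 - b), b; split.
  have := Gexp_lt X_cdf F_ac ltr01 (ltr1n R 2).
  by rewrite (hb 2) ?ler1n//; lra.
move=> s s0; have [/hb ->|/ltW s1] := leP 1 s; first by ring.
(* For s <= 1 the affine piece starting at s contains 1 and 2, where it agrees with the piece
   starting at 1. *)
have [c hc] := Gexp_affine_above s0.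
have := hc 1 s1; have := hc 2 (le_trans s1 (ler1n R 2)); rewrite (hb 2) ?ler1n//.
move=> e2 e1; have cb : c = b by lra.
by rewrite cb in e1; lra.
Qed.

Lemma exponential_of_cond_expect : exists2 c : R, 0 < c &
  forall x, lF <= x -> F x = 1 - expR (- c * (x - lF)).
Proof.
have [al [be [be0 GE]]] := Gexp_affine.
have lal : lF <= al.
  rewrite leNgt; apply/negP => al_lt.
  (* At this argument the affine formula gives the value [lF], which [Gexp F] strictly exceeds. *)
  have s0 : 0 < (lF - al) / be by rewrite divr_gt0// subr_gt0.
  have := left_endpoint_lt_Gexp X_cdf F_ac lF_def s0.
  by rewrite GE// [be * _]mulrC divfK ?gt_eqF// addrC subrK ltxx.
have Fal : F al = 0.
  apply/eqP; rewrite eq_le (F_ge0 X_cdf) andbT leNgt; apply/negP => Fal0.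
  (* From 1 - e^(-x) <= x at x = F al follows Gexp F (F al) <= al, against the positive slope of the
     affine formula. *)
  have : 1 - expR (- F al) <= F al by have := expR_ge1Dx (- F al); lra.
  by rewrite -(Gexp_le X_cdf F_ac)// GE// gerDl leNgt mulr_gt0.
have alE : al = lF.
  apply/eqP; rewrite eq_le lal andbT -lee_fin -lF_def.
  apply: le_ereal_inf_tmp => _ [x xsupp <-]; rewrite lee_fin leNgt; apply/negP => xal.
  (* With radius al - x the support condition at x asks for a value of F below F al = 0. *)
  have := xsupp (al - x); rewrite subr_gt0 => /(_ xal).
  by rewrite [x + (al - x)]addrC subrK Fal ltNge (F_ge0 X_cdf).
exists be^-1; first by rewrite invr_gt0.
move=> x; rewrite -alE le_eqVlt => /predU1P[<-|alx].
  by rewrite subrr mulr0 expR0 subrr Fal.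
have s0 : 0 < (x - al) / be by rewrite divr_gt0// subr_gt0.
have -> : x = Gexp F ((x - al) / be).
  by rewrite GE// [be * _]mulrC divfK ?gt_eqF// addrC subrK.
rewrite (F_Gexp X_cdf F_ac)// GE//; congr (1 - expR _).
by field; rewrite gt_eqF.
Qed.

End affine_quantile.
End records_exponential.

Theorem corollary4 (R : realType) (d : measure_display) (T : measurableType d)
    (P : probability T R) (X : nat -> {RV P >-> R}) (F : R -> R) (lF : R)
    (m n : nat)
    (X_indep : mutually_independent P (fun j => X j.+1 : T -> R))
    (X_cdf : forall (j : nat) (x : R), cdf (X j.+1) x = (F x)%:E)
    (F_ac : distribution P (X 1%N) `<< (@lebesgue_measure R))
    (lF_def : left_endpoint F = lF%:E)
    (m_ge2 : (2 <= m)%N) (m_le : (m <= n - 1)%N) :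
  let Rec := record_value (fun j => X j : T -> R) in
  let Z := fun w => (Rec (m - 1)%N w, Rec (n + 1)%N w) in
  (exists2 c : R, 0 < c &
     forall x : R, lF <= x -> F x = 1 - expR (- c * (x - lF)))
  <->
  (exists g1 g2 : R * R -> R,
     [/\ cond_expect P (fun w => Rec n w - (n - m)%:R * Rec m w) Z g1,
         cond_expect P (fun w => Rec m w - (n - m)%:R * Rec (m - 1)%N w) Z g2 &
         forall u v : R, lF < u -> u < v -> g1 (u, v) = g2 (u, v)]).
Proof.
move=> Rec Z; rewrite {}/Z.
(* The bound m >= 2 makes m - 1 = p + 1 a valid record number, and m <= n - 1 makes N = M + 1
   positive. *)
have [p [M [mE nE]]] : exists p M, m = p.+2 /\ n = (p + M.+3)%N.
  by exists (m - 2)%N, (n - m).-1; lia.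
have -> : (n - m)%N = M.+1 by lia.
have -> : (m - 1)%N = p.+1 by lia.
have -> : (n + 1)%N = (p + M.+4)%N by lia.
rewrite {}mE {}nE; split=> [[c c0 F_exp]|[g1 [g2 [cond1 cond2 g12]]]].
  have [g [hg1 hg2]] := exponential_cond_expect X_indep X_cdf F_ac p M.+1 c0 F_exp.
  by exists g, g; split.
exact: (exponential_of_cond_expect X_indep X_cdf F_ac lF_def cond1 cond2 g12).
Qed.
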